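(* For each $j\in\{1,\dots,n\}$, the Klein-Gordon position operator $Q_j$ on $L^2_r(\mathbb{R}^n)$ is closed and its spectrum is $\mathbb{R}$.
   Context: Fix $n\ge 1$ and $m>0$, and let $E(\vec p)=\sqrt{|\vec p|^2+m^2}$ for $\vec p\in\mathbb{R}^n$. Let $L^2_r(\mathbb{R}^n)=L^2(\mathbb{R}^n,d\vec p/E(\vec p))$, the Hilbert space of (complex) functions with norm $\|\phi\|_r=\left(\int|\phi(\vec p)|^2\,\frac{d\vec p}{E(\vec p)}\right)^{1/2}$. The Klein-Gordon position operators are the unbounded operators $Q_j$ ($1\le j\le n$) on $L^2_r(\mathbb{R}^n)$ given by $Q_j\phi=\mathrm{i}\,\partial\phi/\partial p_j$ ($\mathrm{i}=\sqrt{-1}$), whose domain $D(Q_j)$ is the set of $\phi\in L^2_r(\mathbb{R}^n)$ whose restrictions to lines parallel to the $j$th coordinate axis are almost all locally absolutely continuous (for a suitable representative of $\phi$), and which satisfy $\partial\phi/\partial p_j\in L^2_r(\mathbb{R}^n)$. *)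

(* Defs.v *)
From HB Require Import structures.
From mathcomp Require Import all_boot all_order all_algebra.
From mathcomp Require Import all_classical all_reals all_analysis.
From mathcomp Require Import measurable_realfun complex generic_quotient ring_quotient.

Set Implicit Arguments.
Unset Strict Implicit.
Unset Printing Implicit Defensive.
Import Order.TTheory GRing.Theory Num.Theory.
Import numFieldNormedType.Exports.
Import Normc.

Local Open Scope classical_set_scope.
Local Open Scope ring_scope.
Local Open Scope quotient_scope.
Local Open Scope complex_scope.

Section euclidean_lebesgue_measure.
Context {R : realType}.

Definition cons_coord n (x : measurableTypeR R * n.-tuple R) : n.+1.-tuple R :=
  [tuple of (x.1 : R) :: x.2].

Lemma measurable_cons_coord n : measurable_fun [set: _] (@cons_coord n).
Proof. exact: measurable_cons. Qed.

Section step.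
Context n (mu : {measure set (n.-tuple R) -> \bar R}).

Definition lebesgue_cons : set (n.+1.-tuple R) -> \bar R :=
  pushforward (@lebesgue_measure R \x^ mu)%E (@cons_coord n).

Let lebesgue_cons0 : lebesgue_cons set0 = 0%E.
Proof. by rewrite /lebesgue_cons /pushforward preimage_set0 measure0. Qed.

Let lebesgue_cons_ge0 A : (0 <= lebesgue_cons A)%E.
Proof. by rewrite /lebesgue_cons /pushforward; exact: measure_ge0. Qed.

Let lebesgue_cons_sigma_additive : semi_sigma_additive lebesgue_cons.
Proof.
apply: (@measure_semi_sigma_additive _ _ _
  (measure_function_pushforward__canonical__measure_function_Measure
     (@lebesgue_measure R \x^ mu)%E (@measurable_cons_coord n))).
Qed.

HB.instance Definition _ := isMeasure.Build _ _ _ lebesgue_cons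
  lebesgue_cons0 lebesgue_cons_ge0 lebesgue_cons_sigma_additive.

End step.

(* Lebesgue measure on the product (Borel) sigma-algebra of R^n, built one
   coordinate at a time; lebesgue_measure_n_box checks it on boxes. With \x^
   (instead of \x) the recursive factor need not be known to be
   sigma-finite. *)
Fixpoint lebesgue_measure_n n : {measure set (n.-tuple R) -> \bar R} :=
  if n is n'.+1 then
    [the measure _ _ of lebesgue_cons (lebesgue_measure_n n')]
  else [the measure _ _ of dirac [tuple]].

Lemma lebesgue_measure_n_box n (A : 'I_n -> set R) :
  (forall i, measurable (A i)) ->
  lebesgue_measure_n n [set p | forall i, A i (tnth p i)] =
  (\prod_(i < n) lebesgue_measure (A i))%E.
Proof.
elim: n A => [|n IHn] A mA /=.
  rewrite big_ord0 /dirac /= indicE mem_set//.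
  by case.
rewrite big_ord_recl /lebesgue_cons /pushforward.
set B : set (n.-tuple R) := [set p | forall i, A (lift ord0 i) (tnth p i)].
have mB : measurable B.
  rewrite (_ : B = \bigcap_(i in [set: 'I_n])
      ((fun p : n.-tuple R => tnth p i) @^-1` A (lift ord0 i))); last first.
    by apply/seteqP; split => [p Bp i _|p Bp i]; [exact: Bp|exact: Bp].
  apply: fin_bigcap_measurable => // i _.
  by rewrite -[X in measurable X]setTI; apply: measurable_tnth.
rewrite (_ : _ @^-1` _ = (A ord0 : set (measurableTypeR R)) `*` B); last first.
  apply/seteqP; split => [[x p]/= h|[x p]/= [h1 h2] i].
    split; first by have := h ord0; rewrite tnth0.
    by move=> i /=; have := h (lift ord0 i); rewrite tnthS.
  by case: (unliftP ord0 i) => [k|] ->; rewrite ?tnthS ?tnth0//; exact: h2.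
rewrite product_measure2E//; last exact: mA.
congr (_ * _)%E; exact: (IHn (fun i => A (lift ord0 i))) => i.
Qed.

End euclidean_lebesgue_measure.

Lemma measurable_sqrt (R : realType) :
  measurable_fun [set: R] (@Num.sqrt R).
Proof. by apply: continuous_measurable_fun => x; exact: sqrt_continuous. Qed.

Section complex_L2.
Context {R : realType} {n : nat} (m : {posnum R}).
Local Notation leb := (@lebesgue_measure_n R n).
Local Notation T := (n.-tuple R).
Local Notation C := (R[i]^o).

Definition energy (p : T) : R :=
  Num.sqrt (\sum_(i < n) tnth p i ^+ 2 + m%:num ^+ 2).

(* squared norm: integral of |phi p|^2 dp / E(p) *)
Definition sqintegral (phi : T -> C) : \bar R :=
  (\int[leb]_p (normc (phi p) ^+ 2 / energy p)%:E)%E.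

Definition cmeasurable (phi : T -> C) :=
  measurable_fun [set: T] (fun p => complex.Re (phi p)) /\
  measurable_fun [set: T] (fun p => complex.Im (phi p)).

(* Borel square-integrable functions; as every Lebesgue measurable function is
   almost everywhere equal to a Borel one, this gives all the classes of
   L^2(R^n, dp / E(p)). *)
Definition sqint : {pred T -> C} :=
  mem [set phi | cmeasurable phi /\ (sqintegral phi < +oo)%E].

Lemma energy_gt0 p : 0 < energy p.
Proof.
rewrite sqrtr_gt0 ltr_wpDl// ?exprn_gt0//.
by apply: sumr_ge0 => i _; exact: sqr_ge0.
Qed.

Lemma measurable_energy : measurable_fun [set: T] energy.
Proof.
apply: (@measurableT_comp _ _ _ _ _ _ (@Num.sqrt R)).
  exact: measurable_sqrt.
apply: measurable_funD => //; apply: measurable_sum => i.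
by apply: measurable_funX; exact: measurable_tnth.
Qed.

Definition weighted_modulus (phi : T -> C) (p : T) : R :=
  normc (phi p) / Num.sqrt (energy p).

Lemma measurable_weighted_modulus phi :
  cmeasurable phi -> measurable_fun [set: T] (weighted_modulus phi).
Proof.
move=> [mRe mIm].
rewrite (_ : weighted_modulus phi = fun p => Num.sqrt
  (complex.Re (phi p) ^+ 2 + complex.Im (phi p) ^+ 2) *
  (Num.sqrt (energy p))^-1); last first.
  by apply/funext => p; rewrite /weighted_modulus; case: (phi p).
apply: measurable_funM.
  apply: (@measurableT_comp _ _ _ _ _ _ (@Num.sqrt R)).
    exact: measurable_sqrt.
  by apply: measurable_funD; exact: measurable_funX.
rewrite (_ : (fun _ => _) = fun p => (Num.sqrt (energy p)) `^ (-1)); last first.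
  by apply/funext => p; rewrite powR_inv1// sqrtr_ge0.
apply: (measurableT_comp (measurable_powR _)).
apply: (@measurableT_comp _ _ _ _ _ _ (@Num.sqrt R)).
  exact: measurable_sqrt.
exact: measurable_energy.
Qed.

Lemma normc_ge0 (z : C) : 0 <= normc z.
Proof. by case: z => a b; exact: sqrtr_ge0. Qed.

Lemma weighted_modulus_ge0 phi p : 0 <= weighted_modulus phi p.
Proof. by rewrite divr_ge0 ?normc_ge0 ?sqrtr_ge0. Qed.

Lemma sqintegralE phi :
  sqintegral phi = (\int[leb]_p (weighted_modulus phi p ^+ 2)%:E)%E.
Proof.
apply: eq_integral => p _; rewrite /weighted_modulus exprMn exprVn sqr_sqrtr//.
exact/ltW/energy_gt0.
Qed.

Lemma sqintegral_Lnorm phi :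
  sqintegral phi = ('N[leb]_2%:E[EFin \o weighted_modulus phi] `^ 2)%E.
Proof.
rewrite powR_Lnorm// sqintegralE; apply: eq_integral => p _.
by rewrite /= powR_mulrn// ger0_norm ?weighted_modulus_ge0.
Qed.


Lemma Lnorm_weighted_modulus_lty phi :
  ('N[leb]_2%:E[EFin \o weighted_modulus phi] < +oo)%E <->
  (sqintegral phi < +oo)%E.
Proof.
rewrite sqintegral_Lnorm; split=> [h|]; first exact: poweR_lty.
by move=> h; apply: (@lty_poweRy _ _ 2).
Qed.

Lemma cmeasurable_lin a (f g : T -> C) : cmeasurable f -> cmeasurable g ->
  cmeasurable (a *: f + g).
Proof.
move=> [rf jf] [rg jg]; split.
  rewrite (_ : (fun _ => _) = fun p =>
    complex.Re a * complex.Re (f p) - complex.Im a * complex.Im (f p)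
    + complex.Re (g p)).
    by apply: measurable_funD => //; apply: measurable_funB; exact: measurable_funM.
  apply/funext => p; rewrite !fctE /GRing.scale/=.
  by case: a (f p) (g p) => [? ?] [? ?] [? ?].
rewrite (_ : (fun _ => _) = fun p =>
    complex.Re a * complex.Im (f p) + complex.Im a * complex.Re (f p)
    + complex.Im (g p)).
  by apply: measurable_funD => //; apply: measurable_funD; exact: measurable_funM.
apply/funext => p; rewrite !fctE /GRing.scale/=.
by case: a (f p) (g p) => [? ?] [? ?] [? ?].
Qed.

Lemma weighted_modulusD (f g : T -> C) p :
  weighted_modulus (f + g) p <= weighted_modulus f p + weighted_modulus g p.
Proof.
by rewrite -mulrDl ler_wpM2r ?invr_ge0 ?sqrtr_ge0//; exact: le_normcD.
Qed.

Lemma weighted_modulusZ a (f : T -> C) :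
  weighted_modulus (a *: f) = normc a \*o weighted_modulus f.
Proof. by apply/funext => p; rewrite /weighted_modulus /= normcM mulrA. Qed.

Lemma Lnorm_weighted_modulusD (f g : T -> C) :
  cmeasurable f -> cmeasurable g ->
  ('N[leb]_2%:E[EFin \o weighted_modulus (f + g)%R] <=
   'N[leb]_2%:E[EFin \o weighted_modulus f] +
   'N[leb]_2%:E[EFin \o weighted_modulus g])%E.
Proof.
move=> mf mg.
have mwf := measurable_weighted_modulus mf.
have mwg := measurable_weighted_modulus mg.
apply: le_trans (eminkowski leb mwf mwg _); last by rewrite lee_fin ler1n.
rewrite unlock /Lnorm.
have mw : measurable_fun [set: T] (weighted_modulus (f + g)).
  apply: measurable_weighted_modulus.
  by have := cmeasurable_lin 1 mf mg; rewrite scale1r.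
rewrite gt0_ler_poweR ?invr_ge0//.
- by rewrite in_itv/= leey integral_ge0.
- by rewrite in_itv/= leey integral_ge0.
rewrite ge0_le_integral//.
- by move=> p _; rewrite /= lee_fin powR_ge0.
- apply/measurable_EFinP.
  by apply: (measurableT_comp (measurable_powR _)); exact: measurableT_comp.
- apply/measurable_EFinP.
  apply: (measurableT_comp (measurable_powR _)); apply: measurableT_comp => //.
  exact: measurable_funD.
move=> p _; rewrite lee_fin; apply: ge0_ler_powR => //.
rewrite !ger0_norm /= ?addr_ge0 ?weighted_modulus_ge0//.
exact: weighted_modulusD.
Qed.

Lemma sqintegralZ a (f : T -> C) : cmeasurable f ->
  sqintegral (a *: f) = ((normc a ^+ 2)%:E * sqintegral f)%E.
Proof.
move=> mf; rewrite !sqintegralE -ge0_integralZl//.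
- apply: eq_integral => p _.
  by rewrite weighted_modulusZ /= exprMn EFinM.
- by apply/measurable_EFinP; apply: measurable_funX; exact: measurable_weighted_modulus.
- by move=> p _; rewrite lee_fin sqr_ge0.
- by rewrite lee_fin sqr_ge0.
Qed.

Lemma cmeasurable0 : cmeasurable (0 : T -> C).
Proof. by split; exact: measurable_cst. Qed.

Lemma sqint_submod_closed : submod_closed sqint.
Proof.
split.
  rewrite inE; split; first exact: cmeasurable0.
  rewrite /sqintegral integral0_eq// => p _.
  by rewrite (_ : (0 : T -> C) p = 0)// normc0 expr0n mul0r.
move=> a f g; rewrite !inE => -[mf lf] [mg lg].
have maf : cmeasurable (a *: f).
  by have := cmeasurable_lin a mf cmeasurable0; rewrite addr0.
split; first exact: cmeasurable_lin.
apply/Lnorm_weighted_modulus_lty.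
apply: (le_lt_trans (Lnorm_weighted_modulusD maf mg)).
rewrite lte_add_pinfty//; apply/Lnorm_weighted_modulus_lty => //.
by rewrite sqintegralZ// lte_mul_pinfty// lee_fin sqr_ge0.
Qed.

HB.instance Definition _ := GRing.isSubmodClosed.Build _ _ sqint
  sqint_submod_closed.

Record sqint_fun := SqintFun { sqint_val :> T -> C ; _ : sqint_val \in sqint }.

HB.instance Definition _ := [isSub for sqint_val].
HB.instance Definition _ := [Choice of sqint_fun by <:].
HB.instance Definition _ := [SubChoice_isSubLmodule of sqint_fun by <:].

(* The almost everywhere quantifiers are with respect to dp; dp and dp / E(p)
   have the same null sets since E > 0. *)
Definition null_fun : {pred sqint_fun} :=
  mem [set f : sqint_fun | \forall p \ae leb, f p = 0].

Lemma null_fun_zmod_closed : zmod_closed null_fun.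
Proof.
split; first by rewrite inE; apply: aeW.
move=> f g; rewrite !inE => f0 g0.
apply: filterS2 f0 g0 => p fp0 gp0.
by change (f p - g p = 0); rewrite fp0 gp0 subr0.
Qed.

HB.instance Definition _ := GRing.isZmodClosed.Build _ null_fun
  null_fun_zmod_closed.


Definition L2r := Quotient.quot null_fun.
HB.instance Definition _ := EqQuotient.on L2r.
HB.instance Definition _ := Choice.on L2r.
HB.instance Definition _ := GRing.Zmodule.on L2r.
HB.instance Definition _ := @isZmodQuotient.Build sqint_fun
  (Quotient.equiv null_fun) 0 -%R +%R L2r
  (@pi_zeror _ _ _ _ _ (Quotient.quot null_fun))
  (@pi_oppr _ _ _ _ _ (Quotient.quot null_fun))
  (@pi_addr _ _ _ _ _ (Quotient.quot null_fun)).

Lemma pi_L2r_eq (f g : sqint_fun) :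
  (\pi_L2r f = \pi_L2r g) <-> (\forall p \ae leb, f p = g p).
Proof.
split=> [/eqP|fg].
  rewrite -[_ == _]/(\pi_(Quotient.quot null_fun) f == \pi_(Quotient.quot null_fun) g).
  rewrite -Quotient.idealrBE inE; apply: filterS => p.
  by move=> h; apply/eqP; rewrite -subr_eq0; apply/eqP.
apply/eqP.
rewrite -[_ == _]/(\pi_(Quotient.quot null_fun) f == \pi_(Quotient.quot null_fun) g).
rewrite -Quotient.idealrBE inE; apply: filterS fg => p fgp.
by change (f p - g p = 0); rewrite fgp subrr.
Qed.

Lemma repr_L2r_pi (f : sqint_fun) : \forall p \ae leb, repr (\pi_L2r f) p = f p.
Proof. by apply/pi_L2r_eq; rewrite reprK. Qed.

Definition scale_L2r (a : R[i]) (phi : L2r) : L2r := \pi_L2r (a *: repr phi).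

Lemma scale_L2r_pi a (f : sqint_fun) :
  scale_L2r a (\pi_L2r f) = \pi_L2r (a *: f).
Proof.
apply/pi_L2r_eq; apply: filterS (repr_L2r_pi f) => p fp.
by change (a *: repr (\pi_L2r f) p = a *: f p); rewrite fp.
Qed.

Fact scale_L2rA a b phi : scale_L2r a (scale_L2r b phi) = scale_L2r (a * b) phi.
Proof. by rewrite -[phi]reprK (scale_L2r_pi b) !scale_L2r_pi scalerA. Qed.

Fact scale_L2r1 : left_id 1 scale_L2r.
Proof. by move=> phi; rewrite -[phi]reprK scale_L2r_pi scale1r. Qed.

Fact scale_L2rDr : right_distributive scale_L2r +%R.
Proof.
by move=> a x y; rewrite -[x]reprK -[y]reprK -pi_addr !scale_L2r_pi scalerDr pi_addr.
Qed.

Fact scale_L2rDl phi : {morph scale_L2r^~ phi : a b / a + b}.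
Proof.
by move=> a b; rewrite -[phi]reprK !scale_L2r_pi scalerDl pi_addr.
Qed.

HB.instance Definition _ := GRing.Zmodule_isLmodule.Build R[i] L2r
  scale_L2rA scale_L2r1 scale_L2rDr scale_L2rDl.

Definition norm_r (f : T -> C) : R := Num.sqrt (fine (sqintegral f)).

Lemma norm_rE (f : sqint_fun) :
  ((norm_r f)%:E = 'N[leb]_2%:E[EFin \o weighted_modulus f])%E.
Proof.
have := valP f; rewrite inE => -[_ /Lnorm_weighted_modulus_lty].
rewrite /norm_r sqintegral_Lnorm.
have := @Lnorm_ge0 _ _ _ leb 2%:E (EFin \o weighted_modulus f).
case: ('N[_]_2%:E[_])%E => //= r; rewrite lee_fin => r0 _.
by rewrite powR_mulrn// sqrtr_sqr ger0_norm.
Qed.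

Lemma norm_rD (f g : sqint_fun) : norm_r (f + g) <= norm_r f + norm_r g.
Proof.
rewrite -lee_fin EFinD (norm_rE (f + g)) !norm_rE.
apply: Lnorm_weighted_modulusD.
  by have := valP f; rewrite inE => -[].
by have := valP g; rewrite inE => -[].
Qed.

Lemma norm_rZ a (f : sqint_fun) : norm_r (a *: (f : T -> C)) = normc a * norm_r f.
Proof.
have := valP f; rewrite inE => -[mf lf].
rewrite /norm_r sqintegralZ//.
have : (0 <= sqintegral f)%E.
  apply: integral_ge0 => p _.
  by rewrite lee_fin divr_ge0 ?sqr_ge0// ltW// energy_gt0.
move: lf; rewrite /= -/(sqintegral f).
case: (sqintegral f) => //= r _; rewrite lee_fin => r0.
by rewrite sqrtrM ?sqr_ge0// sqrtr_sqr ger0_norm ?normc_ge0.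
Qed.

Lemma norm_r_eq0 (f : sqint_fun) :
  norm_r f = 0 <-> (\forall p \ae leb, f p = 0).
Proof.
have := valP f; rewrite inE => -[mf lf].
have mw := measurable_weighted_modulus mf.
have /(ae_eq_integral_abs leb measurableT) : measurable_fun [set: T]
    (fun p => (weighted_modulus f p ^+ 2)%:E).
  by apply/measurable_EFinP; exact: measurable_funX.
rewrite (_ : integral _ _ _ = sqintegral f); last first.
  by rewrite sqintegralE; apply: eq_integral => p _; rewrite gee0_abs ?lee_fin ?sqr_ge0.
move=> h.
have s0 : (0 <= sqintegral f)%E.
  apply: integral_ge0 => p _.
  by rewrite lee_fin divr_ge0 ?sqr_ge0// ltW// energy_gt0.
split=> [nf0|f0].
  have /h : sqintegral f = 0%E.
    move: nf0 s0 lf; rewrite /norm_r /= -/(sqintegral f).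
    case: (sqintegral f) => //= r; rewrite lee_fin => /eqP.
    rewrite sqrtr_eq0 => r0 r0' _; congr (_%:E).
    by apply/eqP; rewrite eq_le r0.
  apply: filterS => p /(_ I) [] /eqP.
  rewrite sqrf_eq0 mulf_eq0 invr_eq0 sqrtr_eq0 leNgt energy_gt0 orbF => /eqP.
  exact: eq0_normc.
rewrite /norm_r (_ : sqintegral _ = 0%E) ?sqrtr0//.
apply/h; apply: filterS f0 => p fp0 _.
by rewrite /weighted_modulus fp0 normc0 mul0r expr0n.
Qed.

Lemma eq_norm_r (f g : sqint_fun) :
  (\forall p \ae leb, f p = g p) -> norm_r f = norm_r g.
Proof.
move=> fg; congr Num.sqrt; congr fine.
have mf : cmeasurable f by have := valP f; rewrite inE => -[].
have mg : cmeasurable g by have := valP g; rewrite inE => -[].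
rewrite !sqintegralE; apply: ae_eq_integral => //.
- by apply/measurable_EFinP; apply: measurable_funX; exact: measurable_weighted_modulus.
- by apply/measurable_EFinP; apply: measurable_funX; exact: measurable_weighted_modulus.
- by apply: filterS fg => p fgp _; rewrite /weighted_modulus fgp.
Qed.

(* The norm of a normed module over R[i] takes its values in R[i]. *)
Definition norm_L2r (phi : L2r) : R[i] := (norm_r (repr phi))%:C.

Fact norm_L2rD phi psi : norm_L2r (phi + psi) <= norm_L2r phi + norm_L2r psi.
Proof.
rewrite -rmorphD/= lecR; apply: le_trans (norm_rD _ _).
rewrite le_eqVlt; apply/orP; left; apply/eqP; apply: (@eq_norm_r _ (_ + _)).
by apply/pi_L2r_eq; rewrite pi_addr !reprK.
Qed.

Fact norm_L2rZ a phi : norm_L2r (a *: phi) = `|a| * norm_L2r phi.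
Proof.
rewrite normc_def -rmorphM/= (_ : Num.sqrt _ = normc a); last by case: a.
rewrite -norm_rZ; congr (_%:C); apply: (@eq_norm_r _ (a *: _)).
by apply/pi_L2r_eq; rewrite reprK.
Qed.

Fact norm_L2r_eq0 phi : norm_L2r phi = 0 -> phi = 0.
Proof.
move=> [] /norm_r_eq0 phi0.
rewrite -[phi]reprK -[RHS](@pi_zeror _ _ _ _ _ L2r); exact/pi_L2r_eq.
Qed.

HB.instance Definition _ := Lmodule_isNormed.Build R[i] L2r
  norm_L2rD norm_L2rZ norm_L2r_eq0.

End complex_L2.

Arguments L2r {R} n m.

Section unbounded_operators.
Context {K : numFieldType} {V : normedModType K}.

(* The values of action outside of domain are irrelevant. *)
Record unbounded_operator :=
  UnboundedOperator { domain : set V ; action :> V -> V }.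

Definition operator_graph (A : unbounded_operator) : set (V * V) :=
  [set u | domain A u.1 /\ u.2 = A u.1].

Definition closed_operator (A : unbounded_operator) := closed (operator_graph A).

(* z such that A - z is a bijection of domain A onto V with bounded inverse B *)
Definition resolvent_set (A : unbounded_operator) : set K :=
  [set z | exists B : {linear V -> V},
    [/\ continuous B,
        (forall y, domain A (B y) /\ A (B y) - z *: B y = y) &
        (forall x, domain A x -> B (A x - z *: x) = x)]].

Definition spectrum (A : unbounded_operator) : set K := ~` resolvent_set A.

End unbounded_operators.
Arguments unbounded_operator {K} V.

Definition abs_continuous_on (R : realType) (a b : R) (g : R -> R[i]) :=
  forall eps : R, 0 < eps -> exists2 delta : R, 0 < delta &
    forall k (c d : 'I_k -> R),
      (forall i, [&& a <= c i, c i <= d i & d i <= b]) ->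
      trivIset [set: 'I_k] (fun i => `]c i, d i[%classic) ->
      \sum_(i < k) (d i - c i) < delta ->
      \sum_(i < k) normc (g (d i) - g (c i)) < eps.

Definition loc_abs_continuous (R : realType) (g : R -> R[i]) :=
  forall a b : R, abs_continuous_on a b g.

Section klein_gordon_position.
Context {R : realType} {n : nat}.
Local Notation T := (n.-tuple R).
Implicit Types (j : 'I_n) (f : T -> R[i]).

(* The lines parallel to the j-th axis are the maps t |-> insert_coord j q t;
   they are parametrized by the remaining coordinates q in R^(n-1). *)
Definition insert_coord j (q : n.-1.-tuple R) (t : R) : T :=
  [tuple if unlift j i is Some k then tnth q k else t | i < n].

Definition set_coord j (p : T) (t : R) : T :=
  [tuple if i == j then t else tnth p i | i < n].

(* Junk where the derivative does not exist; when f is locally absolutely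
   continuous on almost all lines this is a null set. *)
Definition partial_derivative j f (p : T) : R[i] :=
  derive1 (fun t => complex.Re (f (set_coord j p t))) (tnth p j) +i*
  derive1 (fun t => complex.Im (f (set_coord j p t))) (tnth p j).

(* chi is the class of d phi / d p_j, computed on a representative f of phi
   (any function almost everywhere equal to phi) that is locally absolutely
   continuous on almost all lines parallel to the j-th axis. Two such
   representatives agree on almost all lines, so chi is determined by phi. *)
Definition partial_class (m : {posnum R}) j (phi chi : L2r n m) :=
  exists f,
    [/\ \forall p \ae lebesgue_measure_n n, f p = repr phi p,
        \forall q \ae lebesgue_measure_n n.-1,
          loc_abs_continuous (fun t => f (insert_coord j q t)) &
        \forall p \ae lebesgue_measure_n n,
          repr chi p = partial_derivative j f p].

Definition kg_position (m : {posnum R}) j : unbounded_operator (L2r n m) :=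
  UnboundedOperator
    [set phi | exists chi, partial_class j phi chi]
    (fun phi => 'i *: get (partial_class j phi)).

End klein_gordon_position.

(* Main.v *)
Require Import Defs.
From mathcomp Require Import all_boot all_order all_algebra.
From mathcomp Require Import all_classical all_reals all_analysis.
From mathcomp Require Import complex.
From HB Require Import structures.
From mathcomp Require Import measurable_realfun.
From mathcomp Require Import ring lra.

(** For [z = a + i b] with [b <> 0] the equation [(Q_j - z) f = psi] is the ordinary
    differential equation [i f' - z f = psi] on each line parallel to the [j]th axis. Variation
    of constants solves it: [f] is [e^(- i z t)] times the primitive of [- i e^(i z s) psi(s)]
    taken from the end of the line where [e^(i z s)] decays ([line_sol_solution]), so that [f]
    is dominated by [|psi|] convolved with [e^(- |b| |t|)]. Cauchy-Schwarz and Tonelli bound it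
    in the weighted norm (Schur's test, [line_sol_weighted]): the energy is 1-Lipschitz and
    bounded below by [m], hence moving the weight [1 / E] from one point of a line to another
    costs a factor that is linear in their distance, and the exponential absorbs it. The
    solution is unique because a solution of the homogeneous equation is a multiple of
    [e^(- i z t)], which grows exponentially at one end of the line and has no finite weighted
    norm ([line_solution_unique]). This gives a bounded inverse of [Q_j - z]
    ([kg_position_resolvent]). An operator with nonempty resolvent set is closed
    ([resolvent_closed_operator]).

    A real [lam] is an approximate eigenvalue: the plane wave [e^(- i lam p_j)] cut off by a
    profile [g(p_j)] with [|g'| <= e g], and by a box in the other variables, satisfies
    [|(Q_j - lam) f| <= e |f|] for the norms ([norm_wave_defect]). No bounded inverse of
    [Q_j - lam] can exist then ([approximate_eigenvalue_spectrum]).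

    The domain of [Q_j] is described by absolute continuity on almost every line and by the
    class of an almost everywhere derivative; three facts link it to the differential
    equation. A locally absolutely continuous function is differentiable almost everywhere
    ([loc_abs_cont_derivable_ae], from Lebesgue's theorem on monotone functions), and is
    constant if its derivative vanishes almost everywhere ([loc_abs_cont_cst]). Lebesgue
    measure on [R^n] is the product of the measures of the transversal and of the lines
    ([ge0_disintegration]), so that a null set of [R^n] meets almost every line in a null set
    ([ae_lines]). Conversely, for a property of points that holds almost everywhere on almost
    every line to hold almost everywhere, it has to define a measurable set ([ae_of_lines]);
    differentiability is therefore tested on rational increments ([measurable_slope_set],
    [ae_is_derive_lines]). *)

Set Implicit Arguments.
Unset Strict Implicit.
Unset Printing Implicit Defensive.
Import Order.TTheory GRing.Theory Num.Theory.
Import numFieldNormedType.Exports.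
Local Open Scope classical_set_scope.
Local Open Scope ring_scope.

(** * Almost everywhere differentiability of monotone functions *)

Section expanding_homeomorphism.
Context {R : realType}.
Local Notation leb := (@lebesgue_measure R).
Variables (phi psi : R -> R).
Hypothesis phi_exp : forall x y, x <= y -> y - x <= phi y - phi x.
Hypothesis phiK : cancel phi psi.
Hypothesis psiK : cancel psi phi.

Lemma expanding_mono : {mono phi : x y / x <= y}.
Proof.
apply: le_mono => x y xy; rewrite -subr_gt0.
by apply: lt_le_trans (phi_exp (ltW xy)); rewrite subr_gt0.
Qed.

Lemma expanding_inv_mono : {mono psi : x y / x <= y}.
Proof. by move=> x y; rewrite -{2}(psiK x) -{2}(psiK y) expanding_mono. Qed.

Lemma expanding_inv_contract x y : x <= y -> psi y - psi x <= y - x.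
Proof.
by rewrite -expanding_inv_mono => /phi_exp; rewrite !psiK.
Qed.

Lemma expanding_inv_dist x y : `|psi x - psi y| <= `|x - y|.
Proof.
wlog xy : x y / x <= y => [h|].
  by case: (leP x y) => [/h//|/ltW/h]; rewrite distrC [in X in _ <= X]distrC.
rewrite distrC [leRHS]distrC !ger0_norm ?subr_ge0 ?expanding_inv_mono//.
exact: expanding_inv_contract.
Qed.

Lemma expanding_inv_continuous : continuous psi.
Proof.
move=> x; apply/cvgrPdist_le => e e0; near=> y.
apply: le_trans (expanding_inv_dist _ _) _.
by near: y; apply: cvgr_dist_le.
Unshelve. all: by end_near. Qed.

Lemma expanding_measurable : measurable_fun [set: measurableTypeR R] (phi : _ -> measurableTypeR R).
Proof.
by apply: nondecreasing_measurable => // x y; rewrite expanding_mono.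
Qed.

Let defect x := x - psi x.

Let defect_nd : nondecreasing defect.
Proof.
move=> x y xy; rewrite /defect.
by have := expanding_inv_contract xy; lra.
Qed.

Let defect_rc : right_continuous defect.
Proof.
move=> x; apply: cvg_at_right_filter; apply: cvgB; first exact: cvg_id.
exact: expanding_inv_continuous.
Qed.

HB.instance Definition _ := isCumulative.Build R _ R defect defect_nd defect_rc.

Lemma expanding_preimage_itv (a b : R) :
  phi @^-1` `]a, b]%classic = `]psi a, psi b]%classic.
Proof.
apply/seteqP; split => x /=; rewrite !in_itv/= => /andP[ax xb].
  by rewrite -(phiK x) expanding_inv_mono xb andbT ltNge expanding_inv_mono -ltNge.
by rewrite -(psiK a) -(psiK b) expanding_mono xb andbT ltNge expanding_mono -ltNge.
Qed.

(** The preimage measure on the left is the Stieltjes measure of [psi]. As [psi] is a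
    contraction, [id - psi] has a Stieltjes measure too, and the two add up to Lebesgue
    measure since they do so on half-open intervals. *)
Lemma expanding_preimage_le (A : set R) : measurable A ->
  (leb (phi @^-1` A) <= leb A)%E.
Proof.
move=> mA.
pose kap := measure_function_pushforward__canonical__measure_function_Measure
   leb expanding_measurable.
pose tau := lebesgue_stieltjes_measure defect.
pose mu := [the measure _ _ of measure_add kap tau].
have muE X : mu X = (kap X + tau X)%E by exact: measure_addE.
rewrite [leRHS](@lebesgue_measure_unique _ mu)//; first by rewrite muE leeDl.
move=> _ [[a b] _ <-]; rewrite muE /=.
have [ba|ab] := leP b a; first
  by rewrite set_itv_ge ?bnd_simp -?leNgt// /kap/= /pushforward preimage_set0 /tau !measure0 adde0.
rewrite /kap/= /pushforward.
have -> := expanding_preimage_itv a b.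
rewrite !lebesgue_measure_itv/= !lte_fin ab.
rewrite ltNge expanding_inv_mono -ltNge ab.
rewrite /tau/lebesgue_stieltjes_measure/measure_extension.
rewrite measurable_mu_extE/=; last exact: is_ocitv.
rewrite wlength_itv_bnd// -?EFinB -?EFinD; last exact: ltW.
by congr EFin; rewrite /defect; lra.
Qed.

Let kap := measure_function_pushforward__canonical__measure_function_Measure
   leb expanding_measurable.

(** The measure [kap] of preimages is dominated by Lebesgue measure, hence has a
    Radon-Nikodym density [h], and [psi] is a primitive of it: [psi' = h] almost everywhere.
    The points where this fails and the zeros of [h] are null for [kap], which says that
    their preimages under [phi] are Lebesgue null. Everywhere else the rule for the
    derivative of an inverse function applies to [psi]. *)
Lemma expanding_derivable_ae_itv (N : R) :
  leb.-negligible [set x | - N < phi x < N /\ ~ derivable phi x 1].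
Proof.
pose D : set (measurableTypeR R) := `]- N, N[%classic.
have mD : measurable D by exact: measurable_itv.
have Dfin : (kap D < +oo)%E.
  apply: le_lt_trans (expanding_preimage_le mD) _.
  by rewrite lebesgue_measure_itv/=; case: ifP => _; rewrite ?ltry// -EFinD ltry.
pose nu := mfrestr mD Dfin.
have nuE A : nu A = kap (A `&` D) by [].
have nuleb : nu `<< leb.
  apply/null_content_dominatesP => A mA A0.
  apply/eqP; rewrite -measure_le0.
  apply: (@le_trans _ _ (kap A)).
    by apply: (le_measure kap); rewrite ?inE//; exact: measurableI.
  by rewrite -A0; exact: expanding_preimage_le.
have [g [g0 gfin intg nuEg0]] := radon_nikodym_sigma_finite nuleb.
have nuEg A : measurable A -> nu A = (\int[leb]_(x in A) g x)%E := nuEg0 A.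
pose h : R -> R := fine \o g.
have hE : EFin \o h = g by apply/funext => x /=; rewrite fineK.
have inth : leb.-integrable setT (EFin \o h) by rewrite hE.
have mh : measurable_fun [set: R] h by case/integrableP : inth => /measurable_EFinP.
pose F y := \int[leb]_(t in `]- N, y]) h t.
have FTC : {ae leb, forall y, (BRight (- N) < BRight y)%O -> derivable F y 1 /\ derive1 F y = h y}.
  apply: (@FTC1 R h (BRight (- N))); last exact: open_integrable_locally openT inth.
  by move=> y; exact: integrableS inth.
have psiF y : - N < y < N -> psi y = F y + psi (- N).
  move=> /andP[Ny yN]; apply/eqP; rewrite -subr_eq -eqe; apply/eqP.
  transitivity (nu `]- N, y]%classic).
    rewrite nuE (_ : _ `&` _ = `]- N, y]%classic); last first.
      apply/seteqP; split => [x []//|x xNy]; split => //.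
      by move: xNy; rewrite /D/= !in_itv/= => /andP[-> /le_lt_trans]; apply.
    rewrite /kap/= /pushforward; have -> := expanding_preimage_itv (- N) y.
    by rewrite lebesgue_measure_itv/= lte_fin ltNge expanding_inv_mono -ltNge Ny.
  rewrite nuEg; last exact: measurable_itv.
  rewrite /F /Rintegral fineK; last first.
    by apply: integrable_fin_num => //; exact: integrableS inth.
  by apply: eq_integral => x _; rewrite /= fineK.
have [B [mB B0 Bsub]] := FTC.
pose Z := B `|` h @^-1` [set 0].
have mh0 : measurable (h @^-1` [set 0]) by rewrite -[X in measurable X]setTI; exact: mh.
have mZ : measurable Z by exact: measurableU.
have nuZ : nu Z = 0%E.
  have nuB : nu B = 0%E by move/null_content_dominatesP : nuleb; exact.
  have nuh : nu (h @^-1` [set 0]) = 0%E.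
    rewrite nuEg// -hE integral0_eq// => x /= hx0.
    by have -> : h x = 0 by exact: hx0.
  apply/eqP; rewrite -measure_le0 -[leRHS]adde0 -{1}nuB -nuh.
  exact: measureU2.
(* the preimage of Z is null because nu, a restriction of kap, vanishes on Z *)
exists (phi @^-1` (Z `&` D)); split.
- rewrite -[X in measurable X]setTI; apply: expanding_measurable => //.
  exact: measurableI.
- exact: nuZ.
- move=> x /= [/andP[Nx xN] nder]; split; last by rewrite /D/= in_itv/= Nx.
  apply: contrapT => nZ; apply: nder.
  have h0 : h (phi x) != 0 by apply/eqP => h0; apply: nZ; right.
  have [dF F'] : derivable F (phi x) 1 /\ derive1 F (phi x) = h (phi x).
    have : ~ B (phi x) by move=> Bx; apply: nZ; left.
    move=> /(subsetC Bsub); rewrite setCK; apply.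
    by rewrite bnd_simp.
  have dpsi : is_derive (phi x) 1 psi (h (phi x)).
    have dF' : is_derive (phi x) 1 (F + cst (psi (- N))) (h (phi x)).
      rewrite -[h _]addr0; apply: is_deriveD; apply: DeriveDef => //.
      by rewrite -F' derive1E.
    apply: near_eq_is_derive dF'.
    have : \forall y \near phi x, - N < y < N.
      near=> y; apply/andP; split; near: y; [exact: lt_nbhsr|exact: lt_nbhsl].
    by apply: filterS => y /psiF ->.
  rewrite -(phiK x).
  have n1 : {near phi x, cancel psi phi} by near=> y; exact: psiK.
  have n2 : {near phi x, continuous psi}.
    by near=> y; exact: expanding_inv_continuous.
  by case: (is_derive_inverse n1 n2 dpsi h0).
Unshelve. all: by end_near. Qed.

Lemma expanding_derivable_ae : {ae leb, forall x, derivable phi x 1}.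
Proof.
have neg : leb.-negligible
    (\bigcup_k [set x | - k%:R < phi x < k%:R /\ ~ derivable phi x 1]).
  by apply: negligible_bigcup => k; exact: expanding_derivable_ae_itv.
apply: negligibleS neg => x nx.
exists (Num.trunc `|phi x|).+1 => //; split => //.
by rewrite -ltr_norml truncnS_gt.
Qed.

End expanding_homeomorphism.

Lemma ae_bounded_intervals {R : realType} (P : R -> Prop) :
  (forall k : nat, {ae @lebesgue_measure R, forall x, - k%:R < x < k%:R -> P x}) ->
  {ae @lebesgue_measure R, forall x, P x}.
Proof.
move=> loc; rewrite /almost_everywhere/=.
apply: negligibleS (negligible_bigcup loc) => x nx.
exists (Num.trunc `|x|).+1 => //= h; apply: nx; apply: h.
by rewrite -ltr_norml truncnS_gt.
Qed.

(** Lebesgue's theorem, in the continuous case: [id + v] increases at least as fast as [id],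
    so it is an expanding homeomorphism, and it has the same points of differentiability
    as [v]. *)
Lemma nondecreasing_derivable_ae {R : realType} (v : R -> R) :
  continuous v -> nondecreasing v ->
  {ae @lebesgue_measure R, forall x, derivable v x 1}.
Proof.
move=> cv ndv.
pose phi x := x + v x.
have phi_exp x y : x <= y -> y - x <= phi y - phi x.
  by move=> /ndv; rewrite /phi; lra.
have cphi : continuous phi by move=> x; apply: cvgD; [exact: cvg_id|exact: cv].
have surj y : exists x, phi x = y.
  pose M := `|y| + `|v 0|.
  have M0 : 0 <= M by rewrite addr_ge0.
  have [|||x _ <-] := @IVT R phi (- M) M y; last by exists x.
  - by lra.
  - exact: continuous_subspaceT.
  - have v1 : v 0 <= v M by exact: ndv.
    have v2 : v (- M) <= v 0 by apply: ndv; lra.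
    have := ler_norm y; have := ler_norm (- y); rewrite normrN.
    have := ler_norm (v 0); have := ler_norm (- v 0); rewrite normrN.
    rewrite /phi ge_min le_max => *.
    by apply/andP; split; apply/orP; [left|right]; rewrite /M in v1 v2 *; lra.
pose psi y := projT1 (cid (surj y)).
have psiK : cancel psi phi by move=> y; rewrite /psi; case: cid.
have phiK : cancel phi psi.
  by move=> x; apply: (mono_inj lexx le_anti (expanding_mono phi_exp)); rewrite psiK.
have := expanding_derivable_ae phi_exp phiK psiK.
apply: filterS; first exact: (ae_filter_ringOfSetsType (@lebesgue_measure R)).
move=> x dphi.
have -> : v = phi - id by apply/funext => y; rewrite /phi !fctE; lra.
by apply: derivableB.
Qed.

(** * Absolutely continuous functions of one real variable *)

Section absolutely_continuous.
Context {R : realType}.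
Local Notation leb := (@lebesgue_measure R).
Implicit Types (a b : R) (f : R -> R).

(** Compactness of [[a, b]] as an induction principle. The step goes from a point at the
    left of [x] to a point at its right, so that a local estimate around each [x] is enough
    and no subdivision has to be chosen. *)
Lemma continuous_induction a b (P : R -> Prop) : a <= b -> P a ->
  (forall x, a <= x <= b -> exists2 r, 0 < r &
    forall y y', a <= y -> y <= x -> x <= y' -> y' <= b ->
      x - y < r -> y' - x < r -> P y -> P y') ->
  P b.
Proof.
move=> ab Pa step.
pose S := [set x | a <= x <= b /\ P x].
have Sa : S a by rewrite /S/= lexx.
have supS : has_sup S by split; [exists a|exists b => x [/andP[]]].
have sab : a <= sup S <= b.
  rewrite (ub_le_sup supS.2 Sa)/=; apply: ge_sup; first by exists a.
  by move=> x [/andP[]].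
have [r r0 rstep] := step _ sab.
have [y [/andP[ay yb] Py] sy] := sup_adherent r0 supS.
have ys : y <= sup S by apply: (ub_le_sup supS.2); rewrite /S/= ay.
have [/andP[as_ sb]] := (sab).
pose y' := Num.min b (sup S + r / 2).
have sy' : sup S <= y' by rewrite le_min sb/=; lra.
have y'b : y' <= b by rewrite ge_min lexx.
have y'r : y' - sup S < r.
  by rewrite ltrBlDl; apply: (@le_lt_trans _ _ (sup S + r / 2)); rewrite ?ge_min ?lexx ?orbT//; lra.
have Py' : P y' by apply: (rstep y) => //; rewrite ltrBlDr addrC -ltrBlDr.
have [bs|sb'] := leP b (sup S + r / 2); first by move: Py'; rewrite /y' min_l.
have : y' <= sup S by apply: (ub_le_sup supS.2); rewrite /S/= (le_trans as_ sy').
by rewrite /y' (min_r (ltW sb')) gerDl leNgt divr_gt0.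
Qed.

(** The real-valued form of [abs_continuous_on]: the theory on a line is developed over the
    reals, and complex functions enter through their real and imaginary parts. *)
Definition abs_cont a b f := forall eps : R, 0 < eps ->
  exists2 delta : R, 0 < delta & forall k (c d : 'I_k -> R),
    (forall i, [&& a <= c i, c i <= d i & d i <= b]) ->
    trivIset [set: 'I_k] (fun i => `]c i, d i[%classic) ->
    \sum_(i < k) (d i - c i) < delta ->
    \sum_(i < k) `|f (d i) - f (c i)| < eps.

Definition loc_abs_cont f := forall a b, abs_cont a b f.

Lemma abs_cont_dist f a b eps : abs_cont a b f -> 0 < eps ->
  exists2 delta, 0 < delta & forall x y, a <= x -> x <= y -> y <= b ->
    y - x < delta -> `|f y - f x| < eps.
Proof.
move=> acf eps0; have [delta d0 acd] := acf _ eps0.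
exists delta => // x y ax xy yb xyd.
have := @acd 1%N (fun=> x) (fun=> y); rewrite !big_ord1; apply => //.
- by move=> i; rewrite ax xy yb.
- by move=> i j _ _ _; rewrite !ord1.
Qed.

Lemma loc_abs_cont_continuous f : loc_abs_cont f -> continuous f.
Proof.
move=> acf x; apply/cvgrPdist_lt => e e0.
have [d d0 fd] := abs_cont_dist (acf (x - 1) (x + 1)) e0.
near=> y.
have yd : `|x - y| < d by near: y; apply: cvgr_dist_lt.
have y1 : `|x - y| < 1 by near: y; apply: cvgr_dist_lt.
move: yd y1; rewrite ![`|x - y| < _]ltr_norml => /andP[? ?] /andP[? ?].
have [xy|/ltW yx] := leP x y.
  by rewrite distrC; apply: fd; lra.
by apply: fd; lra.
Unshelve. all: by end_near. Qed.

(** The variation is at most one on intervals of length less than the [delta] that goes with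
    [eps = 1], and [[a, b]] is covered by finitely many of them. *)
Lemma abs_cont_bounded_variation a b f : a <= b -> abs_cont a b f ->
  bounded_variation a b f.
Proof.
move=> ab acf; have [delta d0 acd] := acf _ (ltr01 : 0 < (1 : R)).
suff short x y : a <= x -> x <= y -> y <= b -> y - x < delta ->
    bounded_variation x y f.
  apply: (@continuous_induction a b (fun x => bounded_variation a x f)) => //.
    exact: bounded_variationxx.
  move=> x /andP[ax xb]; exists (delta / 2); first by rewrite divr_gt0.
  move=> y y' ay yx xy' y'b xyd y'xd.
  have yy' := le_trans yx xy'.
  move=> /(bounded_variationP _ ay) fy.
  apply/(bounded_variationP _ (le_trans ay yy')).
  rewrite (total_variationD _ ay yy') fin_numD fy/=.
  by apply/(bounded_variationP _ yy'); apply: short => //; lra.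
move=> ax xy yb xyd; exists 1 => _ [s [ps /eqP ls] <-].
rewrite /variation /= big_mkord; apply: ltW.
have ss (i k : nat) : (i < k)%N -> (k <= size s)%N -> nth y (x :: s) i <= nth y (x :: s) k.
  move=> ik ks; apply/ltW/(@sorted_ltn_nth _ <%O) => //=.
  - exact: lt_trans.
  - by rewrite inE /= ltnS (leq_trans (ltnW ik)).
have yE : nth y (x :: s) (size s) = y by have := nth_last y (x :: s); rewrite /= ls.
have bnd i : (i <= size s)%N -> x <= nth y (x :: s) i <= y.
  move=> si; apply/andP; split.
    by case: i si => [//|i si]; apply: (ss 0%N).
  apply: (@le_trans _ _ (nth y (x :: s) (size s))); last by rewrite yE.
  by move: si; rewrite leq_eqVlt => /predU1P[->//|si]; apply: ss.
apply: (acd _ (fun i : 'I_(size s) => nth y (x :: s) i) (fun i : 'I_(size s) => nth y s i)).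
- move=> i; have /andP[xc _] := bnd i (ltnW (ltn_ord i)).
  have /andP[_ dy] := bnd i.+1 (ltn_ord i).
  by rewrite (le_trans ax xc) (le_trans dy yb) andbT/=; exact: (ss i i.+1).
- have dis (i k : 'I_(size s)) : (i < k)%N ->
      `]nth y (x :: s) i, nth y s i[%classic `&` `]nth y (x :: s) k, nth y s k[%classic = set0.
    move=> ik; apply/seteqP; split => // t [].
    rewrite /= !in_itv/= => /andP[_ h1] /andP[h2 _].
    have := lt_trans h2 h1; apply/negP; rewrite -leNgt.
    move: ik; rewrite leq_eqVlt => /predU1P[<-//|ik].
    exact: (ss i.+1 k _ (ltnW (ltn_ord k))).
  apply/trivIsetP => i k _ _; rewrite -val_eqE neq_ltn => /orP[|] ik; first exact: dis.
  by rewrite setIC; exact: dis.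
- rewrite -(big_mkord xpredT (fun i => nth y (x :: s) i.+1 - nth y (x :: s) i)).
  rewrite telescope_sumr//=.
  by rewrite yE.
Qed.

(** On each bounded interval [f] is a difference of two continuous nondecreasing functions,
    its total variation and the total variation minus [f]. *)
Lemma loc_abs_cont_derivable_ae f : loc_abs_cont f ->
  {ae leb, forall x, derivable f x 1}.
Proof.
move=> acf; have cf := loc_abs_cont_continuous acf.
have loc (k : nat) : {ae leb, forall x, - k%:R < x < k%:R -> derivable f x 1}.
  pose K : R := k%:R; have K0 : 0 <= K by exact: ler0n.
  pose a := - K - 1; pose b := K + 1.
  have ab : a < b by rewrite /a/b; lra.
  have bvf : bounded_variation a b f by apply: abs_cont_bounded_variation => //; exact: ltW.
  have /(continuous_within_itvP _ ab)[cTV _ _] := @total_variation_continuous R a b f ab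
    (continuous_subspaceT cf) bvf.
  (* c clamps to [-K, K], which makes the total variation a function on the whole line *)
  pose c (x : R) := Num.max (- K) (Num.min K x).
  have cK x : - K <= c x <= K.
    by rewrite /c le_max lexx/= ge_max ge_min lexx/= andbT; lra.
  have cab x : c x \in `]a, b[.
    by rewrite in_itv/= /a/b; have /andP[? ?] := cK x; apply/andP; split; lra.
  have cc : continuous c.
    move=> x; apply: (@continuous_max _ _ (fun=> - K) (fun x => Num.min K x)); first exact: cvg_cst.
    by apply: (@continuous_min _ _ (fun=> K) id); [exact: cvg_cst|exact: cvg_id].
  have ndc : nondecreasing c.
    move=> x y xy; rewrite /c ge_max !le_max lexx/=.
    by rewrite !le_min !ge_min lexx xy /= !orbT.
  pose v x := fine (total_variation a (c x) f).
  have bvc x : total_variation a (c x) f \is a fin_num.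
    have /andP[h1 h2] := cK x; apply/bounded_variationP; first by rewrite /a; lra.
    by apply: bounded_variationl bvf; rewrite /a/b; lra.
  have tvD x y : x <= y -> `|f (c y) - f (c x)| <= v y - v x.
    move=> /ndc xy; rewrite -lee_fin EFinB /v !fineK//.
    rewrite leeBrDr//.
    have /andP[h1 h2] := cK x.
    have ac : a <= c x by rewrite /a; lra.
    rewrite (total_variationD f ac xy).
    by rewrite [leLHS]addeC; apply: leeD => //; exact: total_variation_ge.
  have cv : continuous v.
    move=> x; apply: (@continuous_comp _ _ _ c (fine \o (total_variation a ^~ f))); first exact: cc.
    exact: cTV.
  have ndv : nondecreasing v.
    by move=> x y /tvD; rewrite -subr_ge0; exact: le_trans.
  pose g x := v x - f (c x).
  have cg : continuous g.
    move=> x; apply: cvgB; first exact: cv.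
    by apply: continuous_comp; [exact: cc|exact: cf].
  have ndg : nondecreasing g.
    move=> x y xy; rewrite /g; have := tvD _ _ xy.
    by have := ler_norm (f (c y) - f (c x)); lra.
  have := nondecreasing_derivable_ae cg ndg.
  have := nondecreasing_derivable_ae cv ndv.
  apply: filterS2; first exact: (ae_filter_ringOfSetsType leb).
  move=> x dv dg /andP[Kx xK].
  have : derivable (v - g) x 1 by exact: derivableB.
  apply: near_eq_derivable.
  have : \forall y \near x, - K < y < K.
    near=> y; apply/andP; split; near: y; [exact: lt_nbhsr|exact: lt_nbhsl].
  apply: filterS => y /andP[Ky yK]; rewrite !fctE /g opprB addrC subrK /c.
  by rewrite min_r ?max_r// ltW.
exact: ae_bounded_intervals loc.
Unshelve. all: by end_near. Qed.

(** The first order expansion with explicit radii: increments are estimated directly below,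
    and later along rational increments only. *)
Lemma is_derive_localP f (x d : R) : is_derive x 1 f d <->
  forall e, 0 < e -> exists2 r, 0 < r & forall y, `|y - x| < r ->
    `|f y - f x - d * (y - x)| <= e * `|y - x|.
Proof.
split.
  move=> /is_derive1_caratheodory[g [fE cg gd]] e e0.
  have /cvgrPdist_le/(_ e e0) := cg.
  rewrite gd => /nbhs_ballP[r r0 rg]; exists r => // y yx.
  rewrite fE -mulrBl normrM ler_wpM2r// distrC.
  by apply: rg; rewrite /ball/= distrC.
move=> fd; apply/is_derive1_caratheodory.
exists (fun y => if y == x then d else (f y - f x) / (y - x)); split.
- move=> y; case: eqP => [->|/eqP]; first by rewrite !subrr mulr0.
  by rewrite -subr_eq0 => /divfK ->.
- apply/cvgrPdist_le => e e0; rewrite /= eqxx.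
  have [r r0 fr] := fd e e0; near=> y.
  have [_|yx] := eqVneq y x; first by rewrite subrr normr0 ltW.
  have yx0 : 0 < `|y - x| by rewrite normr_gt0 subr_eq0.
  rewrite -(ler_pM2r yx0) -normrM mulrBl divfK ?subr_eq0// distrC.
  by apply: fr; near: y; apply: cvgr_distC_lt.
- by rewrite eqxx.
Unshelve. all: by end_near. Qed.

(** The points without zero derivative lie in an open set of small measure, across which the
    increments of [f] are controlled by absolute continuity; near any other point the
    increments of [f] are at most [e] times the length. *)
Lemma loc_abs_cont_cst f : loc_abs_cont f ->
  {ae leb, forall x : R, is_derive x 1 f 0} -> forall x y, f x = f y.
Proof.
move=> acf [B [mB B0 Bsub]].
suff le a b : a <= b -> f b = f a.
  by move=> x y; case: (leP x y) => [|/ltW] /le.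
move=> ab; apply/eqP; rewrite -subr_eq0 -normr_le0; apply/ler_addgt0Pl => e' e'0.
pose e := e' / (1 + (b - a)).
have ba1 : 0 < 1 + (b - a) by lra.
have e0 : 0 < e by rewrite divr_gt0.
have [delta d0 acd] := acf a b _ e0.
have [U [oU BU Udelta]] : exists U, [/\ open U, B `<=` U & (leb U < delta%:E)%E].
  have leB0 : leb (B : set R) = 0%E := B0.
  have Bfin : (leb (B : set R) < +oo)%E by rewrite leB0.
  have [U [oU BU UB]] := @lebesgue_regularity_outer R B delta mB Bfin d0.
  exists U; split => //; apply: le_lt_trans UB.
  have mU := open_measurable oU.
  have UE : (U `\` B) `|` B = U by rewrite setUC setDUK.
  rewrite -[leRHS]adde0 -leB0 -{1}UE; apply: measureU2 => //.
  exact: measurableD.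
(* the intervals ]c i, d i[ are those crossed at points of B: they lie in U, hence are short *)
pose P (x : R) : Prop := exists k (c d : 'I_k -> R),
  [/\ forall i, [&& a <= c i, c i <= d i & d i <= x],
    trivIset [set: 'I_k] (fun i => `]c i, d i[%classic),
    ((\sum_(i < k) (d i - c i))%:E <= leb (U `&` `]-oo, x[))%E &
    `|f x - f a| <= e * (x - a) + \sum_(i < k) `|f (d i) - f (c i)| ].
have [k [c [d [bnd dis len est]]]] : P b.
  apply: (@continuous_induction a b P) => //.
    exists 0%N, (fun=> 0), (fun=> 0); split => //; first by case.
    - by move=> [].
    - by rewrite big_ord0.
    - by rewrite big_ord0 !subrr normr0 mulr0 addr0.
  move=> x /andP[ax xb]; have [Bx|nBx] := pselect (B x).
    have [r r0 rU] : exists2 r, 0 < r & forall z, `|z - x| < r -> U z.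
      have /nbhs_ballP[r r0 rU] := open_nbhs_nbhs (conj oU (BU _ Bx)).
      by exists r => // z zx; apply: rU; rewrite /ball/= distrC.
    exists r => // y y' ay yx xy' y'b xyr y'xr [k [c [d [bnd dis len est]]]].
    exists k.+1, (fun i => if unlift ord0 i is Some i' then c i' else y),
      (fun i => if unlift ord0 i is Some i' then d i' else y'); split.
    - move=> i; case: unliftP => [i' _|_].
        by have /and3P[-> -> h] := bnd i'; rewrite (le_trans h)//; lra.
      by rewrite ay lexx (le_trans yx).
    - have out i : `]c i, d i[%classic `&` `]y, y'[%classic = set0.
        apply/seteqP; split => // t []; rewrite /= !in_itv/= => /andP[_ td] /andP[yt _].
        have /and3P[_ _ dy] := bnd i.
        by have := lt_trans yt (lt_le_trans td dy); rewrite ltxx.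
      apply/trivIsetP => i i' _ _.
      case: (unliftP ord0 i) => [l ->|->]; case: (unliftP ord0 i') => [l' ->|->] //=.
      + rewrite (inj_eq lift_inj) => ll'.
        by move/trivIsetP : dis; apply.
      + by rewrite setIC out.
    - rewrite big_ord_recl/= ?unlift_none.
      under eq_bigr do rewrite ?liftK.
      rewrite EFinD; apply: (@le_trans _ _ (leb `]y, y'[%classic + leb (U `&` `]-oo, y[))%E).
        rewrite leeD// lebesgue_measure_itv/= lte_fin.
        by case: ltP => // y'y; rewrite lee_fin subr_le0.
      rewrite -measureU//; last 2 first.
      + by apply: measurableI; [exact: open_measurable|exact: measurable_itv].
      + by apply/seteqP; split => // t [] /=; rewrite !in_itv/= => /andP[h1 _] [_ /(lt_trans h1)]; rewrite ltxx.
      apply: le_measure; rewrite ?inE.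
      + apply: measurableU; first exact: measurable_itv.
        by apply: measurableI; [exact: open_measurable|exact: measurable_itv].
      + by apply: measurableI; [exact: open_measurable|exact: measurable_itv].
      + move=> t [|[Ut]]; rewrite /= !in_itv/=; [move=> /andP[yt ty']|move=> ty].
          split; last by apply: (lt_le_trans ty').
          by apply: rU; rewrite ltr_norml; apply/andP; split; lra.
        by split => //; apply: (lt_le_trans ty); exact: le_trans yx xy'.
    - rewrite big_ord_recl/= ?unlift_none.
      under eq_bigr do rewrite ?liftK.
      have := ler_normD (f y' - f y) (f y - f a); rewrite addrA subrK.
      have : e * (y - a) <= e * (y' - a) by rewrite ler_wpM2l ?(ltW e0)//; lra.
      lra.
  have dfx : is_derive x 1 f 0.
    by apply: contrapT => nd; apply: nBx; exact: Bsub.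
  have [r r0 rf'] := (is_derive_localP f x 0).1 dfx e e0.
  have rf y : `|y - x| < r -> `|f y - f x| <= e * `|y - x|.
    by move=> /rf'; rewrite mul0r subr0.
  exists r => // y y' ay yx xy' y'b xyr y'xr [k [c [d [bnd dis len est]]]].
  exists k, c, d; split => //.
  - by move=> i; have /and3P[-> -> h] := bnd i; rewrite (le_trans h)//; lra.
  - apply: (le_trans len); apply: le_measure; rewrite ?inE.
    + by apply: measurableI; [exact: open_measurable|exact: measurable_itv].
    + by apply: measurableI; [exact: open_measurable|exact: measurable_itv].
    + by apply: setIS => t; rewrite /= !in_itv/=; lra.
  - have e1 : `|y' - x| = y' - x by rewrite ger0_norm ?subr_ge0.
    have e2 : `|y - x| = x - y by rewrite distrC ger0_norm ?subr_ge0.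
    have h1 := rf y'; have h2 := rf y; rewrite e1 in h1; rewrite e2 in h2.
    have {}h1 := h1 y'xr; have {}h2 := h2 xyr.
    have h3 := ler_normD (f y' - f x) (f x - f y).
    have h4 := ler_normD (f y' - f y) (f y - f a).
    move: h3 h4; rewrite !addrA !subrK [`|f x - f y|]distrC.
    have -> : e * (y' - a) = e * (y' - x) + e * (x - y) + e * (y - a) by ring.
    lra.
have lenb : \sum_(i < k) (d i - c i) < delta.
  rewrite -lte_fin; apply: (le_lt_trans len); apply: le_lt_trans Udelta.
  apply: le_measure; rewrite ?inE; last by move=> ? [].
  - by apply: measurableI; [exact: open_measurable|exact: measurable_itv].
  - exact: open_measurable.
have := acd k c d bnd dis lenb.
have -> : e' + 0 = e * (b - a) + e by rewrite /e; field; rewrite gt_eqF.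
lra.
Qed.

End absolutely_continuous.

Section absolutely_continuous_algebra.
Context {R : realType}.
Local Notation leb := (@lebesgue_measure R).
Implicit Types (a b : R) (f g : R -> R).

Lemma abs_contD a b f g : abs_cont a b f -> abs_cont a b g ->
  abs_cont a b (fun x => f x + g x).
Proof.
move=> acf acg e e0; have e20 : 0 < e / 2 by rewrite divr_gt0.
have [d1 d10 ac1] := acf _ e20; have [d2 d20 ac2] := acg _ e20.
exists (Num.min d1 d2); first by rewrite lt_min d10.
move=> k c d bnd dis; rewrite lt_min => /andP[len1 len2].
rewrite (splitr e); apply: le_lt_trans (ltrD (ac1 k c d bnd dis len1) (ac2 k c d bnd dis len2)).
rewrite -big_split/=; apply: ler_sum => i _.
by rewrite opprD addrACA; exact: ler_normD.
Qed.

Lemma abs_contZ a b r f : abs_cont a b f -> abs_cont a b (fun x => r * f x).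
Proof.
move=> acf e e0; have r0 : 0 < `|r| + 1 by have := normr_ge0 r; lra.
have [d d0 ac] := acf (e / (`|r| + 1)) (divr_gt0 e0 r0).
exists d => // k c d' bnd dis len.
have := ac k c d' bnd dis len; rewrite ltr_pdivlMr//; apply: le_lt_trans.
rewrite mulr_suml; apply: ler_sum => i _.
rewrite -mulrBr normrM mulrC ler_wpM2l//; lra.
Qed.

Lemma abs_contB a b f g : abs_cont a b f -> abs_cont a b g ->
  abs_cont a b (fun x => f x - g x).
Proof.
move=> acf acg; have -> : (fun x => f x - g x) = (fun x => f x + -1 * g x).
  by apply/funext => x; rewrite mulN1r.
by apply: abs_contD => //; exact: abs_contZ.
Qed.

Lemma continuous_bounded_itv a b f : continuous f -> a <= b ->
  exists2 M, 0 < M & forall x, a <= x -> x <= b -> `|f x| <= M.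
Proof.
move=> cf ab.
have cnf : {within `[a, b], continuous (fun x => `|f x|)}.
  by apply: continuous_subspaceT => x; apply: continuous_comp; [exact: cf|exact: norm_continuous].
have [c _ cM] := EVT_max ab cnf.
exists (`|f c| + 1); first by have := normr_ge0 (f c); lra.
move=> x ax xb; have := cM x; rewrite in_itv/= ax xb => /(_ isT); lra.
Qed.

Lemma abs_cont_degenerate a b f : b < a -> abs_cont a b f.
Proof.
move=> ba e e0; exists 1 => // k c d bnd _ _.
case: k c d bnd => [|k] c d bnd; first by rewrite big_ord0.
by have /and3P[? ? ?] := bnd ord0; lra.
Qed.

Lemma loc_abs_contM f g : loc_abs_cont f -> loc_abs_cont g ->
  loc_abs_cont (fun x => f x * g x).
Proof.
move=> acf acg a b.
have [ab|/abs_cont_degenerate//] := leP a b.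
have [M M0 fM] := continuous_bounded_itv (loc_abs_cont_continuous acf) ab.
have [N N0 gN] := continuous_bounded_itv (loc_abs_cont_continuous acg) ab.
move=> e e0.
have [d1 d10 ac1] := abs_contZ N (acf a b) (divr_gt0 e0 (ltr0Sn R 1)).
have [d2 d20 ac2] := abs_contZ M (acg a b) (divr_gt0 e0 (ltr0Sn R 1)).
exists (Num.min d1 d2); first by rewrite lt_min d10.
move=> k c d bnd dis; rewrite lt_min => /andP[len1 len2].
rewrite (splitr e); apply: le_lt_trans (ltrD (ac1 k c d bnd dis len1) (ac2 k c d bnd dis len2)).
rewrite -big_split/=; apply: ler_sum => i _; have /and3P[ac cd db] := bnd i.
have -> : f (d i) * g (d i) - f (c i) * g (c i) =
  (f (d i) - f (c i)) * g (d i) + f (c i) * (g (d i) - g (c i)) by ring.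
apply: le_trans (ler_normD _ _) _.
rewrite -!mulrBr !normrM (ger0_norm (ltW N0)) (ger0_norm (ltW M0)).
rewrite [N * _]mulrC; apply: lerD; rewrite ?ler_wpM2l ?ler_wpM2r//.
  by rewrite gN// (le_trans ac).
by rewrite fM// (le_trans cd).
Qed.

Lemma C1_loc_abs_cont f (f' : R -> R) : (forall x : R, is_derive x 1 f (f' x)) -> continuous f' ->
  loc_abs_cont f.
Proof.
move=> df cf' a b; have [ab|/abs_cont_degenerate//] := leP a b.
move=> e e0; have [M M0 fM] := continuous_bounded_itv cf' ab.
exists (e / M); first by rewrite divr_gt0.
move=> k c d bnd _; rewrite ltr_pdivlMr//; apply: le_lt_trans.
rewrite mulr_suml; apply: ler_sum => i _; have /and3P[ac cd db] := bnd i.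
have [->|cd'] := eqVneq (c i) (d i); first by rewrite !subrr normr0 mul0r.
have cd'' : c i < d i by rewrite lt_neqAle cd'.
have [|r /itvP rcd ->] := MVT cd'' (fun x _ => df x).
  apply: continuous_subspaceT => x; apply: differentiable_continuous.
  by apply/derivable1_diffP; case: (df x).
rewrite normrM [`|d i - _|]ger0_norm ?subr_ge0// mulrC ler_wpM2l ?subr_ge0//.
by rewrite fM//; [apply: le_trans ac _|apply: le_trans _ db]; rewrite rcd.
Qed.

(** Absolute continuity of the integral, applied to [f] cut off outside [[a, b]]. *)
Lemma primitive_loc_abs_cont f F :
  (forall a b, leb.-integrable `[a, b] (EFin \o f)) ->
  (forall x y, x <= y -> F y - F x = \int[leb]_(t in `]x, y]) f t) ->
  loc_abs_cont F.
Proof.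
move=> intf FE a b e e0.
have intr : leb.-integrable setT (EFin \o (f \_ `[a, b])).
  by rewrite -restrict_EFin; apply/integrable_restrict => //; rewrite setTI.
have [delta [d0 dP]] := integral_normr_continuous intr e0.
exists delta => // k c d bnd dis len.
pose D := \big[setU/set0]_(i < k) `]c i, d i[%classic.
have mD : measurable D by apply: bigsetU_measurable => i _; exact: measurable_itv.
have mfr : measurable_fun setT (fun x => `|((f \_ `[a, b]) x)|%:E).
  apply/measurable_EFinP; apply: measurableT_comp => //.
  by case/integrableP : intr => /measurable_EFinP.
have lD : (leb D < delta%:E)%E.
  rewrite measure_semi_additive_ord//.
  apply: (@le_lt_trans _ _ (\sum_(i < k) (d i - c i))%:E); last by rewrite lte_fin.
  rewrite -sumEFin lee_sum// => i _.
  apply: (@le_trans _ _ (leb `]c i, d i[%classic)) => //.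
  rewrite lebesgue_measure_itv/=.
  by case: ifP => // _; rewrite lee_fin subr_ge0; have /and3P[] := bnd i.
have := dP D mD lD; apply: le_lt_trans.
rewrite -lee_fin -sumEFin /Rintegral fineK; last first.
  apply: (@integrable_fin_num _ _ _ leb) => //.
  apply: (@integrableS _ _ _ _ setT) => //.
  by apply: (integrable_norm intr).
rewrite /D ge0_integral_bigsetU//; last 3 first.
- exact: index_enum_uniq.
- by apply: sub_trivIset dis => i.
- by apply: measurable_funTS.
apply: lee_sum => i _; have /and3P[ac cd db] := bnd i.
have sub : `]c i, d i]%classic `<=` `[a, b]%classic.
  move=> x; rewrite /= !in_itv/= => /andP[? ?]; apply/andP; split; lra.
have inti : leb.-integrable `]c i, d i] (EFin \o f) by exact: integrableS (intf a b).
rewrite FE//; apply: (@le_trans _ _ (\int[leb]_(x in `]c i, d i]) `|f x|)%:E).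
  by rewrite lee_fin; apply: le_normr_Rintegral.
rewrite /Rintegral fineK; last first.
  by apply: (@integrable_fin_num _ _ _ leb) => //; apply: integrable_norm inti.
rewrite integral_itv_bndoo; last first.
  apply/measurable_EFinP; apply: measurableT_comp => //.
  by apply: (@measurable_funS _ _ _ _ `]c i, d i]%classic) => //;
    [exact: subset_itv_oo_oc|case/integrableP : inti => /measurable_EFinP].
rewrite le_eqVlt; apply/orP; left; apply/eqP; apply: eq_integral => x.
rewrite inE => xcd; rewrite patchE mem_set//.
by apply: sub; exact: subset_itv_oo_oc xcd.
Qed.

Lemma primitive_is_derive_ae f F :
  (forall a b, leb.-integrable `[a, b] (EFin \o f)) ->
  (forall x y, x <= y -> F y - F x = \int[leb]_(t in `]x, y]) f t) ->
  {ae leb, forall x : R, is_derive x 1 F (f x)}.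
Proof.
move=> intf FE.
have loc (k : nat) : {ae leb, forall x : R, - k%:R < x < k%:R -> is_derive x 1 F (f x)}.
  pose K : R := k%:R.
  (* the fundamental theorem asks for integrability on half-lines *)
  pose fK := f \_ `[- K, K].
  have intK : leb.-integrable setT (EFin \o fK).
    by rewrite -restrict_EFin; apply/integrable_restrict => //; rewrite setTI.
  have /(@FTC1 R fK (BRight (- K))) : (forall y, leb.-integrable `]- K, y] (EFin \o fK)).
    by move=> y; exact: integrableS intK.
  move=> /(_ (open_integrable_locally openT intK)) /=.
  apply: filterS; first exact: (ae_filter_ringOfSetsType leb).
  move=> x dF /andP[Kx xK]; have [|d1 d2] := dF; first by rewrite ?bnd_simp.
  have fKE : f x = fK x.
    by rewrite /fK patchE mem_set//= in_itv/= !ltW.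
  rewrite fKE; set G := (X in derivable X) in d1 d2.
  have dG : is_derive x 1 (G + cst (F (- K))) (fK x).
    rewrite -[fK x]addr0; apply: is_deriveD; apply: DeriveDef => //.
    by rewrite -derive1E.
  apply: near_eq_is_derive dG.
  have : \forall y \near x, - K < y < K.
    near=> y; apply/andP; split; near: y; [exact: lt_nbhsr|exact: lt_nbhsl].
  apply: filterS => y /andP[Ky yK]; rewrite !fctE.
  rewrite -[RHS](subrK (F (- K))) FE ?ltW//; congr (_ + _).
  rewrite /G; apply: eq_Rintegral => t; rewrite inE/= in_itv/= => /andP[Kt ty].
  by rewrite /fK patchE mem_set//= in_itv/= (ltW Kt) (le_trans ty) ?ltW.
exact: ae_bounded_intervals loc.
Unshelve. all: by end_near. Qed.

End absolutely_continuous_algebra.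

(** * Exponential integrals, Cauchy-Schwarz and primitives on half-lines *)

Section exponential_kernel.
Context {R : realType}.
Local Notation leb := (@lebesgue_measure R).

Lemma is_derive_continuous (f : R -> R) (f' : R -> R) :
  (forall x : R, is_derive x 1 f (f' x)) -> continuous f.
Proof.
move=> df x; apply: differentiable_continuous.
by apply/derivable1_diffP; case: (df x).
Qed.

Lemma continuous_scale (h : R -> R) (c : R) : continuous h ->
  continuous (fun s : R => h (c * s)).
Proof.
move=> ch s; apply: continuous_comp; last exact: ch.
by apply: cvgM; [exact: cvg_cst|exact: cvg_id].
Qed.

Lemma integral_expR_half (c a : R) : 0 < c ->
  (\int[leb]_(x in `[a, +oo[) (expR (- (c * (x - a))))%:E = (c^-1)%:E)%E.
Proof.
move=> c0.
pose e (x : R) := expR (- (c * (x - a))).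
have de (x : R) : is_derive x 1 e (- c * e x).
  apply: is_derive_eq.
  by rewrite /e /GRing.scale/=; ring.
have dF (x : R) : is_derive x 1 (fun x => - c^-1 * e x) (e x).
  apply: is_derive_eq.
  by rewrite /GRing.scale/=; field; rewrite gt_eqF.
have cF := is_derive_continuous dF.
rewrite (@ge0_continuous_FTC2y R e (fun x => - c^-1 * e x) a 0).
- by rewrite /e subrr mulr0 oppr0 expR0 mulr1 sub0e EFinN oppeK.
- by move=> x _; exact: expR_ge0.
- by apply: continuous_subspaceT; exact: is_derive_continuous de.
- rewrite -(mulr0 (- c^-1)); apply: cvgM; first exact: cvg_cst.
  apply: (cvg_comp (fun x => c * (x - a)) (fun y => expR (- y))); last exact: cvgr_expR.
  by apply: gt0_cvgMry => //; exact: cvg_addrr.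
- by move=> x _; case: (dF x).
- by apply: cvg_at_right_filter; exact: cF.
- by move=> x _; rewrite derive1E; case: (dF x).
Qed.

Lemma integral_expR_abs (c t : R) : 0 < c ->
  (\int[leb]_s (expR (- (c * `|t - s|)))%:E = (2 / c)%:E)%E.
Proof.
move=> c0.
have cg : continuous (fun s : R => expR (- (c * `|t - s|))).
  move=> s; apply: continuous_comp; last exact: continuous_expR.
  apply: cvgN; apply: cvgM; first exact: cvg_cst.
  by apply: cvg_norm; apply: cvgB; [exact: cvg_cst|exact: cvg_id].
have mg : measurable_fun setT (fun s : R => (expR (- (c * `|t - s|)))%:E).
  by apply/measurable_EFinP; exact: continuous_measurable_fun.
rewrite -(setUCl `]-oo, t]%classic) setCitvl.
rewrite ge0_integral_setU//=; last 2 first.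
- exact: measurable_funTS.
- by apply/disj_setPS => x []; rewrite /= !in_itv/= andbT => tx /(lt_le_trans tx); rewrite ltxx.
rewrite addeC.
rewrite integral_itv_obnd_cbnd; last by apply: measurable_funTS.
rewrite -{1}(opprK t) ge0_integration_by_substitutionNy.
- transitivity (c^-1%:E + c^-1%:E)%E; last by rewrite -EFinD; congr EFin; field; rewrite gt_eqF.
  congr (_ + _)%E.
  + rewrite -(integral_expR_half (- t) c0); apply: eq_integral => x.
    by rewrite inE/= in_itv/= andbT => tx; rewrite !opprK ger0_norm; [rewrite addrC|lra].
  + rewrite -(integral_expR_half t c0); apply: eq_integral => x.
    by rewrite inE/= in_itv/= andbT => tx; rewrite distrC ger0_norm ?subr_ge0.
- exact: continuous_subspaceT.
- by move=> x _; exact: expR_ge0.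
Qed.

End exponential_kernel.

Section cauchy_schwarz.
Context d (T : measurableType d) (R : realType) (mu : {measure set T -> \bar R}).

(** The Cauchy-Schwarz inequality for the measure [k mu], in terms of upper bounds [c] and [H]
    of the total mass and of the square integral. With the arithmetic-geometric inequality
    [2 |v| <= l + v^2 / l] the case [l = 1] gives finiteness, and [l = I / c] the bound. *)
Lemma integral_cauchy_schwarz (k v : T -> R) (c H : R) :
  measurable_fun setT k -> measurable_fun setT v -> (forall x, 0 <= k x) ->
  0 < c -> (\int[mu]_x (k x)%:E <= c%:E)%E ->
  (\int[mu]_x (k x * v x ^+ 2)%:E <= H%:E)%E ->
  exists2 I, (\int[mu]_x (k x * `|v x|)%:E = I%:E)%E & I ^+ 2 <= c * H.
Proof.
move=> mk mv k0 c0 kc kH.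
have mkv : measurable_fun setT (fun x => (k x * `|v x|)%:E).
  by apply/measurable_EFinP; apply: measurable_funM => //; exact: measurableT_comp.
have mkv2 : measurable_fun setT (fun x => (k x * v x ^+ 2)%:E).
  by apply/measurable_EFinP; apply: measurable_funM => //; exact: measurable_funX.
have mk' : measurable_fun setT (fun x => (k x)%:E) by exact/measurable_EFinP.
have kv0 x : 0 <= k x * `|v x| by rewrite mulr_ge0.
have kv20 x : 0 <= k x * v x ^+ 2 by rewrite mulr_ge0 ?sqr_ge0.
have young l : 0 < l -> (\int[mu]_x (k x * `|v x|)%:E <= (l * c / 2 + H / (2 * l))%:E)%E.
  move=> l0.
  apply: (@le_trans _ _ (\int[mu]_x ((l / 2)%:E * (k x)%:E + ((2 * l)^-1)%:E * (k x * v x ^+ 2)%:E))%E).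
    apply: ge0_le_integral => //.
    - by move=> x _; rewrite lee_fin.
    - by apply: emeasurable_funD; apply: emeasurable_funM => //; exact: measurable_cst.
    - move=> x _; rewrite -!EFinM -EFinD lee_fin -[v x ^+ 2](real_normK (num_real (v x))).
      have -> : l / 2 * k x + (2 * l)^-1 * (k x * `|v x| ^+ 2) =
         k x * `|v x| + k x * (2 * l)^-1 * (`|v x| - l) ^+ 2.
        by field; rewrite gt_eqF.
      by rewrite lerDl mulr_ge0 ?sqr_ge0// mulr_ge0// invr_ge0; lra.
  rewrite ge0_integralD//; last 4 first.
  - by move=> x _; rewrite -EFinM lee_fin mulr_ge0// divr_ge0// ltW.
  - by apply: emeasurable_funM => //; exact: measurable_cst.
  - by move=> x _; rewrite -EFinM lee_fin mulr_ge0// invr_ge0; lra.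
  - by apply: emeasurable_funM => //; exact: measurable_cst.
  have l1 : (0 <= (l / 2)%:E)%E by rewrite lee_fin; lra.
  have l2 : (0 <= ((2 * l)^-1)%:E)%E by rewrite lee_fin invr_ge0; lra.
  have k1 x : setT x -> (0 <= (k x)%:E)%E by rewrite lee_fin.
  have k2 x : setT x -> (0 <= (k x * v x ^+ 2)%:E)%E by rewrite lee_fin.
  rewrite !ge0_integralZl// EFinD; apply: leeD.
    have -> : (l * c / 2)%:E = ((l / 2)%:E * c%:E)%E by rewrite -EFinM mulrAC.
    exact: lee_wpmul2l.
  have -> : (H / (2 * l))%:E = (((2 * l)^-1)%:E * H%:E)%E by rewrite -EFinM mulrC.
  exact: lee_wpmul2l.
have I0 : (0 <= \int[mu]_x (k x * `|v x|)%:E)%E.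
  by apply: integral_ge0 => x _; rewrite lee_fin.
have H0 : 0 <= H.
  by rewrite -lee_fin; apply: le_trans kH; apply: integral_ge0 => x _; rewrite lee_fin.
move: young I0; case: (integral _ _ _) => [I|/(_ 1 ltr01)//|//] young.
rewrite lee_fin => I0; exists I => //.
have [->|In0] := eqVneq I 0; first by rewrite expr0n mulr_ge0// ltW.
have Ip : 0 < I by rewrite lt_neqAle eq_sym In0.
have := young (I / c) (divr_gt0 Ip c0); rewrite lee_fin => h.
have : I * I <= (I / c * c / 2 + H / (2 * (I / c))) * I by rewrite ler_wpM2r.
have -> : (I / c * c / 2 + H / (2 * (I / c))) * I = I * I / 2 + c * H / 2.
  by field; rewrite !gt_eqF.
by rewrite expr2; lra.
Qed.

End cauchy_schwarz.

Section halfline.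
Context {R : realType}.
Local Notation leb := (@lebesgue_measure R).

(** With [b < 0] for [s], this is the half-line seen from [t] on which [x |-> e^(b (t - x))]
    decays as [x] goes to infinity. *)
Definition halfline (s : bool) (t : R) : set R :=
  if s then `]-oo, t]%classic else `]t, +oo[%classic.

Lemma measurable_halfline s t : measurable (halfline s t).
Proof. by case: s; exact: measurable_itv. Qed.

(** The sign makes it a primitive of [u] in both cases. *)
Definition halfline_primitive s (u : R -> R) (t : R) : R :=
  (-1) ^+ (~~ s) * \int[leb]_(x in halfline s t) u x.

Lemma halfline_primitiveB s u :
  (forall t, leb.-integrable (halfline s t) (EFin \o u)) ->
  forall x y, x <= y -> halfline_primitive s u y - halfline_primitive s u x =
    \int[leb]_(t in `]x, y]) u t.
Proof.
rewrite /halfline_primitive; case: s => /= intu x y xy.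
  rewrite expr0 !mul1r.
  have := intu y; rewrite (@itv_bndbnd_setU _ _ -oo%O (BRight x) (BRight y))// => intxy.
  rewrite Rintegral_setU//; first by rewrite addrC addKr.
  by apply/disj_setPS => t []; rewrite /= !in_itv/= => + /andP[/lt_le_trans h _] => /h; rewrite ltxx.
rewrite expr1 !mulN1r opprK.
have := intu x; rewrite (@itv_bndbnd_setU _ _ (BRight x) (BRight y) +oo%O)// => intxy.
rewrite Rintegral_setU//; first by rewrite addrC addrK.
by apply/disj_setPS => t []; rewrite /= !in_itv/= => /andP[_ +] /andP[/lt_le_trans h _] => /h; rewrite ltxx.
Qed.

Lemma halfline_integrable_itv s u :
  (forall t, leb.-integrable (halfline s t) (EFin \o u)) ->
  forall a b, leb.-integrable `[a, b] (EFin \o u).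
Proof.
move=> intu a b; pose t := if s then b else a - 1.
apply: integrableS (intu t) => //; first exact: measurable_halfline.
rewrite /t; case: s {t intu} => /=.
- by move=> x; rewrite /= !in_itv/= => /andP[].
- by move=> x; rewrite /= !in_itv/= => /andP[? _]; lra.
Qed.

Lemma halfline_primitive_loc_abs_cont s u :
  (forall t, leb.-integrable (halfline s t) (EFin \o u)) ->
  loc_abs_cont (halfline_primitive s u).
Proof.
move=> intu; apply: primitive_loc_abs_cont (halfline_primitiveB intu).
exact: halfline_integrable_itv intu.
Qed.

Lemma halfline_primitive_is_derive_ae s u :
  (forall t, leb.-integrable (halfline s t) (EFin \o u)) ->
  {ae leb, forall x : R, is_derive x 1 (halfline_primitive s u) (u x)}.
Proof.
move=> intu; apply: primitive_is_derive_ae (halfline_primitiveB intu).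
exact: halfline_integrable_itv intu.
Qed.

Lemma normr_halfline_primitive s u t :
  leb.-integrable (halfline s t) (EFin \o u) ->
  (`|halfline_primitive s u t|%:E <= \int[leb]_(x in halfline s t) `|u x|%:E)%E.
Proof.
move=> intu; rewrite /halfline_primitive normrM normr_sign mul1r.
have mh := measurable_halfline s t.
apply: (@le_trans _ _ (\int[leb]_(x in halfline s t) `|u x|)%:E).
  by rewrite lee_fin le_normr_Rintegral.
rewrite /Rintegral fineK//; apply: (@integrable_fin_num _ _ _ leb) => //.
exact: integrable_norm intu.
Qed.

End halfline.

(** * The resolvent equation on a line *)

Section line_equation.
Context {R : realType}.
Local Notation leb := (@lebesgue_measure R).
Implicit Types (a b t : R) (f g u : R -> R).

(** [twist_cos a b - i twist_sin a b] is [t |-> e^(- i z t)] for [z = a + i b]. *)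
Definition twist_cos a b t := expR (b * t) * cos (a * t).
Definition twist_sin a b t := expR (b * t) * sin (a * t).

Lemma is_derive_twist_cos a b t :
  is_derive t 1 (twist_cos a b) (b * twist_cos a b t - a * twist_sin a b t).
Proof. by apply: is_derive_eq; rewrite /twist_cos /twist_sin /GRing.scale/=; ring. Qed.

Lemma is_derive_twist_sin a b t :
  is_derive t 1 (twist_sin a b) (b * twist_sin a b t + a * twist_cos a b t).
Proof. by apply: is_derive_eq; rewrite /twist_cos /twist_sin /GRing.scale/=; ring. Qed.

Lemma continuous_twist_cos a b : continuous (twist_cos a b).
Proof. exact: is_derive_continuous (is_derive_twist_cos a b). Qed.

Lemma continuous_twist_sin a b : continuous (twist_sin a b).
Proof. exact: is_derive_continuous (is_derive_twist_sin a b). Qed.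

Lemma twist_cos_loc_abs_cont a b : loc_abs_cont (twist_cos a b).
Proof.
apply: (C1_loc_abs_cont (is_derive_twist_cos a b)) => t.
by apply: cvgB; apply: cvgM; do ?[exact: cvg_cst|exact: continuous_twist_cos
  |exact: continuous_twist_sin].
Qed.

Lemma twist_sin_loc_abs_cont a b : loc_abs_cont (twist_sin a b).
Proof.
apply: (C1_loc_abs_cont (is_derive_twist_sin a b)) => t.
by apply: cvgD; apply: cvgM; do ?[exact: cvg_cst|exact: continuous_twist_cos
  |exact: continuous_twist_sin].
Qed.

Lemma twist_sqr a b t : twist_cos a b t ^+ 2 + twist_sin a b t ^+ 2 = expR (b * t) ^+ 2.
Proof. by rewrite /twist_cos /twist_sin !exprMn -mulrDr cos2Dsin2 mulr1. Qed.

Lemma twist_cosN a b t : twist_cos a b t * twist_cos a (- b) t +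
  twist_sin a b t * twist_sin a (- b) t = 1.
Proof.
have e1 : expR (b * t) * expR (- b * t) = 1 by rewrite mulNr expRN divff// gt_eqF ?expR_gt0.
transitivity (expR (b * t) * expR (- b * t) * (cos (a * t) ^+ 2 + sin (a * t) ^+ 2)).
  by rewrite /twist_cos /twist_sin; ring.
by rewrite e1 cos2Dsin2 mulr1.
Qed.

Lemma twist_sinN a b t : twist_cos a b t * twist_sin a (- b) t =
  twist_sin a b t * twist_cos a (- b) t.
Proof. by rewrite /twist_cos /twist_sin; ring. Qed.

(** The equation [i f' - z f = g] for [z = a + i b], [f = f1 + i f2] and [g = g1 + i g2],
    solved for the derivatives of [f1] and [f2]. *)
Definition line_solution a b g1 g2 f1 f2 := [/\ loc_abs_cont f1, loc_abs_cont f2 &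
  {ae leb, forall t, is_derive t 1 f1 (b * f1 t + a * f2 t + g2 t) /\
                     is_derive t 1 f2 (b * f2 t - a * f1 t - g1 t)}].

(** Multiplication by [e^(i z t)] turns a solution into an absolutely continuous function with
    zero derivative almost everywhere, which is constant. *)
Lemma line_solution_homogeneous a b f1 f2 : line_solution a b (cst 0) (cst 0) f1 f2 ->
  exists c1 c2, forall t, f1 t = c1 * twist_cos a b t + c2 * twist_sin a b t /\
    f2 t = c2 * twist_cos a b t - c1 * twist_sin a b t.
Proof.
move=> [ac1 ac2 df].
pose C := twist_cos a (- b); pose S := twist_sin a (- b).
pose V1 t := C t * f1 t - S t * f2 t.
pose V2 t := S t * f1 t + C t * f2 t.
have acC := twist_cos_loc_abs_cont a (- b); have acS := twist_sin_loc_abs_cont a (- b).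
have acV1 : loc_abs_cont V1 by move=> p q; apply: abs_contB; exact: loc_abs_contM.
have acV2 : loc_abs_cont V2 by move=> p q; apply: abs_contD; exact: loc_abs_contM.
have dV1 : {ae leb, forall t, is_derive t 1 V1 0}.
  move: df; apply: filterS; first exact: (ae_filter_ringOfSetsType leb).
  move=> t [d1 d2].
  have dC := is_derive_twist_cos a (- b) t; have dS := is_derive_twist_sin a (- b) t.
  apply: is_derive_eq; rewrite /GRing.scale/= -/C -/S; ring.
have dV2 : {ae leb, forall t, is_derive t 1 V2 0}.
  move: df; apply: filterS; first exact: (ae_filter_ringOfSetsType leb).
  move=> t [d1 d2].
  have dC := is_derive_twist_cos a (- b) t; have dS := is_derive_twist_sin a (- b) t.
  apply: is_derive_eq; rewrite /GRing.scale/= -/C -/S; ring.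
exists (V1 0), (V2 0) => t.
rewrite (loc_abs_cont_cst acV1 dV1 0 t) (loc_abs_cont_cst acV2 dV2 0 t) /V1 /V2.
have e1 := twist_cosN a b t; have e2 := twist_sinN a b t; rewrite -/C -/S in e1 e2.
split.
  transitivity (f1 t * (twist_cos a b t * C t + twist_sin a b t * S t) +
     f2 t * (twist_sin a b t * C t - twist_cos a b t * S t)); last by ring.
  by rewrite e1 e2 subrr; ring.
transitivity (f2 t * (twist_cos a b t * C t + twist_sin a b t * S t) +
     f1 t * (twist_cos a b t * S t - twist_sin a b t * C t)); last by ring.
by rewrite e1 e2 subrr; ring.
Qed.

End line_equation.

Section line_existence.
Context {R : realType}.
Local Notation leb := (@lebesgue_measure R).
Implicit Types (a b t : R) (f g u v : R -> R).

Definition exp_kernel (c t s : R) := expR (- (c * `|t - s|)).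

Lemma exp_kernel_ge0 c t s : 0 <= exp_kernel c t s.
Proof. exact: expR_ge0. Qed.

Lemma measurable_exp_kernel c t : measurable_fun setT (exp_kernel c t).
Proof.
apply: continuous_measurable_fun => s; apply: continuous_comp; last exact: continuous_expR.
apply: cvgN; apply: cvgM; first exact: cvg_cst.
by apply: cvg_norm; apply: cvgB; [exact: cvg_cst|exact: cvg_id].
Qed.

Lemma exp_kernelE b t s : halfline (b < 0) t s ->
  expR (b * t) * expR (- b * s) = exp_kernel `|b| t s.
Proof.
rewrite /halfline /exp_kernel -expRD; case: ltP => b0 /=; rewrite in_itv/= ?andbT => st.
  by congr expR; rewrite ltr0_norm// ger0_norm ?subr_ge0//; ring.
by congr expR; rewrite ger0_norm// distrC ger0_norm ?subr_ge0 ?ltW//; ring.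
Qed.

(** On the half-line [e^(b t) e^(- b s)] is the exponential kernel, so Cauchy-Schwarz against
    this kernel gives both integrability and the bound. *)
Lemma halfline_primitive_bound b v t (H : R) : b != 0 -> measurable_fun setT v ->
  (\int[leb]_s (exp_kernel `|b| t s * v s ^+ 2)%:E <= H%:E)%E ->
  leb.-integrable (halfline (b < 0) t) (EFin \o (fun s => expR (- b * s) * v s)) /\
  (expR (b * t) * halfline_primitive (b < 0) (fun s => expR (- b * s) * v s) t) ^+ 2
    <= 2 / `|b| * H.
Proof.
move=> b0 mv vH.
have b0' : 0 < `|b| by rewrite normr_gt0.
have c0 : 0 < 2 / `|b| by rewrite divr_gt0.
have mk := measurable_exp_kernel `|b| t.
have kc : (\int[leb]_s (exp_kernel `|b| t s)%:E <= (2 / `|b|)%:E)%E.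
  by rewrite integral_expR_abs.
have [I IE I2] := @integral_cauchy_schwarz _ _ R leb _ _ _ _ mk mv (exp_kernel_ge0 `|b| t) c0 kc vH.
have mh := measurable_halfline (b < 0) t.
have mu : measurable_fun setT (fun s => expR (- b * s) * v s).
  apply: measurable_funM => //; apply: continuous_measurable_fun.
  by apply: continuous_scale; exact: continuous_expR.
have mkv : measurable_fun setT (fun s => (exp_kernel `|b| t s * `|v s|)%:E).
  by apply/measurable_EFinP; apply: measurable_funM => //; exact: measurableT_comp.
pose u s := expR (- b * s) * v s; pose eb := expR (- b * t).
have le : (\int[leb]_(s in halfline (b < 0)%R t) `|u s|%:E <= (eb * I)%:E)%E.
  have -> : (eb * I)%:E = (\int[leb]_s (eb%:E * (exp_kernel `|b| t s * `|v s|)%:E))%E.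
    rewrite ge0_integralZl//= ?IE ?EFinM//; last by rewrite lee_fin expR_ge0.
    by move=> x _; rewrite lee_fin mulr_ge0// exp_kernel_ge0.
  apply: (@le_trans _ _ (\int[leb]_(s in halfline (b < 0)%R t) (eb%:E * (exp_kernel `|b| t s * `|v s|)%:E))%E).
    rewrite le_eqVlt; apply/orP; left; apply/eqP; apply: eq_integral => s; rewrite inE => hs.
    rewrite -EFinM; congr EFin; rewrite -exp_kernelE// normrM (ger0_norm (expR_ge0 _)).
    rewrite /eb !mulrA -expRD (_ : - b * t + b * t = 0) ?expR0 ?mul1r//; ring.
  apply: ge0_subset_integral => //.
  - by apply: emeasurable_funM => //; exact: measurable_cst.
  - by move=> s _; rewrite -EFinM lee_fin mulr_ge0 ?expR_ge0// mulr_ge0// exp_kernel_ge0.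
have intu : leb.-integrable (halfline (b < 0) t) (EFin \o u).
  apply/integrableP; split; first by apply/measurable_EFinP; exact: measurable_funTS.
  by apply: le_lt_trans le (ltry _).
split => //.
have := le_trans (normr_halfline_primitive intu) le; rewrite lee_fin => hI.
have I0 : 0 <= I.
  rewrite -lee_fin -IE; apply: integral_ge0 => s _.
  by rewrite lee_fin mulr_ge0// exp_kernel_ge0.
apply: le_trans I2; rewrite -[leLHS]real_normK ?num_real//.
rewrite ler_sqr ?nnegrE// normrM (ger0_norm (expR_ge0 _)).
apply: le_trans (ler_wpM2l (expR_ge0 _) hI) _.
rewrite mulrA -expRD (_ : b * t + - b * t = 0) ?expR0 ?mul1r//; ring.
Qed.

(** Real and imaginary part of [e^(i a s) (- i g s)]. *)
Definition line_source1 a (g1 g2 : R -> R) s := cos (a * s) * g2 s + sin (a * s) * g1 s.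
Definition line_source2 a (g1 g2 : R -> R) s := sin (a * s) * g2 s - cos (a * s) * g1 s.

Lemma line_source_sqr a g1 g2 s :
  line_source1 a g1 g2 s ^+ 2 + line_source2 a g1 g2 s ^+ 2 = g1 s ^+ 2 + g2 s ^+ 2.
Proof.
rewrite /line_source1 /line_source2.
transitivity ((cos (a * s) ^+ 2 + sin (a * s) ^+ 2) * (g1 s ^+ 2 + g2 s ^+ 2)); first by ring.
by rewrite cos2Dsin2 mul1r.
Qed.

(** With [line_source1] and [line_source2] for [v], these are the real and imaginary part of
    the primitive of [e^(i z s) (- i g s)] that vanishes where [e^(- i z t)] is large. *)
Definition untwisted (v : R -> R) b t :=
  halfline_primitive (b < 0) (fun s => expR (- b * s) * v s) t.

(** Variation of constants: [e^(- i z t)] times the primitive above. *)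
Definition line_sol1 a b g1 g2 t :=
  twist_cos a b t * untwisted (line_source1 a g1 g2) b t +
  twist_sin a b t * untwisted (line_source2 a g1 g2) b t.
Definition line_sol2 a b g1 g2 t :=
  twist_cos a b t * untwisted (line_source2 a g1 g2) b t -
  twist_sin a b t * untwisted (line_source1 a g1 g2) b t.

Section solution.
Variables (a b : R) (g1 g2 : R -> R).
Hypothesis b0 : b != 0.
Hypotheses (mg1 : measurable_fun setT g1) (mg2 : measurable_fun setT g2).

Let v1 := line_source1 a g1 g2.
Let v2 := line_source2 a g1 g2.

Let mcos : measurable_fun setT (fun s => cos (a * s)).
Proof. by apply: continuous_measurable_fun; apply: continuous_scale; exact: continuous_cos. Qed.

Let msin : measurable_fun setT (fun s => sin (a * s)).
Proof. by apply: continuous_measurable_fun; apply: continuous_scale; exact: continuous_sin. Qed.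

Let mv1 : measurable_fun setT v1.
Proof. by apply: measurable_funD; exact: measurable_funM. Qed.

Let mv2 : measurable_fun setT v2.
Proof. by apply: measurable_funB; exact: measurable_funM. Qed.

Let K t v := (\int[leb]_s (exp_kernel `|b| t s * v s ^+ 2)%:E)%E.

Let K12 t : (K t v1 + K t v2 =
  \int[leb]_s (exp_kernel `|b| t s * (g1 s ^+ 2 + g2 s ^+ 2))%:E)%E.
Proof.
have mk := measurable_exp_kernel `|b| t.
rewrite /K -ge0_integralD//.
- by apply: eq_integral => s _; rewrite -EFinD -mulrDr line_source_sqr.
- by move=> s _; rewrite lee_fin mulr_ge0 ?exp_kernel_ge0 ?sqr_ge0.
- by apply/measurable_EFinP; apply: measurable_funM => //; exact: measurable_funX.
- by move=> s _; rewrite lee_fin mulr_ge0 ?exp_kernel_ge0 ?sqr_ge0.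
- by apply/measurable_EFinP; apply: measurable_funM => //; exact: measurable_funX.
Qed.

Let K_ge0 t v : (0 <= K t v)%E.
Proof. by apply: integral_ge0 => s _; rewrite lee_fin mulr_ge0 ?exp_kernel_ge0 ?sqr_ge0. Qed.

Lemma line_sol_bound t : ((line_sol1 a b g1 g2 t ^+ 2 + line_sol2 a b g1 g2 t ^+ 2)%:E <=
  (2 / `|b|)%:E * \int[leb]_s (exp_kernel `|b| t s * (g1 s ^+ 2 + g2 s ^+ 2))%:E)%E.
Proof.
have b0' : 0 < 2 / `|b| by rewrite divr_gt0 ?normr_gt0.
rewrite -K12; have := K_ge0 t v1; have := K_ge0 t v2.
case K1 : (K t v1) => [H1||]; case K2 : (K t v2) => [H2||] //= _ _; last 3 first.
- by rewrite mulry gtr0_sg// mul1e leey.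
- by rewrite mulry gtr0_sg// mul1e leey.
- by rewrite mulry gtr0_sg// mul1e leey.
have leH1 : (K t v1 <= H1%:E)%E by rewrite K1.
have leH2 : (K t v2 <= H2%:E)%E by rewrite K2.
have [_ h1] := halfline_primitive_bound b0 mv1 leH1.
have [_ h2] := halfline_primitive_bound b0 mv2 leH2.
rewrite -EFinD -EFinM lee_fin mulrDr; apply: le_trans (lerD h1 h2).
rewrite -/(untwisted v1 b t) -/(untwisted v2 b t) /line_sol1 /line_sol2 -/v1 -/v2.
rewrite [in leRHS]exprMn [X in _ <= _ + X]exprMn -mulrDr -(twist_sqr a).
rewrite le_eqVlt; apply/orP; left; apply/eqP; ring.
Qed.

Hypothesis gfin : forall t,
  (\int[leb]_s (exp_kernel `|b| t s * (g1 s ^+ 2 + g2 s ^+ 2))%:E < +oo)%E.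

Lemma line_sol_solution : line_solution a b g1 g2 (line_sol1 a b g1 g2) (line_sol2 a b g1 g2).
Proof.
have fin t : (K t v1 < +oo)%E /\ (K t v2 < +oo)%E.
  have := gfin t; rewrite -K12; have := K_ge0 t v1; have := K_ge0 t v2.
  by case: (K t v1) => [?||]; case: (K t v2) => [?||] //= *; rewrite ?ltry.
have int1 t : leb.-integrable (halfline (b < 0) t) (EFin \o (fun s => expR (- b * s) * v1 s)).
  have le : (K t v1 <= (fine (K t v1))%:E)%E.
    by rewrite fineK// ge0_fin_numE; [case: (fin t)|exact: K_ge0].
  by case: (halfline_primitive_bound b0 mv1 le).
have int2 t : leb.-integrable (halfline (b < 0) t) (EFin \o (fun s => expR (- b * s) * v2 s)).
  have le : (K t v2 <= (fine (K t v2))%:E)%E.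
    by rewrite fineK// ge0_fin_numE; [case: (fin t)|exact: K_ge0].
  by case: (halfline_primitive_bound b0 mv2 le).
have ac1 := halfline_primitive_loc_abs_cont int1.
have ac2 := halfline_primitive_loc_abs_cont int2.
have acC := twist_cos_loc_abs_cont a b; have acS := twist_sin_loc_abs_cont a b.
split.
- by move=> p q; apply: abs_contD; exact: loc_abs_contM.
- by move=> p q; apply: abs_contB; exact: loc_abs_contM.
have := halfline_primitive_is_derive_ae int2.
have := halfline_primitive_is_derive_ae int1.
apply: filterS2; first exact: (ae_filter_ringOfSetsType leb).
move=> t d1 d2.
have dC := is_derive_twist_cos a b t; have dS := is_derive_twist_sin a b t.
have e0 : expR (b * t) * expR (- b * t) = 1 by rewrite mulNr expRN divff// gt_eqF ?expR_gt0.
have e1 : cos (a * t) ^+ 2 + sin (a * t) ^+ 2 = 1 by exact: cos2Dsin2.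
have src1 : twist_cos a b t * (expR (- b * t) * v1 t) + twist_sin a b t * (expR (- b * t) * v2 t) = g2 t.
  transitivity ((expR (b * t) * expR (- b * t)) * (cos (a * t) ^+ 2 + sin (a * t) ^+ 2) * g2 t).
    by rewrite /twist_cos /twist_sin /v1 /v2 /line_source1 /line_source2; ring.
  by rewrite e0 e1; ring.
have src2 : twist_cos a b t * (expR (- b * t) * v2 t) - twist_sin a b t * (expR (- b * t) * v1 t) = - g1 t.
  transitivity (- ((expR (b * t) * expR (- b * t)) * (cos (a * t) ^+ 2 + sin (a * t) ^+ 2) * g1 t)).
    by rewrite /twist_cos /twist_sin /v1 /v2 /line_source1 /line_source2; ring.
  by rewrite e0 e1; ring.
split.
- rewrite -src1; apply: is_derive_eq.
  by rewrite /line_sol1 /line_sol2 /untwisted /GRing.scale/= -/v1 -/v2; ring.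
- rewrite -src2; apply: is_derive_eq.
  by rewrite /line_sol1 /line_sol2 /untwisted /GRing.scale/= -/v1 -/v2; ring.
Qed.

End solution.
End line_existence.

(** * The energy weight and Schur's test on a line *)

Section line_weight.
Context {R : realType}.
Local Notation leb := (@lebesgue_measure R).
Implicit Types (a b t s : R) (f g u v : R -> R).

(** The energy on a line, [k] being [m^2] plus the squares of the other momenta. *)
Definition line_energy (k t : R) : R := Num.sqrt (t ^+ 2 + k).

Variables (m k : R).
Hypotheses (m0 : 0 < m) (mk : m ^+ 2 <= k).

Let E := line_energy k.

Lemma line_energy_ge t : m <= E t.
Proof.
rewrite -(ger0_norm (ltW m0)) -sqrtr_sqr ler_wsqrtr//.
by apply: le_trans mk _; rewrite lerDr sqr_ge0.
Qed.

Lemma line_energy_gt0 t : 0 < E t.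
Proof. exact: lt_le_trans m0 (line_energy_ge t). Qed.

Let k0 : 0 <= k. Proof. by apply: le_trans mk; exact: sqr_ge0. Qed.

Lemma line_energy_sqr t : E t ^+ 2 = t ^+ 2 + k.
Proof. by rewrite sqr_sqrtr// addr_ge0// sqr_ge0. Qed.

Lemma le_line_energy t : `|t| <= E t.
Proof. by rewrite -sqrtr_sqr ler_wsqrtr// lerDl. Qed.

Lemma line_energy_dist t s : E s <= E t + `|t - s|.
Proof.
have E0 x : 0 <= E x by exact/ltW/line_energy_gt0.
rewrite -ler_sqr ?nnegrE ?addr_ge0// sqrrD !line_energy_sqr real_normK ?num_real//.
have h1 : t * (s - t) <= E t * `|t - s|.
  apply: le_trans (ler_norm _) _; rewrite normrM distrC ler_wpM2r//.
  exact: le_line_energy.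
lra.
Qed.

Lemma continuous_line_energy : continuous E.
Proof.
move=> t; apply: continuous_comp; last exact: sqrt_continuous.
by apply: cvgD; [exact: exprn_continuous|exact: cvg_cst].
Qed.

Lemma measurable_line_energyV : measurable_fun setT (fun t => (E t)^-1).
Proof.
apply: continuous_measurable_fun => t; apply: cvgV; last exact: continuous_line_energy.
by rewrite gt_eqF// line_energy_gt0.
Qed.

(** A solution of the homogeneous equation grows exponentially at one end of the line, whereas
    the weight only decays like the inverse of the distance. *)
Lemma line_solution_unique a b f1 f2 : b != 0 ->
  line_solution a b (cst 0) (cst 0) f1 f2 ->
  (\int[leb]_t ((f1 t ^+ 2 + f2 t ^+ 2) / E t)%:E < +oo)%E ->
  forall t, f1 t = 0 /\ f2 t = 0.
Proof.
move=> b0 sol fin; have [c1 [c2 fE]] := line_solution_homogeneous sol.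
have mf : measurable_fun setT (fun t => ((f1 t ^+ 2 + f2 t ^+ 2) / E t)%:E).
  apply/measurable_EFinP; apply: measurable_funM; last exact: measurable_line_energyV.
  have [/loc_abs_cont_continuous cf1 /loc_abs_cont_continuous cf2 _] := sol.
  by apply: measurable_funD; apply: measurable_funX; exact: continuous_measurable_fun.
have b0' : 0 < `|b| by rewrite normr_gt0.
pose c := c1 ^+ 2 + c2 ^+ 2.
have fE2 t : f1 t ^+ 2 + f2 t ^+ 2 = c * expR (b * t) ^+ 2.
  by have [-> ->] := fE t; rewrite -(twist_sqr a); rewrite /c; ring.
suff c_eq0 : c = 0.
  have : (c1 ^+ 2 == 0) && (c2 ^+ 2 == 0).
    by rewrite -paddr_eq0 ?sqr_ge0//; apply/eqP.
  rewrite !sqrf_eq0 => /andP[/eqP c10 /eqP c20] t; have [-> ->] := fE t.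
  by rewrite c10 c20 !mul0r addr0 subr0.
apply/eqP; apply: contraPT fin => c_neq0; apply/negP; rewrite -leNgt.
have c0 : 0 < c by rewrite lt_neqAle eq_sym c_neq0 addr_ge0 ?sqr_ge0.
(* kap is such that kap E(t) <= 1 + 2 |b t| <= e^(2 b t) on the half-line of growth *)
pose kap := Num.min (E 0)^-1 (2 * `|b|).
have kap0 : 0 < kap by rewrite lt_min invr_gt0 line_energy_gt0 mulr_gt0.
have mh := measurable_halfline (b < 0) (0 : R).
have low t : halfline (b < 0) 0 t -> c * kap <= (f1 t ^+ 2 + f2 t ^+ 2) / E t.
  move=> ht; rewrite fE2 -mulrA ler_wpM2l ?(ltW c0)// ler_pdivlMr ?line_energy_gt0//.
  have bt : b * t = `|b| * `|t|.
    move: ht; rewrite /halfline; case: ltP => b1 /=; rewrite in_itv/= ?andbT => t0.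
      by rewrite ltr0_norm// ler0_norm// mulrNN.
    by rewrite ger0_norm// gtr0_norm.
  rewrite -expRM_natl bt; apply: le_trans (expR_ge1Dx _).
  have := line_energy_dist 0 t; rewrite sub0r normrN => /(ler_wpM2l (ltW kap0)) h.
  apply: le_trans h _; rewrite mulrDr; apply: lerD.
    by rewrite -ler_pdivlMr ?line_energy_gt0// div1r /kap ge_min lexx.
  by rewrite mulrA -[2%:R * _]/(2 * _) ler_wpM2r// /kap ge_min lexx orbT.
apply: (@le_trans _ _ (\int[leb]_(t in halfline (b < 0)%R 0%R) (c * kap)%:E)%E).
  rewrite integral_cst//.
  have lh : leb (halfline (b < 0) 0) = +oo%E.
    by rewrite /halfline; case: ifP => _; rewrite lebesgue_measure_itv/= ?ltNyr ?ltry.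
  rewrite [X in (_ * X)%E](_ : _ = +oo%E); last exact: lh.
  by rewrite mulry gtr0_sg ?mulr_gt0// mul1e.
apply: (@le_trans _ _ (\int[leb]_(t in halfline (b < 0)%R 0%R) ((f1 t ^+ 2 + f2 t ^+ 2) / E t)%:E)%E).
  apply: ge0_le_integral => //.
  - by move=> t _; rewrite lee_fin mulr_ge0 ?ltW.
  - exact: measurable_funTS.
apply: ge0_subset_integral => //.
by move=> t _; rewrite lee_fin mulr_ge0 ?addr_ge0 ?sqr_ge0// invr_ge0 ltW// line_energy_gt0.
Qed.

Let kernel_weight (be u : R) : 0 < be -> 0 <= u ->
  1 + u / m <= (1 + 2 / (be * m)) * expR (be / 2 * u).
Proof.
move=> be0 u0.
have h := expR_ge1Dx (be / 2 * u).
have C0 : 0 < 1 + 2 / (be * m) by rewrite addr_gt0// divr_gt0// mulr_gt0.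
apply: le_trans (ler_wpM2l (ltW C0) h).
have -> : (1 + 2 / (be * m)) * (1 + be / 2 * u) = 1 + u / m + (be / 2 * u + 2 / (be * m)).
  by field; rewrite !gt_eqF.
rewrite lerDl; apply: addr_ge0; first by rewrite mulr_ge0// divr_ge0// ltW.
by rewrite divr_ge0// mulr_ge0// ltW.
Qed.

(** The second factor is the integral of the kernel with half the decay rate; the first one
    is the cost of absorbing the growth of the weight into the other half. *)
Definition schur_const (be : R) := (1 + 2 / (be * m)) * (2 / (be / 2)).

Lemma schur_const_ge0 be : 0 < be -> 0 <= schur_const be.
Proof.
move=> be0; apply: mulr_ge0; last by rewrite !divr_ge0// ltW.
by rewrite addr_ge0// divr_ge0// mulr_ge0// ltW.
Qed.

(** [E] is 1-Lipschitz and at least [m], so [1 / E t <= (1 + |t - s| / m) / E s], and half of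
    the exponential absorbs the linear factor. *)
Lemma exp_kernel_weight be s : 0 < be ->
  (\int[leb]_t (exp_kernel be t s / E t)%:E <= (schur_const be / E s)%:E)%E.
Proof.
move=> be0; pose C := 1 + 2 / (be * m).
have C0 : 0 < C by rewrite addr_gt0// divr_gt0// mulr_gt0.
have be20 : 0 < be / 2 by rewrite divr_gt0.
have CE0 : 0 <= C / E s by rewrite divr_ge0 ?ltW// line_energy_gt0.
apply: (@le_trans _ _ (\int[leb]_t ((C / E s)%:E * (exp_kernel (be / 2) s t)%:E))%E).
  apply: ge0_le_integral => //.
  - by move=> t _; rewrite lee_fin divr_ge0 ?exp_kernel_ge0// ltW// line_energy_gt0.
  - apply/measurable_EFinP; apply: measurable_funM; last exact: measurable_line_energyV.
    rewrite (_ : (fun t => exp_kernel be t s) = exp_kernel be s); first exact: measurable_exp_kernel.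
    by apply/funext => t; rewrite /exp_kernel distrC.
  - apply: emeasurable_funM; first exact: measurable_cst.
    by apply/measurable_EFinP; exact: measurable_exp_kernel.
  - move=> t _; rewrite -EFinM lee_fin.
    rewrite ler_pdivrMr ?line_energy_gt0//.
    have -> : C / E s * exp_kernel (be / 2) s t * E t =
      (C * exp_kernel (be / 2) s t * E t) / E s by ring.
    rewrite ler_pdivlMr ?line_energy_gt0//.
    have h1 : E s <= E t * (1 + `|t - s| / m).
      apply: le_trans (line_energy_dist t s) _; rewrite mulrDr mulr1 lerD2l mulrCA ler_peMr//.
      by rewrite ler_pdivlMr// mul1r line_energy_ge.
    have h2 := kernel_weight be0 (normr_ge0 (t - s)).
    have h3 := le_trans h1 (ler_wpM2l (ltW (line_energy_gt0 t)) h2).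
    have := ler_wpM2l (exp_kernel_ge0 be t s) h3.
    move=> /le_trans; apply.
    rewrite /exp_kernel [`|s - t|]distrC -/C le_eqVlt; apply/orP; left; apply/eqP.
    have -> : expR (- (be / 2 * `|t - s|)) = expR (- (be * `|t - s|)) * expR (be / 2 * `|t - s|).
      by rewrite -expRD; congr expR; field.
    ring.
rewrite ge0_integralZl//.
- by rewrite integral_expR_abs// -EFinM lee_fin /schur_const -/C mulrAC.
- by apply/measurable_EFinP; exact: measurable_exp_kernel.
- by move=> t _; rewrite lee_fin exp_kernel_ge0.
Qed.

(** The kernel is pointwise at most a multiple of the weight, since [e^(- be u) u <= 1 / be];
    thus a source of finite weighted norm is integrated by the kernel at every point. *)
Lemma exp_kernel_le_weight be t s : 0 < be ->
  exp_kernel be t s <= (E t + be^-1) / E s.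
Proof.
move=> be0; rewrite ler_pdivlMr ?line_energy_gt0//.
apply: le_trans (ler_wpM2l (exp_kernel_ge0 be t s) (line_energy_dist t s)) _.
rewrite mulrDr; apply: lerD.
  rewrite ger_pMl ?line_energy_gt0// /exp_kernel -expR0 ler_expR oppr_le0 mulr_ge0//; lra.
rewrite /exp_kernel expRN mulrC ler_pdivrMr ?expR_gt0//.
rewrite -[leLHS](mulKf (lt0r_neq0 be0)); apply: ler_wpM2l; first by rewrite invr_ge0 ltW.
by have := expR_ge1Dx (be * `|t - s|); lra.
Qed.

End line_weight.

Section line_schur.
Context {R : realType}.
Local Notation leb := (@lebesgue_measure R).
Variables (m k : R).
Hypotheses (m0 : 0 < m) (mk : m ^+ 2 <= k).
Local Notation E := (line_energy k).
Variables (a b : R) (g1 g2 : R -> R).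
Hypotheses (b0 : b != 0).
Hypotheses (mg1 : measurable_fun setT g1) (mg2 : measurable_fun setT g2).

Let G s := g1 s ^+ 2 + g2 s ^+ 2.

Let mG : measurable_fun setT G.
Proof. by apply: measurable_funD; exact: measurable_funX. Qed.

Let G0 s : 0 <= G s.
Proof. by rewrite addr_ge0 ?sqr_ge0. Qed.

Let be0 : 0 < `|b|. Proof. by rewrite normr_gt0. Qed.

Lemma exp_kernel_conv_lty t : (\int[leb]_s (G s / E s)%:E < +oo)%E ->
  (\int[leb]_s (exp_kernel `|b| t s * G s)%:E < +oo)%E.
Proof.
move=> fin; pose c := E t + `|b|^-1.
have c0 : 0 <= c by rewrite addr_ge0 ?invr_ge0// ltW// (line_energy_gt0 m0 mk).
apply: (@le_lt_trans _ _ (\int[leb]_s (c%:E * (G s / E s)%:E))%E).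
  apply: ge0_le_integral => //.
  - by move=> s _; rewrite lee_fin mulr_ge0 ?exp_kernel_ge0.
  - by apply/measurable_EFinP; apply: measurable_funM => //; exact: measurable_exp_kernel.
  - apply: emeasurable_funM; first exact: measurable_cst.
    by apply/measurable_EFinP; apply: measurable_funM => //; exact: measurable_line_energyV m0 mk.
  - move=> s _; rewrite -EFinM lee_fin.
    have -> : c * (G s / E s) = c / E s * G s by ring.
    by rewrite ler_wpM2r// (exp_kernel_le_weight m0 mk).
rewrite ge0_integralZl//; first by rewrite lte_mul_pinfty// lee_fin.
- by apply/measurable_EFinP; apply: measurable_funM => //; exact: measurable_line_energyV m0 mk.
- by move=> s _; rewrite lee_fin divr_ge0// ltW// (line_energy_gt0 m0 mk).
Qed.

Hypothesis msol : measurable_fun setT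
  (fun t => line_sol1 a b g1 g2 t ^+ 2 + line_sol2 a b g1 g2 t ^+ 2).

(** Schur's test: [line_sol_bound] dominates the squared solution by the kernel integrated
    against the squared source; after exchanging the integrals, [exp_kernel_weight] moves the
    weight from one variable to the other. *)
Lemma line_sol_weighted :
  (\int[leb]_t ((line_sol1 a b g1 g2 t ^+ 2 + line_sol2 a b g1 g2 t ^+ 2) / E t)%:E <=
   (2 / `|b| * schur_const m `|b|)%:E * \int[leb]_s (G s / E s)%:E)%E.
Proof.
have E0 t : 0 < E t by exact: line_energy_gt0 m0 mk t.
have mEV := measurable_line_energyV m0 mk.
pose F (x : measurableTypeR R * measurableTypeR R) : \bar R :=
  (exp_kernel `|b| x.1 x.2 * G x.2 / E x.1)%:E.
have mF : measurable_fun setT F.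
  apply/measurable_EFinP; apply: measurable_funM; last first.
    by apply: (measurableT_comp mEV); exact: measurable_fst.
  apply: measurable_funM; last by apply: (measurableT_comp mG); exact: measurable_snd.
  rewrite /exp_kernel; apply: (@measurableT_comp _ _ _ _ _ _ (fun r : R => expR (- (`|b| * `|r|))) _
    (fun x : measurableTypeR R * measurableTypeR R => (x.1 : R) - (x.2 : R))).
    apply: continuous_measurable_fun => s; apply: continuous_comp; last exact: continuous_expR.
    by apply: cvgN; apply: cvgM; [exact: cvg_cst|exact: norm_continuous].
  by apply: measurable_funB; [exact: measurable_fst|exact: measurable_snd].
have F0 x : (0 <= F x)%E.
  by rewrite lee_fin !mulr_ge0 ?exp_kernel_ge0// invr_ge0 ltW.
have c0 : 0 <= 2 / `|b| by rewrite divr_ge0.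
have mL : measurable_fun setT (fun t => \int[leb]_s F (t, s))%E.
  exact: (@measurable_fun_fubini_tonelli_F _ _ _ _ R leb F mF F0).
have mGE : measurable_fun setT (fun s => (G s / E s)%:E).
  by apply/measurable_EFinP; exact: measurable_funM.
have GE0 s : (0 <= (G s / E s)%:E)%E by rewrite lee_fin divr_ge0// ltW.
apply: (@le_trans _ _ (\int[leb]_t ((2 / `|b|)%:E * \int[leb]_s F (t, s)))%E).
  apply: ge0_le_integral => //.
  - by move=> t _; rewrite lee_fin divr_ge0 ?addr_ge0 ?sqr_ge0// ltW.
  - by apply/measurable_EFinP; exact: measurable_funM.
  - by apply: emeasurable_funM => //; exact: measurable_cst.
  - move=> t _.
    have -> : (\int[leb]_s F (t, s) = (E t)^-1%:E * \int[leb]_s (exp_kernel `|b| t s * G s)%:E)%E.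
      rewrite -ge0_integralZl//.
      + by apply: eq_integral => s _; rewrite /F /= -EFinM mulrC.
      + by apply/measurable_EFinP; apply: measurable_funM => //; exact: measurable_exp_kernel.
      + by move=> s _; rewrite lee_fin mulr_ge0 ?exp_kernel_ge0.
      + by rewrite lee_fin invr_ge0 ltW.
    rewrite mulrC EFinM muleCA; apply: lee_wpmul2l.
      by rewrite lee_fin invr_ge0 ltW.
    exact: line_sol_bound.
rewrite ge0_integralZl//; last by move=> t _; apply: integral_ge0.
rewrite [(2 / `|b| * schur_const m `|b|)%:E]EFinM -muleA; apply: lee_wpmul2l => //.
rewrite (@fubini_tonelli _ _ _ _ R leb leb F mF F0).
rewrite -ge0_integralZl//; last by rewrite lee_fin schur_const_ge0.
apply: ge0_le_integral => //.
- by move=> s _; apply: integral_ge0.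
- exact: (@measurable_fun_fubini_tonelli_G _ _ _ _ R leb F mF F0).
- by apply: emeasurable_funM => //; exact: measurable_cst.
- move=> s _.
  have -> : (\int[leb]_t F (t, s) = (G s)%:E * \int[leb]_t (exp_kernel `|b| t s / E t)%:E)%E.
    rewrite -ge0_integralZl//.
    + by apply: eq_integral => t _; rewrite /F /= -EFinM; congr EFin; ring.
    + apply/measurable_EFinP; apply: measurable_funM => //.
      rewrite (_ : (fun t => exp_kernel `|b| t s) = exp_kernel `|b| s); first exact: measurable_exp_kernel.
      by apply/funext => t; rewrite /exp_kernel distrC.
    + by move=> t _; rewrite lee_fin divr_ge0 ?exp_kernel_ge0// ltW.
    + by rewrite lee_fin.
  have -> : ((schur_const m `|b|)%:E * (G s / E s)%:E = (G s)%:E * (schur_const m `|b| / E s)%:E)%E.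
    by rewrite -!EFinM; congr EFin; ring.
  by apply: lee_wpmul2l; [rewrite lee_fin|exact: (exp_kernel_weight m0 mk)].
Qed.

End line_schur.

(** * Lebesgue measure on R^n along parallel lines *)

Section box_measure.
Context {R : realType}.
Local Notation leb := (@lebesgue_measure R).
Local Notation lebn := (@lebesgue_measure_n R).

Definition box n (A : 'I_n -> set R) : set (n.-tuple R) :=
  [set p | forall i, A i (tnth p i)].

Definition boxes n : set (set (n.-tuple R)) :=
  [set box A | A in [set A : 'I_n -> set R | forall i, measurable (A i)]].

Lemma measurable_box n (A : 'I_n -> set R) : (forall i, measurable (A i)) ->
  measurable (box A).
Proof.
move=> mA; rewrite (_ : box A = \bigcap_(i in [set: 'I_n])
    ((fun p : n.-tuple R => tnth p i) @^-1` A i)); last first.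
  by apply/seteqP; split => [p Bp i _|p Bp i]; [exact: Bp|exact: Bp].
apply: fin_bigcap_measurable => // i _.
by rewrite -[X in measurable X]setTI; apply: measurable_tnth.
Qed.

Lemma boxes_setI n : setI_closed (@boxes n).
Proof.
move=> _ _ [A mA <-] [B mB <-]; exists (fun i => A i `&` B i) => /=.
  by move=> i; exact: measurableI.
apply/seteqP; split => [p AB|p [pA pB] i]; last by split.
by split => i; have [] := AB i.
Qed.

Lemma measurable_boxes n : measurable = <<s @boxes n >>.
Proof.
apply/seteqP; split; last first.
  apply: smallest_sub; first exact: sigma_algebra_measurable.
  by move=> _ [A mA <-]; exact: measurable_box.
apply: smallest_sub; first exact: smallest_sigma_algebra.
move=> B; rewrite -bigcup_seq => -[i _ [A mA <-]].
apply: sub_sigma_algebra; exists (fun k => if k == i then A else setT) => /=.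
  by move=> k; case: ifP.
apply/seteqP; split => [p /(_ i)|p [_ Ap] k]; first by rewrite eqxx.
by case: eqP => // ->.
Qed.

Definition cube n (k : nat) : set (n.-tuple R) :=
  box (fun=> `]- k%:R, k%:R[%classic).

Lemma cube_cover n : \bigcup_k (@cube n k) = setT.
Proof.
apply/seteqP; split => // p _.
exists (Num.trunc (\sum_i `|tnth p i|)).+1 => // i /=.
rewrite in_itv/= -ltr_norml; apply: le_lt_trans (truncnS_gt _).
by rewrite (bigD1 i)//= lerDl sumr_ge0.
Qed.

Lemma boxes_cube n k : boxes (@cube n k).
Proof. by exists (fun=> `]- k%:R, k%:R[%classic) => // i; exact: measurable_itv. Qed.

Lemma cube_lty n k : (lebn n (@cube n k) < +oo)%E.
Proof.
rewrite lebesgue_measure_n_box; last by move=> i; exact: measurable_itv.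
have len : leb `]- k%:R, k%:R[%classic =
    (if - k%:R < k%:R :> R then k%:R - - k%:R else 0 : R)%:E.
  by rewrite lebesgue_measure_itv/= lte_fin; case: ifP => // _; rewrite EFinB.
by under eq_bigr do rewrite len; rewrite prodEFin ltry.
Qed.

Lemma lebesgue_measure_n_sigma_finite n : sigma_finite setT (lebn n).
Proof.
exists (@cube n); first by rewrite cube_cover.
move=> k; split; last exact: cube_lty.
by apply: measurable_box => i; exact: measurable_itv.
Qed.

(** A copy of [lebesgue_measure_n] to carry the sigma-finite structure that Tonelli's theorem
    asks for. *)
Definition sigma_finite_lebesgue n : set (n.-tuple R) -> \bar R := lebn n.

HB.instance Definition _ n := isMeasure.Build _ _ _ (@sigma_finite_lebesgue n)
  (measure0 (lebn n)) (measure_ge0 (lebn n))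
  (@measure_semi_sigma_additive _ _ _ (lebn n)).

HB.instance Definition _ n := Measure_isSigmaFinite.Build _ _ _
  (@sigma_finite_lebesgue n) (@lebesgue_measure_n_sigma_finite n).

End box_measure.

Section disintegration.
Context {R : realType} {n : nat}.
Local Notation leb := (@lebesgue_measure R).
Local Notation lebn := (@lebesgue_measure_n R).
Variable j : 'I_n.+1.

Definition insert_pair (x : n.-tuple R * measurableTypeR R) : n.+1.-tuple R :=
  @insert_coord R n.+1 j x.1 x.2.

Lemma measurable_insert_pair : measurable_fun setT insert_pair.
Proof.
apply/measurable_fun_tnthP => i.
rewrite (_ : _ \o _ = fun x => if unlift j i is Some k then tnth x.1 k else x.2); last first.
  by apply/funext => x /=; rewrite /insert_pair tnth_mktuple.
case: (unlift j i) => [k|]; last exact: measurable_snd.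
apply: (@measurableT_comp _ _ _ _ _ _ (fun q : n.-tuple R => tnth q k)).
  exact: measurable_tnth.
exact: measurable_fst.
Qed.

Definition fibered_measure : {measure set (n.-tuple R * measurableTypeR R) -> \bar R} :=
  (@sigma_finite_lebesgue R n \x leb)%E.

(** Both sides are measures that agree on boxes, a generating family closed under
    intersection that contains an exhaustion of the space by sets of finite measure. *)
Lemma disintegration_set (A : set (n.+1.-tuple R)) : measurable A ->
  lebn n.+1 A = fibered_measure (insert_pair @^-1` A).
Proof.
pose m2 : {measure set (n.+1.-tuple R) -> \bar R} :=
  measure_function_pushforward__canonical__measure_function_Measure fibered_measure measurable_insert_pair.
move=> mA; change (lebn n.+1 A = m2 A).
apply: (measure_unique (@boxes R n.+1) (@cube R n.+1)) => //.
- exact: measurable_boxes.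
- exact: boxes_setI.
- exact: boxes_cube.
- exact: cube_cover.
- move=> _ [B mB <-]; rewrite lebesgue_measure_n_box// (bigD1_ord j)//=.
  rewrite /pushforward (_ : _ @^-1` _ = box (fun i : 'I_n => B (lift j i)) `*` (B j)); last first.
    apply/seteqP; split => [[q t] h|[q t] [/= hq ht] i].
      split => [i|]; [have := h (lift j i)|have := h j];
        by rewrite /insert_pair tnth_mktuple ?liftK ?unlift_none.
    by rewrite /insert_pair tnth_mktuple; case: unliftP => [k ->|->].
  have mb : measurable (box (fun i : 'I_n => B (lift j i))) by exact: measurable_box.
  have mBj : measurable (B j : set (measurableTypeR R)) by exact: mB.
  have -> := product_measure1E (@sigma_finite_lebesgue R n) leb mb mBj.
  by rewrite muleC; congr (_ * _)%E; rewrite lebesgue_measure_n_box.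
- exact: cube_lty.
Qed.

Lemma ge0_disintegration (F : n.+1.-tuple R -> \bar R) :
  measurable_fun setT F -> (forall p, 0 <= F p)%E ->
  (\int[lebn n.+1]_p F p =
   \int[@sigma_finite_lebesgue R n]_q \int[leb]_t F (insert_coord j q t))%E.
Proof.
move=> mF F0.
pose m2 : {measure set (n.+1.-tuple R) -> \bar R} :=
  measure_function_pushforward__canonical__measure_function_Measure fibered_measure measurable_insert_pair.
rewrite (eq_measure_integral m2); last by move=> A mA _; exact: disintegration_set.
have := @ge0_integral_pushforward _ _ _ _ R _ measurable_insert_pair
  fibered_measure setT F measurableT mF (fun p _ => F0 p).
rewrite preimage_setT => ->.
rewrite [LHS]fubini_tonelli1//=.
by apply: measurableT_comp => //; exact: measurable_insert_pair.
Qed.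

Lemma measurable_line_integral (F : n.+1.-tuple R -> \bar R) :
  measurable_fun setT F -> (forall p, 0 <= F p)%E ->
  measurable_fun setT (fun q : n.-tuple R => \int[leb]_t F (insert_coord j q t))%E.
Proof.
move=> mF F0.
have mFi : measurable_fun setT (F \o insert_pair).
  by apply: measurableT_comp => //; exact: measurable_insert_pair.
exact: (measurable_fun_fubini_tonelli_F (m2 := leb) _ mFi (fun x => F0 _)).
Qed.

Lemma measurable_insert_line (q : n.-tuple R) :
  measurable_fun [set: measurableTypeR R] (@insert_coord R n.+1 j q).
Proof.
apply/measurable_fun_tnthP => i.
rewrite (_ : _ \o _ = fun t => if unlift j i is Some k then tnth q k else t); last first.
  by apply/funext => t /=; rewrite tnth_mktuple.
by case: (unlift j i).
Qed.

Lemma ae_line_integral_lty (F : n.+1.-tuple R -> \bar R) :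
  measurable_fun setT F -> (forall p, 0 <= F p)%E ->
  (\int[lebn n.+1]_p F p < +oo)%E ->
  \forall q \ae lebn n, (\int[leb]_t F (insert_coord j q t) < +oo)%E.
Proof.
move=> mF F0 Foo.
have mW := measurable_line_integral mF F0.
have intW : (lebn n).-integrable setT (fun q => \int[leb]_t F (insert_coord j q t))%E.
  apply/integrableP; split => //.
  under eq_integral do rewrite gee0_abs ?integral_ge0//.
  by move: Foo; rewrite ge0_disintegration.
have := integrable_ae measurableT intW.
apply: filterS => q /(_ I) fq.
by rewrite ltey_eq fq.
Qed.

Lemma ae_lines (P : set (n.+1.-tuple R)) :
  (\forall p \ae lebn n.+1, P p) ->
  \forall q \ae lebn n, \forall t \ae leb, P (insert_coord j q t).
Proof.
move=> [N [mN N0 Nsub]].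
pose F p : \bar R := (\1_N p)%:E.
have mF : measurable_fun setT F by apply/measurable_EFinP; exact: measurable_indic.
have F0 p : (0 <= F p)%E by rewrite lee_fin.
have mW := measurable_line_integral mF F0.
have /(ae_eq_integral_abs (lebn n) measurableT mW) :
    (\int[lebn n]_q `|\int[leb]_t F (insert_coord j q t)| = 0)%E.
  under eq_integral do rewrite gee0_abs ?integral_ge0//.
  rewrite -[LHS]ge0_disintegration// integral_indic// setIT.
  exact: N0.
apply: filterS => q /(_ I) /= Wq.
pose Nq : set (measurableTypeR R) := [set t | N (insert_coord j q t)].
have mNq : measurable Nq.
  rewrite -[X in measurable X]setTI.
  exact: measurable_insert_line.
exists Nq; split => //; last by move=> t nP; apply: Nsub.
by rewrite -[RHS]Wq -[in LHS](setIT Nq) -integral_indic.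
Qed.

(** The measurability of [P] is essential here: a set that is not measurable may meet every
    line in a null set without being null. *)
Lemma ae_of_lines (P : set (n.+1.-tuple R)) : measurable P ->
  (\forall q \ae lebn n, \forall t \ae leb, P (insert_coord j q t)) ->
  \forall p \ae lebn n.+1, P p.
Proof.
move=> mP aeP; exists (~` P); split => //; first exact: measurableC.
pose F p : \bar R := (\1_(~` P) p)%:E.
have mF : measurable_fun setT F by apply/measurable_EFinP; apply: measurable_indic; exact: measurableC.
have F0 p : (0 <= F p)%E by rewrite lee_fin.
transitivity (\int[lebn n.+1]_p F p)%E.
  by rewrite integral_indic ?setIT//; exact: measurableC.
rewrite ge0_disintegration//.
have mW := measurable_line_integral mF F0.
transitivity (\int[lebn n]_q `|\int[leb]_t F (insert_coord j q t)|)%E.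
  by apply: eq_integral => q _; rewrite gee0_abs// integral_ge0.
apply/(ae_eq_integral_abs (lebn n) measurableT mW).
apply: filterS aeP => q aeq _.
pose Pq : set (measurableTypeR R) := [set t | ~ P (insert_coord j q t)].
have mPq : measurable Pq.
  rewrite -[X in measurable X]setTI; exact: (measurable_insert_line q measurableT (measurableC mP)).
transitivity (leb Pq).
  by rewrite -[in RHS](setIT Pq) -integral_indic.
have [N [mN N0 Nsub]] := aeq.
exact: subset_measure0 mPq mN _ N0.
Qed.

(** The cylinder over a null set of lines is null. *)
Lemma ae_whole_lines (Q : set (n.-tuple R)) (P : set (n.+1.-tuple R)) :
  (forall q, Q q -> forall t, P (insert_coord j q t)) ->
  (\forall q \ae lebn n, Q q) -> \forall p \ae lebn n.+1, P p.
Proof.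
move=> QP [N [mN N0 Nsub]].
pose del (p : n.+1.-tuple R) : n.-tuple R := [tuple tnth p (lift j i) | i < n].
have mdel : measurable_fun setT del.
  apply/measurable_fun_tnthP => i.
  rewrite (_ : _ \o _ = fun p => tnth p (lift j i)); first exact: measurable_tnth.
  by apply/funext => p /=; rewrite tnth_mktuple.
exists (del @^-1` N); split.
- by rewrite -[X in measurable X]setTI; exact: mdel.
- rewrite disintegration_set; last by rewrite -[X in measurable X]setTI; exact: mdel.
  rewrite (_ : _ @^-1` _ = N `*` [set: measurableTypeR R]); last first.
    have delK q t : del (insert_coord j q t) = q.
      by apply: eq_from_tnth => i; rewrite !tnth_mktuple liftK.
    by apply/seteqP; split => [[q t]|[q t] []]; rewrite /insert_pair/= delK.
  rewrite [LHS](product_measure1E (@sigma_finite_lebesgue R n) leb mN measurableT).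
  by rewrite [X in (X * _)%E]N0 mul0e.
- move=> p nP; apply: Nsub => Qp; apply: nP.
  have -> : p = insert_coord j (del p) (tnth p j).
    apply: eq_from_tnth => i; rewrite tnth_mktuple.
    by case: unliftP => [k ->|->//]; rewrite tnth_mktuple.
  exact: QP.
Qed.

End disintegration.

(** * Square integrable functions on almost every line *)

Import Normc.
Local Open Scope complex_scope.

Section density.
Context {R : realType} {n : nat} (m : {posnum R}).
Implicit Types (phi psi : n.-tuple R -> R[i]).

Definition sqdensity phi p : \bar R := (normc (phi p) ^+ 2 / energy m p)%:E.

Lemma measurable_sqdensity phi : cmeasurable phi -> measurable_fun setT (sqdensity phi).
Proof.
move=> mphi; rewrite (_ : sqdensity phi = fun p => (weighted_modulus m phi p ^+ 2)%:E).
  by apply/measurable_EFinP; apply: measurable_funX; exact: measurable_weighted_modulus.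
apply/funext => p; rewrite /sqdensity /weighted_modulus exprMn exprVn sqr_sqrtr//.
exact/ltW/energy_gt0.
Qed.

Lemma sqdensity_ge0 phi p : (0 <= sqdensity phi p)%E.
Proof. by rewrite lee_fin divr_ge0 ?sqr_ge0// ltW// energy_gt0. Qed.

Lemma sqintegral_ge0 phi : (0 <= sqintegral m phi)%E.
Proof. by apply: integral_ge0 => p _; exact: sqdensity_ge0. Qed.

Lemma le_norm_r phi psi (c : R) : 0 <= c -> (sqintegral m psi < +oo)%E ->
  (sqintegral m phi <= c%:E * sqintegral m psi)%E ->
  norm_r m phi <= Num.sqrt c * norm_r m psi.
Proof.
move=> c0 fin le; rewrite /norm_r -sqrtrM// ler_wsqrtr//.
move: le fin (sqintegral_ge0 phi) (sqintegral_ge0 psi).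
by case: (sqintegral m psi) => [r||]//; case: (sqintegral m phi) => [s||]//=.
Qed.

End density.

Section coordinates.
Context {R : realType} {n : nat}.
Local Notation leb := (@lebesgue_measure R).
Local Notation lebn := (@lebesgue_measure_n R).
Local Notation T := (n.+1.-tuple R).
Variables (m : {posnum R}) (j : 'I_n.+1).
Implicit Types (q : n.-tuple R) (p : T).

Lemma tnth_insert_coord q t : tnth (@insert_coord R n.+1 j q t) j = t.
Proof. by rewrite tnth_mktuple unlift_none. Qed.

Lemma set_coord_insert q t s :
  set_coord j (@insert_coord R n.+1 j q t) s = insert_coord j q s.
Proof.
apply: eq_from_tnth => i; rewrite !tnth_mktuple.
case: eqP => [->|/eqP]; first by rewrite unlift_none.
by rewrite eq_sym => /unlift_some[k -> ->].
Qed.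

Definition transverse_energy q : R := \sum_(i < n) tnth q i ^+ 2 + m%:num ^+ 2.

Lemma transverse_energy_ge q : m%:num ^+ 2 <= transverse_energy q.
Proof. by rewrite lerDr sumr_ge0// => i _; exact: sqr_ge0. Qed.

Lemma energy_insert q t :
  energy m (@insert_coord R n.+1 j q t) = line_energy (transverse_energy q) t.
Proof.
rewrite /energy /line_energy; congr Num.sqrt.
rewrite (bigD1_ord j)//= tnth_insert_coord -addrA; congr (_ + (_ + _)).
by apply: eq_bigr => i _; rewrite tnth_mktuple liftK.
Qed.

Lemma measurable_set_coord :
  measurable_fun setT (fun x : T * measurableTypeR R => set_coord j x.1 x.2).
Proof.
apply/measurable_fun_tnthP => i.
rewrite (_ : _ \o _ = fun x => if i == j then x.2 else tnth x.1 i); last first.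
  by apply/funext => x /=; rewrite tnth_mktuple.
case: eqP => _; first exact: measurable_snd.
apply: (@measurableT_comp _ _ _ _ _ _ (fun q : T => tnth q i)).
  exact: measurable_tnth.
exact: measurable_fst.
Qed.

Lemma measurable_insert (h : T -> R) q : measurable_fun setT h ->
  measurable_fun [set: R] (fun t => h (insert_coord j q t)).
Proof. by move=> mh; apply: measurableT_comp => //; exact: measurable_insert_line. Qed.

Lemma normc_sqr (z : R[i]) : normc z ^+ 2 = complex.Re z ^+ 2 + complex.Im z ^+ 2.
Proof. by case: z => x y; rewrite sqr_sqrtr// addr_ge0 ?sqr_ge0. Qed.

Definition line_sqintegral (phi : T -> R[i]) q : \bar R :=
  (\int[leb]_t ((complex.Re (phi (insert_coord j q t)) ^+ 2 +
     complex.Im (phi (insert_coord j q t)) ^+ 2) / line_energy (transverse_energy q) t)%:E)%E.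

Let line_density phi q :
  line_sqintegral phi q = (\int[leb]_t sqdensity m phi (insert_coord j q t))%E.
Proof. by apply: eq_integral => t _; rewrite /sqdensity normc_sqr energy_insert. Qed.

Lemma sqintegral_lines phi : cmeasurable phi ->
  sqintegral m phi = (\int[@sigma_finite_lebesgue R n]_q line_sqintegral phi q)%E.
Proof.
move=> mphi; rewrite /sqintegral -[LHS]/(\int[lebn n.+1]_p sqdensity m phi p)%E.
rewrite (ge0_disintegration j (measurable_sqdensity m mphi) (sqdensity_ge0 m phi)).
by apply: eq_integral => q _; rewrite line_density.
Qed.

Lemma measurable_line_sqintegral phi : cmeasurable phi ->
  measurable_fun setT (line_sqintegral phi).
Proof.
move=> mphi.
rewrite (_ : line_sqintegral phi = fun q => \int[leb]_t sqdensity m phi (insert_coord j q t))%E.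
  exact: (measurable_line_integral j (measurable_sqdensity m mphi) (sqdensity_ge0 m phi)).
by apply/funext => q; exact: line_density.
Qed.

Lemma line_sqintegral_ge0 phi q : (0 <= line_sqintegral phi q)%E.
Proof. by rewrite line_density; apply: integral_ge0 => t _; exact: sqdensity_ge0. Qed.

Lemma ae_line_sqintegral_lty phi : cmeasurable phi -> (sqintegral m phi < +oo)%E ->
  \forall q \ae lebn n, (line_sqintegral phi q < +oo)%E.
Proof.
move=> mphi fin.
have := ae_line_integral_lty j (measurable_sqdensity m mphi) (sqdensity_ge0 m phi) fin.
by apply: filterS => q; rewrite line_density.
Qed.

End coordinates.

Section parametrized_integral.
Context d (X : measurableType d) {R : realType}.
Local Notation leb := (@lebesgue_measure R).

Lemma measurable_Rintegral_param (U : X * measurableTypeR R -> R) :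
  measurable_fun setT U -> measurable_fun setT (fun x => \int[leb]_s U (x, s)).
Proof.
move=> mU; rewrite /Rintegral; apply: measurableT_comp; first exact: fine_measurable.
have mU' : measurable_fun setT (EFin \o U) by exact/measurable_EFinP.
rewrite (_ : (fun _ => _) = fun x => (\int[leb]_s ((EFin \o U)^\+ (x, s)) -
   \int[leb]_s ((EFin \o U)^\- (x, s)))%E); last first.
  by apply/funext => x; rewrite integralE; congr (_ - _)%E; apply: eq_integral => s _; rewrite ?funeposE ?funenegE.
apply: emeasurable_funB.
  apply: (measurable_fun_fubini_tonelli_F (m2 := leb) ((EFin \o U)^\+)%E) => //.
  exact: measurable_funepos.
apply: (measurable_fun_fubini_tonelli_F (m2 := leb) ((EFin \o U)^\-)%E) => //.
exact: measurable_funeneg.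
Qed.

End parametrized_integral.

(** * The solution operator *)

Section solution_operator.
Context {R : realType} {n : nat}.
Local Notation leb := (@lebesgue_measure R).
Local Notation lebn := (@lebesgue_measure_n R).
Local Notation T := (n.+1.-tuple R).
Variables (m : {posnum R}) (j : 'I_n.+1).
Variables (a b : R).
Hypothesis b0 : b != 0.

Definition re_line (psi : T -> R[i]) p s := complex.Re (psi (set_coord j p s)).
Definition im_line (psi : T -> R[i]) p s := complex.Im (psi (set_coord j p s)).

(** The candidate for the resolvent at [z = a + i b], one line at a time. *)
Definition kg_sol (psi : T -> R[i]) (p : T) : R[i] :=
  line_sol1 a b (re_line psi p) (im_line psi p) (tnth p j) +i*
  line_sol2 a b (re_line psi p) (im_line psi p) (tnth p j).

Lemma kg_sol_insert psi q t (p := @insert_coord R n.+1 j q t) :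
  kg_sol psi p =
  line_sol1 a b (fun s => complex.Re (psi (insert_coord j q s)))
    (fun s => complex.Im (psi (insert_coord j q s))) t +i*
  line_sol2 a b (fun s => complex.Re (psi (insert_coord j q s)))
    (fun s => complex.Im (psi (insert_coord j q s))) t.
Proof.
rewrite /kg_sol tnth_insert_coord.
have -> : re_line psi p = (fun s => complex.Re (psi (insert_coord j q s))).
  by apply/funext => s; rewrite /re_line set_coord_insert.
have -> : im_line psi p = (fun s => complex.Im (psi (insert_coord j q s))).
  by apply/funext => s; rewrite /im_line set_coord_insert.
by [].
Qed.

(** The half-line of integration moves with [p]; the indicator of a measurable subset of the
    product turns the integral into one with fixed domain. *)
Lemma measurable_untwisted (v : T * measurableTypeR R -> R) : measurable_fun setT v ->
  measurable_fun setT (fun p : T => untwisted (fun s => v (p, s)) b (tnth p j)).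
Proof.
move=> mv; rewrite /untwisted /halfline_primitive.
apply: measurable_funM; first exact: measurable_cst.
pose W : set (T * measurableTypeR R) := [set x | halfline (b < 0) (tnth x.1 j) x.2].
have mW : measurable W.
  pose h (x : T * measurableTypeR R) : R := (x.2 : R) - tnth x.1 j.
  have mh : measurable_fun setT h.
    apply: measurable_funB; first exact: measurable_snd.
    by apply: (measurableT_comp (measurable_tnth j)); exact: measurable_fst.
  have -> : W = h @^-1` (halfline (b < 0) 0).
    apply/seteqP; split => x; rewrite /W/h/halfline/=; case: ifP => _ /=;
      by rewrite !in_itv/= ?andbT ?subr_le0 ?subr_gt0.
  by rewrite -[X in measurable X]setTI; apply: mh => //; exact: measurable_halfline.
pose U (x : T * measurableTypeR R) : R := \1_W x * (expR (- b * (x.2 : R)) * v x).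
rewrite (_ : (fun p => _) = fun p => \int[leb]_s U (p, s)).
  apply: measurable_Rintegral_param; apply: measurable_funM; first exact: measurable_indic.
  apply: measurable_funM => //.
  apply: (@measurableT_comp _ _ _ _ _ _ (fun r : R => expR (- b * r))); last exact: measurable_snd.
  by apply: continuous_measurable_fun; apply: continuous_scale; exact: continuous_expR.
apply/funext => p; rewrite Rintegral_mkcond; apply: eq_Rintegral => s _.
rewrite patchE /U indicE.
have -> : ((p, s) \in W) = (s \in halfline (b < 0) (tnth p j)) by apply/idP/idP; rewrite !inE.
by case: (s \in _); rewrite ?mul1r ?mul0r.
Qed.

Lemma cmeasurable_kg_sol psi : cmeasurable psi -> cmeasurable (kg_sol psi).
Proof.
move=> [mre mim].
have mre' : measurable_fun setT (fun x : T * measurableTypeR R => re_line psi x.1 x.2).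
  by apply: (measurableT_comp mre); exact: measurable_set_coord.
have mim' : measurable_fun setT (fun x : T * measurableTypeR R => im_line psi x.1 x.2).
  by apply: (measurableT_comp mim); exact: measurable_set_coord.
have mcos : measurable_fun setT (fun x : T * measurableTypeR R => cos (a * (x.2 : R))).
  apply: (@measurableT_comp _ _ _ _ _ _ (fun r : R => cos (a * r))); last exact: measurable_snd.
  by apply: continuous_measurable_fun; apply: continuous_scale; exact: continuous_cos.
have msin : measurable_fun setT (fun x : T * measurableTypeR R => sin (a * (x.2 : R))).
  apply: (@measurableT_comp _ _ _ _ _ _ (fun r : R => sin (a * r))); last exact: measurable_snd.
  by apply: continuous_measurable_fun; apply: continuous_scale; exact: continuous_sin.
have mU1 : measurable_fun setT (fun p =>
    untwisted (line_source1 a (re_line psi p) (im_line psi p)) b (tnth p j)).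
  apply: (@measurable_untwisted (fun x => line_source1 a (re_line psi x.1) (im_line psi x.1) x.2)).
  by apply: measurable_funD; exact: measurable_funM.
have mU2 : measurable_fun setT (fun p =>
    untwisted (line_source2 a (re_line psi p) (im_line psi p)) b (tnth p j)).
  apply: (@measurable_untwisted (fun x => line_source2 a (re_line psi x.1) (im_line psi x.1) x.2)).
  by apply: measurable_funB; exact: measurable_funM.
have mC : measurable_fun setT (fun p : T => twist_cos a b (tnth p j)).
  apply: (measurableT_comp _ (measurable_tnth j)).
  by apply: continuous_measurable_fun; exact: continuous_twist_cos.
have mS : measurable_fun setT (fun p : T => twist_sin a b (tnth p j)).
  apply: (measurableT_comp _ (measurable_tnth j)).
  by apply: continuous_measurable_fun; exact: continuous_twist_sin.
split; [apply: measurable_funD|apply: measurable_funB]; exact: measurable_funM.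
Qed.

Definition kg_const := 2 / `|b| * schur_const m%:num `|b|.

Lemma kg_const_ge0 : 0 <= kg_const.
Proof. by rewrite mulr_ge0 ?divr_ge0 ?schur_const_ge0 ?normr_gt0. Qed.

Lemma sqintegral_kg_sol psi : cmeasurable psi ->
  (sqintegral m (kg_sol psi) <= kg_const%:E * sqintegral m psi)%E.
Proof.
move=> mpsi; have msol := cmeasurable_kg_sol mpsi.
rewrite !(sqintegral_lines m j)// -ge0_integralZl//; last 3 first.
- exact: measurable_line_sqintegral.
- by move=> q _; exact: line_sqintegral_ge0.
- by rewrite lee_fin kg_const_ge0.
apply: ge0_le_integral => //.
- by move=> q _; exact: line_sqintegral_ge0.
- exact: measurable_line_sqintegral.
- by apply: emeasurable_funM; [exact: measurable_cst|exact: measurable_line_sqintegral].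
- move=> q _; rewrite /line_sqintegral.
  under eq_integral do rewrite kg_sol_insert.
  apply: line_sol_weighted => //.
  - exact: transverse_energy_ge.
  - exact: (measurable_insert j q mpsi.1).
  - exact: (measurable_insert j q mpsi.2).
  - have [ms1 ms2] := msol.
    apply: measurable_funD; apply: measurable_funX.
    + have := measurable_insert j q ms1; apply: eq_measurable_fun => t _.
      by rewrite kg_sol_insert.
    + have := measurable_insert j q ms2; apply: eq_measurable_fun => t _.
      by rewrite kg_sol_insert.
Qed.

Lemma kg_sol_sqint psi : psi \in sqint m -> kg_sol psi \in sqint m.
Proof.
rewrite !inE => -[mpsi fin]; split; first exact: cmeasurable_kg_sol.
apply: le_lt_trans (sqintegral_kg_sol mpsi) _.
by rewrite lte_mul_pinfty// lee_fin kg_const_ge0.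
Qed.

Lemma norm_r_kg_sol psi : psi \in sqint m ->
  norm_r m (kg_sol psi) <= Num.sqrt kg_const * norm_r m psi.
Proof.
rewrite inE => -[mpsi fin].
exact: le_norm_r kg_const_ge0 fin (sqintegral_kg_sol mpsi).
Qed.

End solution_operator.

(** * Absolutely continuous functions with complex values *)

Section complex_absolute_continuity.
Context {R : realType}.
Local Notation leb := (@lebesgue_measure R).

Lemma loc_abs_continuousP (g : R -> R[i]) : loc_abs_continuous g <->
  loc_abs_cont (fun t => complex.Re (g t)) /\ loc_abs_cont (fun t => complex.Im (g t)).
Proof.
have leRe (z : R[i]) : `|complex.Re z| <= normc z.
  by case: z => x y /=; rewrite -sqrtr_sqr ler_wsqrtr// lerDl sqr_ge0.
have leIm (z : R[i]) : `|complex.Im z| <= normc z.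
  by case: z => x y /=; rewrite -sqrtr_sqr ler_wsqrtr// lerDr sqr_ge0.
have leN (z : R[i]) : normc z <= `|complex.Re z| + `|complex.Im z|.
  case: z => x y /=; rewrite -[leRHS]ger0_norm ?addr_ge0// -[leRHS]sqrtr_sqr ler_wsqrtr//.
  rewrite sqrrD !real_normK ?num_real// lerD2r lerDl mulrn_wge0//; exact: mulr_ge0.
have ReB (z w : R[i]) : complex.Re (z - w) = complex.Re z - complex.Re w.
  by case: z w => [? ?] [? ?].
have ImB (z w : R[i]) : complex.Im (z - w) = complex.Im z - complex.Im w.
  by case: z w => [? ?] [? ?].
split=> [acg|[ac1 ac2] a b e e0].
  split=> a b e e0; have [d d0 acd] := acg a b e e0; exists d => // k c c' bnd dis len;
    apply: le_lt_trans (acd k c c' bnd dis len); apply: ler_sum => i _.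
    by rewrite -ReB.
  by rewrite -ImB.
have e20 : 0 < e / 2 by rewrite divr_gt0.
have [d1 d10 acd1] := ac1 a b _ e20; have [d2 d20 acd2] := ac2 a b _ e20.
exists (Num.min d1 d2); first by rewrite lt_min d10.
move=> k c d bnd dis; rewrite lt_min => /andP[len1 len2].
rewrite (splitr e); apply: le_lt_trans (ltrD (acd1 k c d bnd dis len1) (acd2 k c d bnd dis len2)).
by rewrite -big_split/=; apply: ler_sum => i _; rewrite -ReB -ImB.
Qed.

Lemma line_solution_lin (a b c1 c2 : R) (g1 g2 f1 f2 g1' g2' f1' f2' : R -> R) :
  line_solution a b g1 g2 f1 f2 -> line_solution a b g1' g2' f1' f2' ->
  line_solution a b
    (fun t => c1 * g1 t - c2 * g2 t + g1' t) (fun t => c1 * g2 t + c2 * g1 t + g2' t)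
    (fun t => c1 * f1 t - c2 * f2 t + f1' t) (fun t => c1 * f2 t + c2 * f1 t + f2' t).
Proof.
move=> [ac1 ac2 df] [ac1' ac2' df']; split.
- by move=> p q; apply: abs_contD => //; apply: abs_contB => //; exact: abs_contZ.
- by move=> p q; apply: abs_contD => //; apply: abs_contD => //; exact: abs_contZ.
move: df df'; apply: filterS2; first exact: (ae_filter_ringOfSetsType leb).
by move=> t [d1 d2] [d1' d2']; split; apply: is_derive_eq; rewrite /GRing.scale/=; ring.
Qed.

Lemma line_solution_ae (a b : R) (g1 g2 g1' g2' f1 f2 : R -> R) :
  {ae leb, forall t, g1 t = g1' t /\ g2 t = g2' t} ->
  line_solution a b g1 g2 f1 f2 -> line_solution a b g1' g2' f1 f2.
Proof.
move=> gg [ac1 ac2 df]; split => //.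
move: gg df; apply: filterS2; first exact: (ae_filter_ringOfSetsType leb).
by move=> t [-> ->].
Qed.

Lemma continuous_ae_eq (f g : R -> R) : continuous f -> continuous g ->
  {ae leb, forall t, f t = g t} -> f = g.
Proof.
move=> cf cg [N [mN N0 Nsub]]; apply/funext => x; apply: contrapT => fgx.
have : \forall y \near x, f y - g y != 0.
  have cfg : {for x, continuous (fun y => f y - g y)} by apply: cvgB; [exact: cf|exact: cg].
  have : f x - g x != 0 by rewrite subr_eq0; apply/eqP.
  exact: (cvgr_neq0 _ cfg).
move=> /nbhs_ballP[r r0 rfg].
have sub : ball x r `<=` N.
  by move=> y /rfg; rewrite subr_eq0 => /eqP fgy; apply: Nsub => /= fgy'; apply: fgy.
have : (leb (ball x r) <= leb N)%E.
  by apply: le_measure => //; rewrite inE//; exact: measurable_ball.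
rewrite [X in (_ <= X)%E]N0 lebesgue_measure_ball ?(ltW r0)// lee_fin.
by rewrite leNgt pmulrn_lgt0// r0.
Qed.

Definition rational (i : nat) : R := if unpickle i is Some q then ratr (q : rat) else 0.

(** Differentiability tested on countably many increments: the points where it holds form a
    measurable set, and for continuous functions it is no weaker than differentiability. *)
Definition rational_slope (f : R -> R) (x d : R) := forall k : nat, exists l : nat,
  forall i : nat, `|rational i| < l.+1%:R^-1 ->
    `|f (x + rational i) - f x - d * rational i| <= k.+1%:R^-1 * `|rational i|.

Let inv_trunc (r : R) : 0 < r -> (Num.trunc r^-1).+1%:R^-1 < r.
Proof. by move=> r0; rewrite -[ltRHS]invrK ltf_pV2 ?posrE ?invr_gt0// truncnS_gt. Qed.

Lemma is_derive_rational_slope (f : R -> R) (x d : R) :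
  is_derive x 1 f d -> rational_slope f x d.
Proof.
move=> /is_derive_localP fd k.
have k0 : 0 < k.+1%:R^-1 :> R by rewrite invr_gt0.
have [r r0 rf] := fd _ k0.
exists (Num.trunc r^-1) => i ir; have := rf (x + rational i).
by rewrite addrAC subrr add0r; apply; apply: lt_trans ir (inv_trunc r0).
Qed.

Lemma rational_slope_is_derive (f : R -> R) (x d : R) : continuous f ->
  rational_slope f x d -> is_derive x 1 f d.
Proof.
move=> cf slope; apply/is_derive_localP => e e0.
have [l lf] := slope (Num.trunc e^-1).
exists l.+1%:R^-1 => // y yx; rewrite leNgt; apply/negP => fy.
pose h (u : R) := `|f (x + u) - f x - d * u| - e * `|u|.
have ch : continuous h.
  move=> u; apply: cvgB.
    apply: cvg_norm; apply: cvgB; last by apply: cvgM; [exact: cvg_cst|exact: cvg_id].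
    apply: cvgB; last exact: cvg_cst.
    apply: (@continuous_comp _ _ _ (fun u => x + u) f); last exact: cf.
    by apply: cvgD; [exact: cvg_cst|exact: cvg_id].
  by apply: cvgM; [exact: cvg_cst|exact: norm_continuous].
pose O : set R := [set u | 0 < h u] `&` ball (0 : R) l.+1%:R^-1.
have oO : open O.
  apply: openI; last exact: ball_open.
  by apply: (@open_comp R R h [set y | 0 < y]) => [u _|]; [exact: ch|exact: open_gt].
have O0 : O !=set0.
  exists (y - x); split.
    by rewrite /= /h [x + (y - x)]addrC subrK subr_gt0.
  by rewrite /ball/= sub0r normrN.
have [v [[hq bq] [q _ qE]]] := dense_rat O0 oO.
have rq : rational (pickle q) = ratr q by rewrite /rational pickleK.
have := lf (pickle q); rewrite rq.
move: hq bq; rewrite -qE /ball/= sub0r normrN /h subr_gt0 => hq bq /(_ bq).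
apply/negP; rewrite -ltNge; apply: le_lt_trans hq.
by rewrite ler_wpM2r// ltW// inv_trunc.
Qed.

End complex_absolute_continuity.

(** * The position operator as an equation on lines *)

Local Open Scope quotient_scope.

Section weak_equation.
Context {R : realType} {n : nat}.
Local Notation leb := (@lebesgue_measure R).
Local Notation lebn := (@lebesgue_measure_n R).
Local Notation T := (n.+1.-tuple R).
Variables (m : {posnum R}) (j : 'I_n.+1) (z : R[i]).
Local Notation ins := (@insert_coord R n.+1 j).

(** [i df/dp_j - z f = psi] on almost every line. The exceptional points are negligible within
    each line, so that solutions can be built and compared line by line. *)
Definition solves (f psi : T -> R[i]) := \forall q \ae lebn n,
  line_solution (complex.Re z) (complex.Im z)
    (fun t => complex.Re (psi (ins q t))) (fun t => complex.Im (psi (ins q t)))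
    (fun t => complex.Re (f (ins q t))) (fun t => complex.Im (f (ins q t))).

Lemma solves_lin (c : R[i]) f1 f2 psi1 psi2 : solves f1 psi1 -> solves f2 psi2 ->
  solves (fun p => c * f1 p + f2 p) (fun p => c * psi1 p + psi2 p).
Proof.
have ReM (d u v : R[i]) : complex.Re (d * u + v) =
    complex.Re d * complex.Re u - complex.Im d * complex.Im u + complex.Re v.
  by case: d u v => [? ?] [? ?] [? ?].
have ImM (d u v : R[i]) : complex.Im (d * u + v) =
    complex.Re d * complex.Im u + complex.Im d * complex.Re u + complex.Im v.
  by case: d u v => [? ?] [? ?] [? ?].
apply: filterS2 => q s1 s2.
have := line_solution_lin (complex.Re c) (complex.Im c) s1 s2.
congr (line_solution _ _ _ _ _ _); apply/funext => t; by rewrite ?ReM ?ImM.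
Qed.

Lemma solves_ae f psi psi' : (\forall p \ae lebn n.+1, psi p = psi' p) ->
  solves f psi -> solves f psi'.
Proof.
move=> /(ae_lines j); apply: filterS2 => q pp; apply: line_solution_ae.
by apply: filterS pp; [exact: (ae_filter_ringOfSetsType leb)|move=> t ->].
Qed.

Lemma kg_sol_solves psi : complex.Im z != 0 -> psi \in sqint m ->
  solves (kg_sol j (complex.Re z) (complex.Im z) psi) psi.
Proof.
move=> z0; rewrite inE => -[mpsi fin].
have := ae_line_sqintegral_lty j mpsi fin; apply: filterS => q finq.
have mp : 0 < m%:num by [].
have mg1 := measurable_insert j q mpsi.1; have mg2 := measurable_insert j q mpsi.2.
have gfin t := exp_kernel_conv_lty mp (transverse_energy_ge m q) z0 mg1 mg2 t finq.
have := line_sol_solution (complex.Re z) z0 mg1 mg2 gfin.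
by congr (line_solution _ _ _ _ _ _); apply/funext => t; rewrite kg_sol_insert.
Qed.

(** Almost every line carries a finite weighted norm of [g], so [line_solution_unique] applies
    on it. *)
Lemma solves_zero f (g : T -> R[i]) : complex.Im z != 0 -> solves f (fun=> 0) ->
  (\forall p \ae lebn n.+1, f p = g p) -> g \in sqint m ->
  \forall p \ae lebn n.+1, f p = 0.
Proof.
move=> z0 sf fg; rewrite inE => -[mg fin].
apply: (@ae_whole_lines _ _ j [set q | forall t, f (ins q t) = 0]) => //.
have := ae_line_sqintegral_lty j mg fin; have := ae_lines j fg.
apply: filterS3 sf => q s0 fgq finq t.
have mp : 0 < m%:num by [].
have [ac1 ac2 _] := s0.
have fin' : (\int[leb]_t ((complex.Re (f (ins q t)) ^+ 2 + complex.Im (f (ins q t)) ^+ 2) /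
    line_energy (transverse_energy m q) t)%:E < +oo)%E.
  rewrite (_ : integral _ _ _ = line_sqintegral m j g q)//; apply: ae_eq_integral => //.
  - apply/measurable_EFinP; apply: measurable_funM; last exact: measurable_line_energyV mp (transverse_energy_ge m q).
    by apply: measurable_funD; apply: measurable_funX; apply: continuous_measurable_fun; exact: loc_abs_cont_continuous.
  - apply/measurable_EFinP; apply: measurable_funM; last exact: measurable_line_energyV mp (transverse_energy_ge m q).
    apply: measurable_funD; apply: measurable_funX.
      exact: (measurable_insert j q mg.1).
    exact: (measurable_insert j q mg.2).
  - by apply: filterS fgq; [exact: (ae_filter_ringOfSetsType leb)|move=> s -> _].
have [e1 e2] := line_solution_unique mp (transverse_energy_ge m q) z0 s0 fin' t.
by case: (f (ins q t)) e1 e2 => x y /= -> ->.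
Qed.

(** Two continuous functions that agree almost everywhere on a line agree on all of it. *)
Lemma ae_eq_lines (f g : T -> R[i]) :
  (\forall p \ae lebn n.+1, f p = g p) ->
  (\forall q \ae lebn n, loc_abs_continuous (fun t => f (ins q t))) ->
  (\forall q \ae lebn n, loc_abs_continuous (fun t => g (ins q t))) ->
  \forall q \ae lebn n, forall t, f (ins q t) = g (ins q t).
Proof.
move=> /(ae_lines j) fg; apply: filterS3 fg => q fg.
move=> /loc_abs_continuousP[/loc_abs_cont_continuous cf1 /loc_abs_cont_continuous cf2].
move=> /loc_abs_continuousP[/loc_abs_cont_continuous cg1 /loc_abs_cont_continuous cg2] t.
have F := ae_filter_ringOfSetsType leb.
have e1 : complex.Re (f (ins q t)) = complex.Re (g (ins q t)).
  have r1 : {ae leb, forall s, complex.Re (f (ins q s)) = complex.Re (g (ins q s))}.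
    by apply: filterS fg => s ->.
  exact: (congr1 (@^~ t) (continuous_ae_eq cf1 cg1 r1)).
have e2 : complex.Im (f (ins q t)) = complex.Im (g (ins q t)).
  have r2 : {ae leb, forall s, complex.Im (f (ins q s)) = complex.Im (g (ins q s))}.
    by apply: filterS fg => s ->.
  exact: (congr1 (@^~ t) (continuous_ae_eq cf2 cg2 r2)).
by case: (f (ins q t)) (g (ins q t)) e1 e2 => [x y] [x' y'] /= -> ->.
Qed.

Lemma partial_derivative_insert (f : T -> R[i]) q t :
  partial_derivative j f (ins q t) =
  derive1 (fun s => complex.Re (f (ins q s))) t +i*
  derive1 (fun s => complex.Im (f (ins q s))) t.
Proof.
rewrite /partial_derivative tnth_insert_coord.
by congr (_ +i* _); congr (derive1 _ t); apply/funext => s; rewrite set_coord_insert.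
Qed.

Lemma partial_class_unique (phi chi chi' : L2r n.+1 m) :
  partial_class j phi chi -> partial_class j phi chi' -> chi = chi'.
Proof.
move=> [f [fphi acf dchi]] [g [gphi acg dchi']].
have fg : \forall p \ae lebn n.+1, f p = g p.
  by apply: filterS2 fphi gphi => p -> ->.
have pfg : \forall p \ae lebn n.+1, partial_derivative j f p = partial_derivative j g p.
  apply: (@ae_whole_lines _ _ j [set q | forall t, f (ins q t) = g (ins q t)]); last exact: ae_eq_lines.
  move=> q fgq t; rewrite !partial_derivative_insert.
  by congr (_ +i* _); congr (derive1 _ t); apply/funext => s; rewrite fgq.
rewrite -[chi]reprK -[chi']reprK; apply/pi_L2r_eq.
by apply: filterS3 pfg dchi dchi' => p pp -> ->.
Qed.

(** Absolute continuity makes the derivatives in [partial_derivative] exist almost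
    everywhere on almost every line. *)
Lemma partial_class_solves (phi chi : L2r n.+1 m) : partial_class j phi chi ->
  exists2 f, (\forall p \ae lebn n.+1, f p = repr phi p) &
    solves f (fun p => 'i * repr chi p - z * repr phi p).
Proof.
move=> [f [fphi acf dchi]]; exists f => //.
have := ae_lines j dchi; have := ae_lines j fphi.
apply: filterS3 acf => q /loc_abs_continuousP[ac1 ac2] fq dq; split => //.
have := loc_abs_cont_derivable_ae ac2; have := loc_abs_cont_derivable_ae ac1.
have F := ae_filter_ringOfSetsType leb.
move=> d1 d2.
have := @filterI _ _ F _ _ (@filterI _ _ F _ _ d1 d2) (@filterI _ _ F _ _ fq dq).
apply: filterS => t [[dt1 dt2] [ft dt]].
rewrite -ft dt partial_derivative_insert.
set D1 := derive1 _ t; set D2 := derive1 _ t.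
have i1 : is_derive t 1 (fun t0 => complex.Re (f (ins q t0))) D1.
  by apply: DeriveDef => //; rewrite /D1 derive1E.
have i2 : is_derive t 1 (fun t0 => complex.Im (f (ins q t0))) D2.
  by apply: DeriveDef => //; rewrite /D2 derive1E.
split; [apply: is_derive_eq i1 _|apply: is_derive_eq i2 _];
  case: (f (ins q t)) => x y /=; case: z => a b /=; ring.
Qed.

End weak_equation.

Section strong_equation.
Context {R : realType} {n : nat}.
Local Notation leb := (@lebesgue_measure R).
Local Notation lebn := (@lebesgue_measure_n R).
Local Notation T := (n.+1.-tuple R).
Variables (m : {posnum R}) (j : 'I_n.+1) (z : R[i]).
Local Notation ins := (@insert_coord R n.+1 j).

Definition slope_set (h d : T -> R) : set T :=
  [set p | rational_slope (fun s => h (set_coord j p s)) (tnth p j) (d p)].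

Lemma measurable_slope_set h d : measurable_fun setT h -> measurable_fun setT d ->
  measurable (slope_set h d).
Proof.
move=> mh md.
pose A (k l i : nat) : set T := [set p | `|@rational R i| < l.+1%:R^-1 ->
  `|h (set_coord j p (tnth p j + @rational R i)) - h (set_coord j p (tnth p j)) -
    d p * @rational R i| <= k.+1%:R^-1 * `|@rational R i| ].
have -> : slope_set h d = \bigcap_k \bigcup_l \bigcap_i A k l i.
  apply/seteqP; split => [p hp k _|p hp k].
    by have [l hl] := hp k; exists l => // i _; exact: hl.
  by have [l _ hl] := hp k I; exists l => i; exact: hl.
apply: bigcapT_measurable => k; apply: bigcupT_measurable => l.
apply: bigcapT_measurable => i; rewrite /A.
have [ri|ri] := boolP (`|@rational R i| < l.+1%:R^-1); last first.
  by rewrite (_ : [set _ | _] = setT)//; apply/seteqP; split.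
have mset (r : R) : measurable_fun setT (fun p : T => h (set_coord j p (tnth p j + r))).
  apply: (measurableT_comp mh).
  have mpair : measurable_fun setT (fun p : T => (p, (tnth p j + r) : measurableTypeR R)).
    apply: measurable_fun_pair; first exact: measurable_id.
    by apply: measurable_funD; [exact: measurable_tnth|exact: measurable_cst].
  exact: (measurableT_comp (measurable_set_coord j) mpair).
pose u p : R := `|h (set_coord j p (tnth p j + @rational R i)) -
    h (set_coord j p (tnth p j)) - d p * @rational R i|.
have mu : measurable_fun setT u.
  apply: measurableT_comp => //; apply: measurable_funB.
    apply: measurable_funB; first exact: mset.
    by have := mset 0; apply: eq_measurable_fun => p _; rewrite addr0.
  by apply: measurable_funM => //; exact: measurable_cst.
rewrite (_ : [set _ | _] = u @^-1` `]-oo, k.+1%:R^-1 * `|@rational R i|]%classic).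
  by rewrite -[X in measurable X]setTI; apply: mu => //; exact: measurable_itv.
by apply/seteqP; split => p /=; rewrite in_itv/= => hp; [exact: hp|move=> _; exact: hp].
Qed.

(** [slope_set] is a measurable substitute for the set of points of differentiability, with
    which it coincides on the lines where [h] is continuous. *)
Lemma ae_is_derive_lines (h d : T -> R) :
  measurable_fun setT h -> measurable_fun setT d ->
  (\forall q \ae lebn n, continuous (fun t => h (ins q t))) ->
  (\forall q \ae lebn n, {ae leb, forall t : R,
    is_derive t 1 (fun s => h (ins q s)) (d (ins q t))}) ->
  \forall p \ae lebn n.+1, is_derive (tnth p j : R) 1 (fun s : R => h (set_coord j p s)) (d p).
Proof.
move=> mh md ch dh.
have lineE q t : (fun s => h (set_coord j (ins q t) s)) = (fun s => h (ins q s)).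
  by apply/funext => s; rewrite set_coord_insert.
have aeS : \forall p \ae lebn n.+1, slope_set h d p.
  apply: (ae_of_lines (j := j)); first exact: measurable_slope_set.
  apply: filterS dh => q; apply: filterS; first exact: (ae_filter_ringOfSetsType leb).
  move=> t /is_derive_rational_slope; rewrite /slope_set /=.
  by rewrite lineE tnth_insert_coord.
have aeC : \forall p \ae lebn n.+1, continuous (fun s => h (set_coord j p s)).
  by apply: (ae_whole_lines (j := j) _ ch) => q cq t; rewrite lineE.
by apply: filterS2 aeS aeC => p sp cp; exact: rational_slope_is_derive.
Qed.

(** A solution of the equation on lines is its own absolutely continuous representative, and
    the equation gives its partial derivative. *)
Lemma solves_partial_class (f psi : sqint_fun m) : solves j z f psi ->
  partial_class j (\pi_(L2r n.+1 m) f) (\pi_(L2r n.+1 m) (- 'i *: (psi + z *: f))).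
Proof.
move=> sf; set h := - 'i *: (psi + z *: f).
have hE p : h p = - 'i * (psi p + z * f p) by [].
have [mf _] : cmeasurable f /\ (sqintegral m f < +oo)%E by have := valP f; rewrite inE.
have [mh _] : cmeasurable h /\ (sqintegral m h < +oo)%E by have := valP h; rewrite inE.
have hRe p : complex.Re (h p) = complex.Im z * complex.Re (f p) +
    complex.Re z * complex.Im (f p) + complex.Im (psi p).
  by rewrite hE; case: (f p) (psi p) z => [? ?] [? ?] [? ?] /=; ring.
have hIm p : complex.Im (h p) = complex.Im z * complex.Im (f p) -
    complex.Re z * complex.Re (f p) - complex.Re (psi p).
  by rewrite hE; case: (f p) (psi p) z => [? ?] [? ?] [? ?] /=; ring.
exists f; split.
- by apply: filterS (repr_L2r_pi f) => p ->.
- apply: filterS sf => q [ac1 ac2 _].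
  exact: (loc_abs_continuousP (fun t => f (ins q t))).2.
have d1 : \forall p \ae lebn n.+1, is_derive (tnth p j : R) 1
    (fun s : R => complex.Re (f (set_coord j p s))) (complex.Re (h p)).
  apply: (@ae_is_derive_lines (fun p => complex.Re (f p)) (fun p => complex.Re (h p)) mf.1 mh.1).
    by apply: filterS sf => q [/loc_abs_cont_continuous].
  apply: filterS sf => q [_ _]; apply: filterS; first exact: (ae_filter_ringOfSetsType leb).
  by move=> t [+ _]; rewrite hRe.
have d2 : \forall p \ae lebn n.+1, is_derive (tnth p j : R) 1
    (fun s : R => complex.Im (f (set_coord j p s))) (complex.Im (h p)).
  apply: (@ae_is_derive_lines (fun p => complex.Im (f p)) (fun p => complex.Im (h p)) mf.2 mh.2).
    by apply: filterS sf => q [_ /loc_abs_cont_continuous].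
  apply: filterS sf => q [_ _]; apply: filterS; first exact: (ae_filter_ringOfSetsType leb).
  by move=> t [_]; rewrite hIm.
apply: filterS3 d1 d2 (repr_L2r_pi h) => p [_ e1] [_ e2] ->.
rewrite /partial_derivative !derive1E e1 e2.
by case: (h p).
Qed.

End strong_equation.

(** * The resolvent at nonreal points *)

Section closed_of_resolvent.
Context {K : numFieldType} {V : normedModType K}.

(** If [B] inverts [A - z], then [(x, y)] is in the graph iff [B (y - z x) = x], a closed
    condition. *)
Lemma resolvent_closed_operator (A : unbounded_operator V) (z : K) :
  resolvent_set A z -> closed_operator A.
Proof.
move=> [B [cB AB BA]]; rewrite /closed_operator.
pose g (u : V * V) := B (u.2 - z *: u.1) - u.1.
have -> : operator_graph A = g @^-1` [set 0].
  apply/seteqP; split => [[x y] [/= Dx yE]|[x y] /eqP].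
    by rewrite /g/= yE BA// subrr.
  rewrite /g/= subr_eq0 => /eqP Bx; rewrite /operator_graph/=.
  have [DB AE] := AB (y - z *: x); rewrite Bx in DB AE.
  by split => //; apply: (addIr (- (z *: x))); rewrite AE.
apply: closed_comp.
  move=> u _; apply: cvgB; last exact: cvg_fst.
  apply: (@continuous_comp _ _ _ (fun u : V * V => u.2 - z *: u.1) B); last exact: cB.
  by apply: cvgB; [exact: cvg_snd|apply: cvgZr; exact: cvg_fst].
exact/accessible_closed_set1/hausdorff_accessible/norm_hausdorff.
Qed.

End closed_of_resolvent.

Section resolvent.
Context {R : realType} {n : nat}.
Local Notation lebn := (@lebesgue_measure_n R).
Local Notation T := (n.+1.-tuple R).
Variables (m : {posnum R}) (j : 'I_n.+1).
Local Notation L2 := (L2r n.+1 m).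
Local Notation Q := (kg_position m j).

Lemma scale_pi (c : R[i]) (f : sqint_fun m) : c *: \pi_L2 f = \pi_L2 (c *: f).
Proof. exact: scale_L2r_pi. Qed.

Lemma add_pi (f g : sqint_fun m) : \pi_L2 f + \pi_L2 g = \pi_L2 (f + g).
Proof. by rewrite pi_addr. Qed.

Lemma repr_lin (c : R[i]) (x y : L2) :
  \forall p \ae lebn n.+1, repr (c *: x + y) p = c * repr x p + repr y p.
Proof.
have -> : c *: x + y = \pi_L2 (c *: repr x + repr y).
  by rewrite -add_pi -scale_pi !reprK.
exact: repr_L2r_pi.
Qed.

Lemma repr_scale (c : R[i]) (x : L2) :
  \forall p \ae lebn n.+1, repr (c *: x) p = c * repr x p.
Proof.
have -> : c *: x = \pi_L2 (c *: repr x) by rewrite -scale_pi reprK.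
exact: repr_L2r_pi.
Qed.

Lemma kg_position_action (phi chi : L2) : partial_class j phi chi -> Q phi = 'i *: chi.
Proof.
move=> pc; congr (_ *: _).
by apply: (partial_class_unique (j := j) _ pc); exact: (getPex (ex_intro _ chi pc)).
Qed.

(** The difference of the solutions satisfies the homogeneous equation and has a square
    integrable class. *)
Lemma solves_unique (z : R[i]) (f f' psi psi' : T -> R[i]) (phi phi' : L2) :
  complex.Im z != 0 -> solves j z f psi -> solves j z f' psi' ->
  (\forall p \ae lebn n.+1, psi p = psi' p) ->
  (\forall p \ae lebn n.+1, f p = repr phi p) ->
  (\forall p \ae lebn n.+1, f' p = repr phi' p) -> phi = phi'.
Proof.
move=> z0 sf sf' pp fphi fphi'.
have s0 : solves j z (fun p => -1 * f p + f' p) (fun=> 0).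
  apply: solves_ae (solves_lin (-1) sf sf').
  by apply: filterS pp => p ->; rewrite mulN1r addNr.
have fE : \forall p \ae lebn n.+1, -1 * f p + f' p = (- repr phi + repr phi' : sqint_fun m) p.
  by apply: filterS2 fphi fphi' => p -> ->; rewrite mulN1r.
have := solves_zero z0 s0 fE (valP (- repr phi + repr phi')).
move=> f0; rewrite -[phi]reprK -[phi']reprK; apply/pi_L2r_eq.
apply: filterS3 f0 fphi fphi' => p + <- <-.
by rewrite mulN1r addrC => /eqP; rewrite subr_eq0 => /eqP.
Qed.

Section nonreal.
Variable z : R[i].
Hypothesis z0 : complex.Im z != 0.
Local Notation a := (complex.Re z).
Local Notation b := (complex.Im z).

Definition resolvent_fun (y : L2) : sqint_fun m :=
  SqintFun (kg_sol_sqint j a z0 (valP (repr y))).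

Definition kg_resolvent (y : L2) : L2 := \pi_L2 (resolvent_fun y).

Lemma resolvent_fun_solves y : solves j z (resolvent_fun y) (repr y).
Proof. by apply: kg_sol_solves => //; exact: (valP (repr y)). Qed.

Lemma kg_resolvent_linear : linear kg_resolvent.
Proof.
move=> c x y; apply: (solves_unique z0 (resolvent_fun_solves _)
  (solves_lin c (resolvent_fun_solves x) (resolvent_fun_solves y)) (repr_lin c x y)).
  by apply: filterS (repr_L2r_pi (resolvent_fun (c *: x + y))) => p ->.
have := repr_lin c (kg_resolvent x) (kg_resolvent y).
apply: filterS3 (repr_L2r_pi (resolvent_fun x)) (repr_L2r_pi (resolvent_fun y)).
by move=> p ex ey ->; rewrite ex ey.
Qed.

Lemma kg_resolvent_norm y :
  `|kg_resolvent y| <= (Num.sqrt (kg_const m b))%:C * `|y|.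
Proof.
rewrite -[X in X <= _]/(norm_L2r (kg_resolvent y)) -[X in _ * X]/(norm_L2r y).
rewrite /norm_L2r -rmorphM/= lecR (eq_norm_r (repr_L2r_pi _)).
exact: norm_r_kg_sol (valP (repr y)).
Qed.

(** The solution operator is a right inverse of [Q - z] by construction, and a left inverse by
    uniqueness. *)
Lemma kg_position_resolvent : resolvent_set Q z.
Proof.
pose B : {linear L2 -> L2} := HB.pack kg_resolvent
  (GRing.isLinear.Build _ _ _ _ kg_resolvent kg_resolvent_linear).
exists B; split.
- apply: bounded_linear_continuous; apply/linear_boundedP.
  exists (Num.sqrt (kg_const m b))%:C; split; first by apply/ger0_real; rewrite lecR sqrtr_ge0.
  move=> r /ltW hr x; apply: le_trans (kg_resolvent_norm x) _.
  by rewrite ler_wpM2r.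
- move=> y; have pc := solves_partial_class (resolvent_fun_solves y).
  split; first by exists (\pi_L2 (- 'i *: (repr y + z *: resolvent_fun y))).
  rewrite (kg_position_action pc) !scale_pi.
  have -> : 'i *: (- 'i *: (repr y + z *: resolvent_fun y)) = repr y + z *: resolvent_fun y.
    rewrite scalerA mulrN -expr2 (_ : 'i ^+ 2 = -1) ?opprK ?scale1r//.
    by rewrite sqr_i.
  by rewrite -add_pi addrK reprK.
- move=> x [chi pc]; rewrite (kg_position_action pc).
  have [f fx sf] := partial_class_solves z pc.
  apply: (solves_unique z0 (resolvent_fun_solves ('i *: chi - z *: x)) sf _ _ fx).
    rewrite -scaleNr.
    apply: filterS2 (repr_lin 'i chi (- z *: x)) (repr_scale (- z) x) => p -> ->.
    by rewrite mulNr.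
  by apply: filterS (repr_L2r_pi (resolvent_fun ('i *: chi - z *: x))) => p ->.
Qed.

End nonreal.
End resolvent.

(** * Approximate eigenvectors at real points *)

Section profile.
Context {R : realType}.
Variable e : R.
Hypothesis e0 : 0 < e.

(** A profile with [|g'| <= e g] that decays exponentially: half of the hyperbolic secant. *)
Definition profile (t : R) : R := (expR (e * t) + expR (- (e * t)))^-1.
Definition profile' (t : R) : R := - (e * (expR (e * t) - expR (- (e * t)))) * profile t ^+ 2.

Let den_gt0 t : 0 < expR (e * t) + expR (- (e * t)).
Proof. by rewrite addr_gt0 ?expR_gt0. Qed.

Lemma profile_gt0 t : 0 < profile t.
Proof. by rewrite invr_gt0. Qed.

Lemma is_derive_profile (t : R) : is_derive t 1 profile (profile' t).
Proof.
have dn : expR (e * t) + expR (- (e * t)) != 0 by rewrite gt_eqF.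
have dden : is_derive t 1 (fun s : R => expR (e * s) + expR (- (e * s)))
    (e * (expR (e * t) - expR (- (e * t)))).
  by apply: is_derive_eq; rewrite /GRing.scale/=; ring.
have dV := @is_deriveV _ (fun s : R => expR (e * s) + expR (- (e * s))) t _ 1 dn dden.
apply: is_derive_eq dV _.
by rewrite /profile' /profile /GRing.scale/= exprVn; ring.
Qed.

Lemma continuous_profile : continuous profile.
Proof. exact: is_derive_continuous is_derive_profile. Qed.

Lemma continuous_profile' : continuous profile'.
Proof.
have ce (c : R) : continuous (fun s : R => expR (c * s)).
  by apply: continuous_scale; exact: continuous_expR.
have ce' : continuous (fun s : R => expR (- (e * s))).
  have -> : (fun s : R => expR (- (e * s))) = (fun s : R => expR (- e * s)).
    by apply/funext => s; rewrite mulNr.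
  exact: ce.
move=> t; apply: cvgM; last first.
  by apply: (@continuous_comp _ _ _ profile (fun x => x ^+ 2)); [exact: continuous_profile|exact: exprn_continuous].
apply: cvgN; apply: cvgM; first exact: cvg_cst.
by apply: cvgB; [exact: ce|exact: ce'].
Qed.

Lemma normr_profile' t : `|profile' t| <= e * profile t.
Proof.
rewrite /profile' normrM normrN normrM (ger0_norm (ltW e0)) -mulrA ler_wpM2l ?(ltW e0)//.
rewrite (ger0_norm (sqr_ge0 _)) expr2 mulrA ler_piMl ?(ltW (profile_gt0 t))//.
rewrite /profile ler_pdivrMr// mul1r; apply: le_trans (ler_normB _ _) _.
by rewrite !ger0_norm ?expR_ge0.
Qed.

Lemma profile_sqr_le t : profile t ^+ 2 <= exp_kernel e 0 t.
Proof.
rewrite /exp_kernel sub0r normrN.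
have le : profile t <= expR (- (e * `|t|)).
  rewrite expRN /profile lef_pV2 ?posrE ?expR_gt0//.
  case: (leP 0 t) => t0; first by rewrite ger0_norm// lerDl expR_ge0.
  by rewrite ltr0_norm// mulrN lerDr expR_ge0.
have le1 : expR (- (e * `|t|)) <= 1.
  by rewrite -expR0 ler_expR oppr_le0 mulr_ge0// ltW.
rewrite expr2; apply: le_trans (ler_wpM2l (ltW (profile_gt0 t)) (le_trans le le1)) _.
by rewrite mulr1.
Qed.

End profile.

Section approximate_eigenvector.
Context {R : realType} {n : nat}.
Local Notation leb := (@lebesgue_measure R).
Local Notation lebn := (@lebesgue_measure_n R).
Local Notation T := (n.+1.-tuple R).
Variables (m : {posnum R}) (j : 'I_n.+1) (lam e : R).
Hypothesis e0 : 0 < e.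
Local Notation ins := (@insert_coord R n.+1 j).

(** Bounded in the directions other than [j], so that only the decay along [j] matters. *)
Definition slab : set T := box (fun i => if i == j then setT else `]-1, 1[%classic).

Lemma measurable_slab : measurable slab.
Proof. by apply: measurable_box => i; case: ifP => _ //; exact: measurable_itv. Qed.

Lemma slab_insert q t : slab (ins q t) <-> @cube R n 1 q.
Proof.
split=> [h i|h i].
  have := h (lift j i); rewrite eq_sym (negbTE (neq_lift _ _)) tnth_mktuple liftK.
  by [].
rewrite tnth_mktuple; case: unliftP => [k ->|->]; last by rewrite eqxx.
by rewrite eq_sym (negbTE (neq_lift _ _)); exact: h.
Qed.

Lemma indic_slab_insert q t : \1_slab (ins q t) = \1_(cube 1) q :> R.
Proof.
by rewrite !indicE; congr (nat_of_bool _)%:R; apply/idP/idP; rewrite !inE => /slab_insert.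
Qed.

(** The plane wave [e^(- i lam p_j)] solves [i df/dp_j = lam f] but is not square integrable;
    it is multiplied by a slowly varying profile. *)
Definition wave (p : T) : R[i] :=
  (\1_slab p * profile e (tnth p j) * cos (lam * tnth p j)) +i*
  (- (\1_slab p * profile e (tnth p j) * sin (lam * tnth p j))).

(** [(Q - lam) wave]: the only term left is the derivative of the profile. *)
Definition wave_defect (p : T) : R[i] :=
  (\1_slab p * profile' e (tnth p j) * sin (lam * tnth p j)) +i*
  (\1_slab p * profile' e (tnth p j) * cos (lam * tnth p j)).

Let mcoord (h : R -> R) : continuous h -> measurable_fun setT (fun p : T => h (tnth p j)).
Proof.
move=> ch; apply: (measurableT_comp _ (measurable_tnth j)).
exact: continuous_measurable_fun.
Qed.

Let ccos : continuous (fun t : R => cos (lam * t)).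
Proof.
by apply: continuous_scale; exact: continuous_cos.
Qed.

Let csin : continuous (fun t : R => sin (lam * t)).
Proof.
by apply: continuous_scale; exact: continuous_sin.
Qed.

Let mslab : measurable_fun setT (\1_slab : T -> R).
Proof. exact: measurable_indic measurable_slab. Qed.

Let mprofile := mcoord (@continuous_profile R e).
Let mprofile' := mcoord (@continuous_profile' R e).

Lemma cmeasurable_wave : cmeasurable wave.
Proof.
split=> /=.
  exact: measurable_funM (measurable_funM mslab mprofile) (mcoord ccos).
apply: measurableT_comp => //.
exact: measurable_funM (measurable_funM mslab mprofile) (mcoord csin).
Qed.

Lemma cmeasurable_wave_defect : cmeasurable wave_defect.
Proof.
split=> /=.
  exact: measurable_funM (measurable_funM mslab mprofile') (mcoord csin).
exact: measurable_funM (measurable_funM mslab mprofile') (mcoord ccos).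
Qed.

Lemma normc_wave p : normc (wave p) ^+ 2 = (\1_slab p * profile e (tnth p j)) ^+ 2.
Proof.
rewrite normc_sqr /= sqrrN !exprMn -mulrDr cos2Dsin2 mulr1.
by [].
Qed.

Lemma normc_wave_defect p : normc (wave_defect p) ^+ 2 <= e ^+ 2 * normc (wave p) ^+ 2.
Proof.
rewrite normc_wave normc_sqr /= ![(_ * cos _) ^+ 2]exprMn ![(_ * sin _) ^+ 2]exprMn.
rewrite -mulrDr [X in _ * X]addrC cos2Dsin2 mulr1 ![(\1_slab p * _) ^+ 2]exprMn [leRHS]mulrCA.
rewrite ler_wpM2l ?sqr_ge0// -exprMn -[leLHS]real_normK ?num_real//.
have p0 := mulr_ge0 (ltW e0) (ltW (profile_gt0 e (tnth p j))).
by rewrite ler_sqr ?nnegrE// normr_profile'.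
Qed.

Lemma wave_sqint : wave \in sqint m.
Proof.
rewrite inE; split; first exact: cmeasurable_wave.
rewrite (sqintegral_lines m j cmeasurable_wave).
pose c := (m%:num^-1 * (2 / e)).
have c0 : 0 <= c by rewrite mulr_ge0 ?divr_ge0 ?invr_ge0 ?ltW.
have mcube : measurable (@cube R n 1) by apply: measurable_box => i; exact: measurable_itv.
apply: (@le_lt_trans _ _ (\int[@sigma_finite_lebesgue R n]_q (c%:E * (\1_(cube 1) q)%:E))%E).
  apply: ge0_le_integral => //.
  - by move=> q _; exact: line_sqintegral_ge0.
  - exact: measurable_line_sqintegral cmeasurable_wave.
  - apply: emeasurable_funM; first exact: measurable_cst.
    by apply/measurable_EFinP; exact: measurable_indic.
  - move=> q _; rewrite /line_sqintegral.
    have mp : 0 < m%:num by [].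
    have E0 := line_energy_gt0 mp (transverse_energy_ge m q).
    apply: (@le_trans _ _ (\int[leb]_t ((m%:num^-1 * \1_(cube 1) q)%:E * (exp_kernel e 0 t)%:E))%E).
      apply: ge0_le_integral => //.
      - by move=> t _; rewrite lee_fin divr_ge0 ?addr_ge0 ?sqr_ge0// ltW.
      - apply/measurable_EFinP; apply: measurable_funM; last exact: measurable_line_energyV mp (transverse_energy_ge m q).
        apply: measurable_funD; apply: measurable_funX.
          exact: (measurable_insert j q cmeasurable_wave.1).
        exact: (measurable_insert j q cmeasurable_wave.2).
      - apply: emeasurable_funM; first exact: measurable_cst.
        by apply/measurable_EFinP; exact: measurable_exp_kernel.
      - move=> t _; rewrite -EFinM lee_fin -normc_sqr normc_wave tnth_insert_coord.
        rewrite indic_slab_insert exprMn [_ / _]mulrC -!mulrA.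
        apply: ler_pM.
        - by rewrite invr_ge0 ltW.
        - by rewrite mulrA mulr_ge0 ?sqr_ge0 -?expr2 ?sqr_ge0.
        - by rewrite lef_pV2 ?posrE// (line_energy_ge mp (transverse_energy_ge m q)).
        - rewrite indicE; case: (_ \in _); rewrite ?mul0r// !mul1r.
          exact: profile_sqr_le.
    rewrite ge0_integralZl//.
    + rewrite [X in (_ * X)%E](_ : _ = (2 / e)%:E); last exact: integral_expR_abs.
      by rewrite -!EFinM lee_fin /c mulrAC.
    + by apply/measurable_EFinP; exact: measurable_exp_kernel.
    + by move=> t _; rewrite lee_fin exp_kernel_ge0.
rewrite ge0_integralZl//; last by apply/measurable_EFinP; exact: measurable_indic.
rewrite integral_indic// setIT lte_mul_pinfty//.
exact: cube_lty.
Qed.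

Lemma sqintegral_wave_defect : (sqintegral m wave_defect <= (e ^+ 2)%:E * sqintegral m wave)%E.
Proof.
rewrite -[leLHS]/(\int[lebn n.+1]_p sqdensity m wave_defect p)%E.
rewrite -[X in (_ * X)%E]/(\int[lebn n.+1]_p sqdensity m wave p)%E.
have mw := measurable_sqdensity m cmeasurable_wave.
have w0 := sqdensity_ge0 m wave.
rewrite -ge0_integralZl//; last by rewrite lee_fin sqr_ge0.
apply: ge0_le_integral => //.
- by move=> p _; exact: sqdensity_ge0.
- exact: measurable_sqdensity cmeasurable_wave_defect.
- by apply: emeasurable_funM; [exact: measurable_cst|].
- move=> p _; rewrite -EFinM lee_fin mulrA ler_wpM2r ?invr_ge0 ?(ltW (energy_gt0 m p))//.
  exact: normc_wave_defect.
Qed.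

Lemma wave_defect_sqint : wave_defect \in sqint m.
Proof.
rewrite inE; split; first exact: cmeasurable_wave_defect.
apply: le_lt_trans sqintegral_wave_defect _.
have := wave_sqint; rewrite inE => -[_ fin].
by rewrite lte_mul_pinfty// lee_fin sqr_ge0.
Qed.

Lemma norm_wave_defect : norm_r m wave_defect <= e * norm_r m wave.
Proof.
have := wave_sqint; rewrite inE => -[_ fin].
have := le_norm_r (sqr_ge0 e) fin sqintegral_wave_defect.
by rewrite sqrtr_sqr ger0_norm// ltW.
Qed.

Lemma wave_solves : solves j lam%:C wave wave_defect.
Proof.
apply: aeW => q.
pose c : R := \1_(cube 1) q.
pose f1 t := c * profile e t * cos (lam * t).
pose f2 t := - (c * profile e t * sin (lam * t)).
pose g1 t := c * profile' e t * sin (lam * t).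
pose g2 t := c * profile' e t * cos (lam * t).
have d1 (t : R) : is_derive t 1 f1 (0 * f1 t + lam * f2 t + g2 t).
  have dp := is_derive_profile e t.
  by apply: is_derive_eq; rewrite /f1 /f2 /g2 /GRing.scale/=; ring.
have d2 (t : R) : is_derive t 1 f2 (0 * f2 t - lam * f1 t - g1 t).
  have dp := is_derive_profile e t.
  by apply: is_derive_eq; rewrite /f1 /f2 /g1 /GRing.scale/=; ring.
have cM (f g : R -> R) : continuous f -> continuous g -> continuous (fun t => c * f t * g t).
  by move=> cf cg t; apply: cvgM; [apply: cvgM; [exact: cvg_cst|exact: cf]|exact: cg].
have cf1 : continuous f1 by apply: cM => //; exact: continuous_profile.
have cf2 : continuous f2 by move=> t; apply: cvgN; apply: cM => //; exact: continuous_profile.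
have cg1 : continuous g1 by apply: cM => //; exact: continuous_profile'.
have cg2 : continuous g2 by apply: cM => //; exact: continuous_profile'.
have H : line_solution lam 0 g1 g2 f1 f2.
  split.
  - apply: (C1_loc_abs_cont d1) => t.
    apply: cvgD; last exact: cg2.
    by apply: cvgD; (apply: cvgM; [exact: cvg_cst|]); [exact: cf1|exact: cf2].
  - apply: (C1_loc_abs_cont d2) => t.
    apply: cvgB; last exact: cg1.
    by apply: cvgB; (apply: cvgM; [exact: cvg_cst|]); [exact: cf2|exact: cf1].
  - by apply: aeW.
move: H; congr (line_solution _ _ _ _ _ _); apply/funext => t;
  by rewrite /= indic_slab_insert tnth_insert_coord.
Qed.

(** The wave vanishes nowhere on the slab, whose measure is positive. *)
Lemma norm_wave_gt0 : 0 < norm_r m wave.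
Proof.
rewrite lt_neqAle sqrtr_ge0 andbT eq_sym; apply/negP => /eqP n0.
have /(ae_lines j) := (norm_r_eq0 (SqintFun wave_sqint)).1 n0.
move=> [N [mN N0 Nsub]].
have sub : @cube R n 1 `<=` N.
  move=> q hq; apply: Nsub => /= -[A [mA A0 Asub]].
  have A1 : A = setT.
    apply/seteqP; split => // t _; apply: Asub => /= wt.
    have : normc (wave (ins q t)) ^+ 2 = 0 by rewrite wt normc0 expr0n.
    rewrite normc_wave tnth_insert_coord indicE mem_set ?mul1r; last exact/slab_insert.
    by apply/eqP; rewrite sqrf_eq0 gt_eqF// profile_gt0.
  move: A0; rewrite A1 => A0.
  have : (leb `[0%R, 1%R]%classic <= leb setT)%E by apply: le_measure; rewrite ?inE.
  rewrite [X in (_ <= X)%E](_ : _ = 0%E); last exact: A0.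
  by rewrite lebesgue_measure_itv/= lte_fin ltr01 oppr0 adde0 lee_fin ler10.
have mcube : measurable (@cube R n 1) by apply: measurable_box => i; exact: measurable_itv.
have : lebn n (@cube R n 1) = 0%E by exact: subset_measure0 mcube mN sub N0.
rewrite lebesgue_measure_n_box; last by move=> i; exact: measurable_itv.
rewrite (eq_bigr (fun=> (2 : R)%:E)); last first.
  move=> i _; rewrite lebesgue_measure_itv/= lte_fin.
  by rewrite ifT; [rewrite -EFinD; congr EFin; ring|lra].
rewrite prodEFin => /eqP; rewrite eqe prodr_const expf_eq0.
by rewrite pnatr_eq0 andbF.
Qed.

End approximate_eigenvector.

(** * The spectrum *)

(** A bounded inverse of [A - z] would bound the norm of [x] by a fixed multiple of the norm of
    [A x - z x]. *)
Lemma approximate_eigenvalue_spectrum {K : numFieldType} {V : normedModType K}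
    (A : unbounded_operator V) (z : K) :
  (forall e : K, 0 < e -> exists x,
    [/\ domain A x, x != 0 & `|A x - z *: x| <= e * `|x|]) ->
  spectrum A z.
Proof.
move=> approx [B [cB _ BA]].
have /linear_boundedP/pinfty_ex_gt0 [k k0 Bk] : bounded_near B (nbhs (0 : V)).
  exact/linear_bounded_continuous.
(* with half of the critical constant, the norm of x is at most half of itself *)
have [|x [Dx x0 xe]] := approx (2 * k)^-1; first by rewrite invr_gt0 mulr_gt0.
have nx : 0 < `|x| by rewrite normr_gt0.
have := le_trans (Bk (A x - z *: x)) (ler_wpM2l (ltW k0) xe).
rewrite BA// invfM mulrA [k * _]mulrC mulfVK ?gt_eqF// => /(ler_wpM2l (ler0n K 2)).
rewrite mulrA divff ?pnatr_eq0// mul1r mulr_natl mulr2n gerDl => /le_lt_trans/(_ nx).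
by rewrite ltxx.
Qed.

Section real_spectrum.
Context {R : realType} {n : nat}.
Variables (m : {posnum R}) (j : 'I_n.+1).

Lemma kg_position_real_spectrum (lam : R) : spectrum (kg_position m j) lam%:C.
Proof.
apply: approximate_eigenvalue_spectrum => e e0.
have [eE e'0] : e = (complex.Re e)%:C /\ 0 < complex.Re e.
  by move: e0; case: e => a b; rewrite ltcE/= => /andP[/eqP -> ?].
move: eE e'0; move: (complex.Re e) => r -> r0.
pose f := SqintFun (wave_sqint m j lam r0).
pose g := SqintFun (wave_defect_sqint m j lam r0).
have pc := solves_partial_class (wave_solves j lam r : solves j lam%:C f g).
have normE (h : sqint_fun m) : `|\pi_(L2r n.+1 m) h| = (norm_r m h)%:C.
  by rewrite -[LHS]/(norm_L2r _) /norm_L2r (eq_norm_r (repr_L2r_pi _)).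
exists (\pi_(L2r n.+1 m) f); split; first by eexists; exact: pc.
  rewrite -normr_gt0 normE ltcR; exact: norm_wave_gt0.
rewrite (kg_position_action pc) !scale_pi.
have -> : 'i *: (- 'i *: (g + lam%:C *: f)) = g + lam%:C *: f.
  by rewrite scalerA mulrN -expr2 sqr_i opprK scale1r.
by rewrite -add_pi addrK !normE -rmorphM lecR; exact: norm_wave_defect.
Qed.

End real_spectrum.

Theorem proposition3 (R : realType) (n : nat) (n_ge1 : (1 <= n)%N)
    (m : {posnum R}) (j : 'I_n) :
  closed_operator (kg_position m j) /\
  spectrum (kg_position m j) = [set x%:C | x in [set: R]].
Proof.
case: n n_ge1 j => // n _ j; split.
  apply: (@resolvent_closed_operator _ _ _ 'i).
  by apply: kg_position_resolvent; rewrite /= oner_eq0.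
apply/seteqP; split => [z|_ [x _ <-]]; last exact: kg_position_real_spectrum.
case: (eqVneq (complex.Im z) 0) => [z0 _|z0 /(_ (kg_position_resolvent m j z0))//].
by exists (complex.Re z) => //; case: z z0 => a b /= ->.
Qed.
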